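(* Let $1<p<q<\infty$, and let the measure space $(\Omega,\Sigma,\mathrm{mes})$, the tree $\mathcal{A}$, the bijection $\hat F$, the spaces $X_p$, $Y_q$, $\mathcal{P}$ satisfy the standing conditions and Assumptions 1, 2 and 3 stated in the context (in particular $k_*=1$ and $\nu_t\le c_3\overline\nu_t$ with $\overline\nu_t=2^{\gamma_*2^t}\psi_*(2^{2^t})$, $t\ge t_0$). Let $\delta_*>\left(\frac1q-\frac1p\right)_+$. Then, for all sufficiently large $n\in\mathbb{N}$ and with constants depending only on $\mathfrak{Z}_0$, $$e_n(I:\hat X_p(\Omega)\to Y_q(\Omega))\lesssim n^{\frac1q-\frac1p}(\log n)^{-\lambda_*-\frac1q+\frac1p}\,u_*(\log n)$$ if $\lambda_*>\frac1p-\frac1q$, and $$e_n(I:\hat X_p(\Omega)\to Y_q(\Omega))\lesssim n^{-\lambda_*}u_*(n)$$ if $\lambda_*<\frac1p-\frac1q$.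
   Context: Notation: $\log=\log_2$; $x_+=\max\{x,0\}$. $f_1\lesssim f_2$ with constants depending only on $\mathfrak{Z}_0$ means $f_1\le Cf_2$ with $C=C(\mathfrak{Z}_0)>0$. Entropy numbers: for normed spaces $X,Y$ and a linear continuous $T:X\to Y$, with $B_X,B_Y$ the unit balls, $e_k(T)=\inf\{\varepsilon>0:\exists y_1,\dots,y_{2^{k-1}}\in Y:\ T(B_X)\subset\bigcup_{i=1}^{2^{k-1}}(y_i+\varepsilon B_Y)\}$, $k\in\mathbb{N}$. Trees. For a graph $\mathcal{G}$, $\mathbf{V}(\mathcal{G})$ is its (at most countable) vertex set. For a tree $\mathcal{T}$ with root $\xi_0$, write $\xi'>\xi$ if $\xi'\neq\xi$ and $\xi$ lies on the simple path from $\xi_0$ to $\xi'$; $\xi'\ge\xi$ means $\xi'>\xi$ or $\xi'=\xi$. $\mathbf{V}_1(\xi)$ is the set of $\xi'>\xi$ adjacent to $\xi$. $\mathcal{T}_\xi$ is the subtree with vertex set $\{\xi'\ge\xi\}$, rooted at $\xi$. A family of subtrees with pairwise disjoint vertex sets whose union is $\mathbf{V}(\mathcal{T})$ is a partition of $\mathcal{T}$. For members $\mathcal{T}_j,\mathcal{T}_s$ of a partition with minimal vertices $\xi_j,\xi_s$, $\mathcal{T}_s$ succeeds $\mathcal{T}_j$ if $\xi_j<\xi_s$ and $\{\xi:\xi_j\le\xi<\xi_s\}\subset\mathbf{V}(\mathcal{T}_j)$. Setting. $(\Omega,\Sigma,\mathrm{mes})$ is a measure space. Sets are called disjoint if their intersection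 has measure zero, and an (at most countable) partition of a measurable set $E$ is a family of pairwise disjoint measurable sets whose union coincides with $E$ up to measure zero. $\hat\Theta$ is a countable partition of $\Omega$ into measurable subsets; $\mathcal{A}$ is a rooted tree with $\mathrm{card}\,\mathbf{V}_1(\xi)\le c_1$ for all $\xi\in\mathbf{V}(\mathcal{A})$ ($c_1\ge1$); $\hat F:\mathbf{V}(\mathcal{A})\to\hat\Theta$ is a bijection. For a subtree $\mathcal{A}'\subset\mathcal{A}$ set $\Omega_{\mathcal{A}'}=\bigcup_{\xi\in\mathbf{V}(\mathcal{A}')}\hat F(\xi)$. For each measurable $E\subset\Omega$ there are given spaces of functions $X_p(E)$ and $Y_q(E)$ with seminorms $\|\cdot\|_{X_p(E)}$, $\|\cdot\|_{Y_q(E)}$ ($Y_q(\Omega)$ being a normed space) such that: (1) $X_p(\Omega)\subset Y_q(\Omega)$; (2) $X_p(E)=\{f|_E:f\in X_p(\Omega)\}$, $Y_q(E)=\{f|_E:f\in Y_q(\Omega)\}$; (3) if $\mathrm{mes}\,E=0$ then $\dim Y_q(E)=\dim X_p(E)=0$; (4) if $E=\bigsqcup_{j\in\mathbb{N}}E_j$ with $E_j$ measurable, then $\|f\|_{X_p(E)}=\|\{\|f|_{E_j}\|_{X_p(E_j)}\}_j\|_{l_p}$ for $f\in X_p(E)$ and $\|f\|_{Y_q(E)}=\|\{\|f|_{E_j}\|_{Y_q(E_j)}\}_j\|_{l_q}$ for $f\in Y_q(E)$; (5) if $E\in\Sigma$ and $f\in Y_q(\Omega)$, then $f\chi_E\in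 Y_q(\Omega)$. $\mathcal{P}(\Omega)\subset X_p(\Omega)$ is a subspace of finite dimension $r_0$ with $\|f\|_{X_p(\Omega)}=0$ for all $f\in\mathcal{P}(\Omega)$; $\mathcal{P}(E)=\{f|_E:f\in\mathcal{P}(\Omega)\}$. Assumption 1. There is $w_*:\mathbf{V}(\mathcal{A})\to(0,\infty)$ such that for each $\hat\xi\in\mathbf{V}(\mathcal{A})$ there is a linear continuous operator $P_{\Omega_{\mathcal{A}_{\hat\xi}}}:Y_q(\Omega)\to\mathcal{P}(\Omega)$ with $\|f-P_{\Omega_{\mathcal{A}_{\hat\xi}}}f\|_{Y_q(\Omega_{\mathcal{A}'})}\le w_*(\hat\xi)\|f\|_{X_p(\Omega_{\mathcal{A}'})}$ for every $f\in X_p(\Omega)$ and every subtree $\mathcal{A}'\subset\mathcal{A}$ rooted at $\hat\xi$. Assumption 2. There are $\tilde w_*:\mathbf{V}(\mathcal{A})\to(0,\infty)$, $\delta_*>0$, $c_2\ge1$ such that for each $\xi\in\mathbf{V}(\mathcal{A})$, $n\in\mathbb{N}$, $m\in\mathbb{Z}_+$ there is a partition $T_{m,n}(G)$ of $G=\hat F(\xi)$ with: $\mathrm{card}\,T_{m,n}(G)\le c_2\cdot2^mn$; for each $E\in T_{m,n}(G)$ there is a linear continuous $P_E:Y_q(\Omega)\to\mathcal{P}(E)$ with $\|f-P_Ef\|_{Y_q(E)}\le(2^mn)^{-\delta_*}\tilde w_*(\xi)\|f\|_{X_p(E)}$ for all $f\in X_p(\Omega)$; for each $E\in T_{m,n}(G)$,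 $\mathrm{card}\{E'\in T_{m\pm1,n}(G):\mathrm{mes}(E\cap E')>0\}\le c_2$. Assumption 3 (for $p<q$). With $k_*=1$, there are $\lambda_*\ge0$, $\mu_*\ge\lambda_*$, $\gamma_*>0$, absolutely continuous $u_*,\psi_*:(0,\infty)\to(0,\infty)$ with $\lim_{y\to\infty}\frac{yu_*'(y)}{u_*(y)}=\lim_{y\to\infty}\frac{y\psi_*'(y)}{\psi_*(y)}=0$, $c_3\ge1$, $t_0\in\mathbb{N}$ and a partition $\{\mathcal{A}_{t,i}\}_{t\ge t_0,\,i\in\hat J_t}$ of $\mathcal{A}$ into subtrees such that for $\xi\in\mathbf{V}(\mathcal{A}_{t,i})$ $$c_3^{-1}2^{-\lambda_*t}u_*(2^{t})\le w_*(\xi)\le c_32^{-\lambda_*t}u_*(2^{t}),\quad c_3^{-1}2^{-\mu_*t}u_*(2^{t})\le\tilde w_*(\xi)\le c_32^{-\mu_*t}u_*(2^{t}),$$ and $\nu_t:=\sum_{i\in\hat J_t}\mathrm{card}\,\mathbf{V}(\mathcal{A}_{t,i})$ satisfies $\nu_t\le c_3\overline\nu_t$, $t\ge t_0$, with $\overline\nu_t:=2^{\gamma_*2^t}\psi_*(2^{2^t})$. In addition: for $t,t'\in\mathbb{Z}_+$, $t'\ge t$, $2^{-\lambda_*t'}u_*(2^{t'})\le c_32^{-\lambda_*t}u_*(2^{t})$; if $\mathcal{A}_{t',i'}$ succeeds $\mathcal{A}_{t,i}$, then $t'=t+1$. The set $\hat J_{t_0}$ is a singleton $\{i_0\}$,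 and the minimal vertex of $\mathcal{A}_{t_0,i_0}$ is the root of $\mathcal{A}$. Let $\hat P:Y_q(\Omega)\to\mathcal{P}(\Omega)$ be the operator given by Assumption 1 for $\hat\xi$ equal to this root. Set $\hat X_p(\Omega)=\{f-\hat Pf:f\in X_p(\Omega)\}$, normed by $\|\cdot\|_{X_p(\Omega)}$, and let $I:\hat X_p(\Omega)\to Y_q(\Omega)$ be the embedding operator. $\mathfrak{Z}_0=(p,q,r_0,w_*,\tilde w_*,\delta_*,k_*,\lambda_*,\mu_*,\gamma_*,\psi_*,u_*,c_1,c_2,c_3)$. *)

(* Defs.v *)
From HB Require Import structures.
From mathcomp Require Import all_boot all_order all_algebra.
From mathcomp Require Import all_classical all_reals all_analysis.

Set Implicit Arguments.
Unset Strict Implicit.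
Unset Printing Implicit Defensive.

Import Order.TTheory GRing.Theory Num.Theory.
Import numFieldNormedType.Exports.

Local Open Scope classical_set_scope.
Local Open Scope ring_scope.

Section trees.
Variables (V : countType) (e : rel V) (root : V).

Definition simple_path (x y : V) (s : seq V) : Prop :=
  [/\ path e x s, uniq (x :: s) & last x s = y].

(* A simple graph is a symmetric irreflexive relation; [ucycle e c] with
   [2 < size c] is a simple cycle. *)
Definition is_tree : Prop :=
  [/\ symmetric e, irreflexive e,
      forall x y, exists2 s, path e x s & last x s = y
    & forall c : seq V, (2 < size c)%N -> ~ ucycle e c].

Definition tree_le (x y : V) : Prop :=
  exists2 s, simple_path root y s & x \in root :: s.

Definition tree_lt (x y : V) : Prop := y <> x /\ tree_le x y.

Definition children (x : V) : set V := [set y | tree_lt x y /\ e x y].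

(* A connected subgraph of a tree contains every edge between its vertices, so
   a subtree is determined by its vertex set. *)
Definition subtree (S : set V) : Prop :=
  S !=set0 /\
  forall x y, S x -> S y ->
    exists s, [/\ path e x s, last x s = y & forall z, z \in s -> S z].

Definition min_vertex (S : set V) (x : V) : Prop :=
  S x /\ forall y, S y -> tree_le x y.

Definition subtree_rooted_at (x : V) (S : set V) : Prop :=
  subtree S /\ min_vertex S x.

(* [succeeds S' S]: S' succeeds S *)
Definition succeeds (S' S : set V) : Prop :=
  exists x x', [/\ min_vertex S x, min_vertex S' x', tree_lt x x'
    & [set z | tree_le x z /\ tree_lt z x'] `<=` S].

End trees.

(* A function on a measurable set E is represented by a total function T -> R,
   of which only the class modulo equality a.e. on E matters. *)

Section spaces.
Context {d : measure_display} {T : measurableType d} {R : realType}.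
Variable mu : {measure set T -> \bar R}.

Definition ae_partition (S : set (set T)) (G : set T) : Prop :=
  [/\ countable S,
      forall E, S E -> measurable E,
      forall E E', S E -> S E' -> E <> E' -> mu (E `&` E') = 0%E
    & mu (G `+` \bigcup_(E in S) E) = 0%E].

Definition ae_restrict (S : set (T -> R)) (E : set T) : set (T -> R) :=
  [set g | exists2 f, S f & f = g %[ae mu in E]].

Record ae_subspace (E : set T) (S : set (T -> R)) : Prop := AeSubspace {
  ae_subspace0 : S (fun=> 0);
  ae_subspaceP : forall a f g, S f -> S g -> S (fun x => a * f x + g x);
  ae_subspaceE : forall f g, f = g %[ae mu in E] -> S f -> S g }.

Record ae_seminorm (E : set T) (S : set (T -> R)) (N : (T -> R) -> R) : Prop :=
  AeSeminorm {
  ae_seminorm_ge0 : forall f, S f -> 0 <= N f;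
  ae_seminormD : forall f g, S f -> S g -> N (f \+ g) <= N f + N g;
  ae_seminormZ : forall a f, S f -> N (fun x => a * f x) = `|a| * N f;
  ae_seminormE : forall f g, f = g %[ae mu in E] -> S f -> N f = N g }.

Definition ae_dim (E : set T) (S : set (T -> R)) (r : nat) : Prop :=
  exists b : 'I_r -> T -> R,
    [/\ forall i, S (b i),
        forall c : 'I_r -> R,
          (fun x => \sum_(i < r) c i * b i x) = (fun=> 0) %[ae mu in E] ->
          forall i, c i = 0
      & forall f, S f -> exists c : 'I_r -> R,
          f = (fun x => \sum_(i < r) c i * b i x) %[ae mu in E]].

(* Linear continuous operators from the space Y of functions on all of T,
   with norm nY, to the space Z of functions on E, with norm nZ. *)
Record lin_cont_op (Y : set (T -> R)) (nY : (T -> R) -> R)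
    (E : set T) (Z : set (T -> R)) (nZ : (T -> R) -> R)
    (A : (T -> R) -> T -> R) : Prop := LinContOp {
  lin_cont_op_in : forall f, Y f -> Z (A f);
  lin_cont_op_ae : forall f g, Y f -> Y g ->
    f = g %[ae mu in [set: T]] -> A f = A g %[ae mu in E];
  lin_cont_op_linear : forall a f g, Y f -> Y g ->
    A (fun x => a * f x + g x) = (fun x => a * A f x + A g x) %[ae mu in E];
  lin_cont_op_continuous : forall f, Y f -> forall eps, 0 < eps ->
    exists2 eta, 0 < eta &
      forall g, Y g -> nY (g \- f) < eta -> nZ (A g \- A f) < eps }.

Definition lp_norm (p : R) (a : nat -> R) : \bar R :=
  'N[@counting nat R]_(p%:E) [EFin \o a]%E.

Definition lp_decomposable (p : R) (X : set T -> set (T -> R))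
    (nX : set T -> (T -> R) -> R) : Prop :=
  forall (E : set T) (Ej : nat -> set T),
    measurable E -> (forall j, measurable (Ej j)) ->
    E = \bigcup_j Ej j ->
    (forall i j, i <> j -> mu (Ej i `&` Ej j) = 0%E) ->
    forall f, X E f -> (nX E f)%:E = lp_norm p (fun j => nX (Ej j) f).

Record function_spaces (p q : R)
    (X : set T -> set (T -> R)) (nX : set T -> (T -> R) -> R)
    (Y : set T -> set (T -> R)) (nY : set T -> (T -> R) -> R) : Prop :=
  FunctionSpaces {
  X_subspace : forall E, measurable E -> ae_subspace E (X E);
  X_seminorm : forall E, measurable E -> ae_seminorm E (X E) (nX E);
  Y_subspace : forall E, measurable E -> ae_subspace E (Y E);
  Y_seminorm : forall E, measurable E -> ae_seminorm E (Y E) (nY E);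
  Y_normed : forall f, Y [set: T] f -> nY [set: T] f = 0 ->
    f = (fun=> 0) %[ae mu in [set: T]];
  X_sub_Y : X [set: T] `<=` Y [set: T];
  X_restrict : forall E, measurable E -> X E = ae_restrict (X [set: T]) E;
  Y_restrict : forall E, measurable E -> Y E = ae_restrict (Y [set: T]) E;
  X_null : forall E, measurable E -> mu E = 0%E -> ae_dim E (X E) 0;
  Y_null : forall E, measurable E -> mu E = 0%E -> ae_dim E (Y E) 0;
  X_decomposable : lp_decomposable p X nX;
  Y_decomposable : lp_decomposable q Y nY;
  Y_indic : forall E f, measurable E -> Y [set: T] f ->
    Y [set: T] (fun x => f x * \1_E x) }.

Record null_subspace (r0 : nat) (X : set T -> set (T -> R))
    (nX : set T -> (T -> R) -> R) (P : set (T -> R)) : Prop := NullSubspace {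
  null_subspace_subspace : ae_subspace [set: T] P;
  null_subspace_sub : P `<=` X [set: T];
  null_subspace_dim : ae_dim [set: T] P r0;
  null_subspace_norm0 : forall f, P f -> nX [set: T] f = 0 }.

End spaces.

(* The value is +oo when no radius is admissible. *)

Definition entropy_number {R : realType} {U : Type} {W : zmodType}
    (X : set U) (nX : U -> R) (Y : set W) (nY : W -> R) (A : U -> W)
    (k : nat) : \bar R :=
  ereal_inf [set eps%:E | eps in [set eps : R | 0 < eps /\
    exists y : 'I_(2 ^ k.-1) -> W, (forall i, Y (y i)) /\
      forall x, X x -> nX x <= 1 -> exists i, nY (A x - y i) <= eps]].

Section slowly_varying.
Context {R : realType}.

Definition abs_continuous_on (a b : R) (f : R -> R) : Prop :=
  forall eps : R, 0 < eps -> exists2 delta : R, 0 < delta &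
    forall (n : nat) (x y : 'I_n -> R),
      (forall i, [/\ a <= x i, x i <= y i & y i <= b]) ->
      (forall i j, i != j -> y i <= x j \/ y j <= x i) ->
      \sum_(i < n) (y i - x i) < delta ->
      \sum_(i < n) `|f (y i) - f (x i)| < eps.

(* Absolute continuity on the open half-line means absolute continuity on each
   of its compact subintervals; f' then exists only almost everywhere, and the
   limit of y f'(y) / f(y) at infinity is taken along almost every y. *)
Record slowly_varying (f : R -> R) : Prop := SlowlyVarying {
  slowly_varying_gt0 : forall y : R, 0 < y -> 0 < f y;
  slowly_varying_ac : forall a b : R, 0 < a -> a < b -> abs_continuous_on a b f;
  slowly_varying_lim : forall eps : R, 0 < eps -> exists M : R,
    {ae @lebesgue_measure R, forall y : R, M < y ->
      derivable f y 1 /\ `|y * derive1 f y / f y| < eps} }.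

Definition log2 (x : R) : R := ln x / ln 2.

End slowly_varying.

Section assumptions.
Context {d : measure_display} {T : measurableType d} {R : realType}.
Variable mu : {measure set T -> \bar R}.
Variables (V : countType) (e : rel V) (root : V) (F : V -> set T).

Definition tree_domain (S : set V) : set T := \bigcup_(x in S) F x.

Variables (X : set T -> set (T -> R)) (nX : set T -> (T -> R) -> R).
Variables (Y : set T -> set (T -> R)) (nY : set T -> (T -> R) -> R).
Variable P : set (T -> R).

Definition tree_projection (w : V -> R) (x : V) (Px : (T -> R) -> T -> R) :
    Prop :=
  lin_cont_op mu (Y [set: T]) (nY [set: T]) [set: T] P (nY [set: T]) Px /\
  forall f S, X [set: T] f -> subtree_rooted_at e root x S ->
    nY (tree_domain S) (f \- Px f) <= w x * nX (tree_domain S) f.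

Definition assumption1 (w : V -> R) : Prop :=
  forall x, exists Px, tree_projection w x Px.

Definition assumption2 (wt : V -> R) (delta c2 : R) : Prop :=
  forall (x : V) (n : nat), (0 < n)%N ->
  exists Tm : nat -> set (set T), forall m : nat,
  [/\ ae_partition mu (Tm m) (F x),
      (counting (Tm m) <= (c2 * (2 ^ m * n)%N%:R)%:E)%E,
      forall E, Tm m E -> exists PE,
        lin_cont_op mu (Y [set: T]) (nY [set: T])
          E (ae_restrict mu P E) (nY E) PE /\
        forall f, X [set: T] f ->
          nY E (f \- PE f) <= (2 ^ m * n)%N%:R `^ (- delta) * wt x * nX E f
    & forall m', m' = m.+1 \/ m = m'.+1 -> forall E, Tm m E ->
        (counting [set E' | Tm m' E' /\ (0 < mu (E `&` E'))%E] <= c2%:E)%E].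

Definition assumption3 (w wt : V -> R) (lambda mu_ gamma : R)
    (psi u : R -> R) (c3 : R) (t0 : nat)
    (J_index : choiceType) (J : nat -> set J_index)
    (At : nat -> J_index -> set V) : Prop :=
  [/\ [/\ forall t i, (t0 <= t)%N -> J t i -> subtree e (At t i),
          forall t i t' i', (t0 <= t)%N -> J t i -> (t0 <= t')%N -> J t' i' ->
            (t, i) <> (t', i') -> At t i `&` At t' i' = set0
        & forall x, exists t i, [/\ (t0 <= t)%N, J t i & At t i x]],
      forall t i x, (t0 <= t)%N -> J t i -> At t i x ->
        c3^-1 * 2 `^ (- lambda * t%:R) * u (2 ^+ t) <= w x
          <= c3 * 2 `^ (- lambda * t%:R) * u (2 ^+ t) /\
        c3^-1 * 2 `^ (- mu_ * t%:R) * u (2 ^+ t) <= wt x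
          <= c3 * 2 `^ (- mu_ * t%:R) * u (2 ^+ t),
      forall t, (t0 <= t)%N ->
        (\esum_(i in J t) counting (At t i) <=
          (c3 * (2 `^ (gamma * 2 ^+ t) * psi (2 ^+ (2 ^ t)%N)))%:E)%E,
      forall t t', (t <= t')%N ->
        2 `^ (- lambda * t'%:R) * u (2 ^+ t')
          <= c3 * (2 `^ (- lambda * t%:R) * u (2 ^+ t))
    & forall t i t' i', (t0 <= t)%N -> J t i -> (t0 <= t')%N -> J t' i' ->
        succeeds e root (At t' i') (At t i) -> t' = t.+1].

Definition Xhat (Phat : (T -> R) -> T -> R) : set (T -> R) :=
  [set f \- Phat f | f in X [set: T]].

End assumptions.

(* Main.v *)
Require Import Defs.
From HB Require Import structures.
From mathcomp Require Import all_boot all_order all_algebra.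
From mathcomp Require Import finmap.
From mathcomp Require Import all_classical all_reals all_analysis.
From mathcomp Require Import measurable_realfun.
From mathcomp Require Import ring lra zify.

Set Implicit Arguments.
Unset Strict Implicit.
Unset Printing Implicit Defensive.

Import Order.TTheory GRing.Theory Num.Theory.
Import numFieldNormedType.Exports.

Local Open Scope classical_set_scope.
Local Open Scope ring_scope.


(** The entropy numbers are bounded by coding.  Put [th = 1/p - 1/q] and
    [L = log2 n], and call the vertices of the trees [A_(t,i)] the vertices of
    level [t]; there [w] and [wt] are at most of order
    [w_t = 2 `^ (- lambda * t) * u (2 ^ t)], and the level has at most a multiple
    of [2 ^ ((gamma + 1) * 2 ^ t)] vertices.  A function [f] of the unit ball is
    described by a vector of natural numbers, its code, in such a way that there
    are at most [2 ^ (n - 1)] codes and that two functions with the same code are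
    at a distance of order [eps].  One ball for each code then covers the ball
    ([entropy_le_code]).

    The code is adapted to the mass of [f], that is, to the [p]-th power of its
    seminorm, which is additive over disjoint sets and at most one in total.  A
    vertex of level [t] has the price [Lam = 2 ^ max (t, t1 + 1)], where [2 ^ t1]
    is of order [L].  It is called heavy if its level is at most [t1], or if its
    level is at most [te], with [2 ^ te] of order [n], and the mass of its branch
    exceeds a multiple of [Lam / n]; the branch is the part of the tree above the
    vertex that is not above another heavy vertex ([heavy_set_exists]).  The
    branches of the heavy vertices are disjoint, so that the heavy vertices of
    level above [t1] cost together at most a multiple of [n].  The tree is the
    disjoint union of the heavy vertices and of the branches at their light
    children.

    A light branch is approximated as a whole by its projection on [P].  At levels
    beyond [te] the weight [w] alone makes the error small enough.  At the others
    the mass of the branch is at most of order [Lam / n], and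
    [sum x^q <= (max x)^(q - p) * sum x^p], so that the error over all light
    branches is at most of order [max_t w_t * (2 ^ t / n) ^ th].  On the set of a
    heavy vertex, the partitions of the second assumption give approximants at
    scales [0, ..., M], with [M] of order [L].  The code contains the coordinates ([coordinates_ex]) of the
    approximants on the coarsest pieces in units of [eps / n], and the integer
    parts of the coordinates of the increments between consecutive scales, in
    units so large that a nonzero entry is paid for by the mass of the piece.
    Hence equal codes mean close functions ([multiscale_close]), and the price of
    the code is at most [3 * n / 8] ([core_entropy]).  Since the price of an entry
    at level [t] is a large multiple of [2 ^ t], which exceeds the logarithm of the
    number of vertices, Kraft's inequality holds, and there are at most
    [e^2 * 2^B] vectors of price at most [B] ([kraft_count]).

    It remains to find [eps], of the order of the maximum of
    [w_t * (2 ^ t / n) ^ th] over the levels with [L <= 2 ^ t <= n], the other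
    errors being smaller by a power of [n].  With [y = 2 ^ t] this is the maximum of
    [n ^ (- th) * y ^ (th - lambda) * u y].  As [u] varies slowly, it changes less
    than any power of [y] ([slowly_varying_potter]), and the maximum is attained,
    up to a constant, at [y = L] if [lambda > th] and at [y = n] if [lambda < th].
    These are the two rates. *)

(** * Codes and entropy numbers *)

Section counting_codes.
Context {R : realType}.

Lemma geometric_le (x : R) n : 0 <= x -> x <= 2^-1 ->
  \sum_(i < n.+1) x ^+ i <= 1 + 2 * x.
Proof.
move=> x0 x2.
have H : forall m, \sum_(i < m) x ^+ i <= 2 - 2 * x ^+ m.
  elim=> [|m IH]; first by rewrite big_ord0 expr0; lra.
  rewrite big_ord_recr /= exprS.
  have : 0 <= x ^+ m by apply: exprn_ge0.
  nra.
rewrite big_ord_recl expr0 lerD2l.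
under eq_bigr do rewrite exprS.
rewrite -mulr_sumr mulrC; apply: ler_wpM2r => //.
apply: (le_trans (H n)); rewrite gerBl; apply: mulr_ge0 => //; exact: exprn_ge0.
Qed.

(** Chernoff's argument: a vector of price at most [B] has weight
    [2 `^ (B - price)] at least [1], and the sum of the weights over all vectors
    factors into geometric sums.  The sum of the powers of [x <= 1/2] is at most
    [1 + 2 x <= expR (2 x)], and Kraft's inequality bounds the product. *)
Lemma kraft_count (J : finType) (c : J -> R) (K : nat) (B : R) :
  (forall j, 1 <= c j) -> \sum_j 2 `^ (- c j) <= 1 ->
  #|[set k : {ffun J -> 'I_K.+1} | \sum_j c j * (k j)%:R <= B]%SET|%:R
    <= expR 2 * 2 `^ B.
Proof.
move=> c1 kraft; set S := [set k | _]%SET.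
rewrite -sum1_card natr_sum.
apply: (@le_trans _ _ (\sum_(k : {ffun J -> 'I_K.+1})
    2 `^ B * \prod_j (2 `^ (- c j)) ^+ k j)).
  rewrite big_mkcond /=; apply: ler_sum => k _.
  have <- : 2 `^ (- \sum_j c j * (k j)%:R) = \prod_j (2 `^ (- c j)) ^+ k j :> R.
    rewrite -sumrN (big_morph (fun x : R => 2 `^ x) (op1 := *%R) (op2 := +%R)
      (id1 := 1) (id2 := 0)) ?powRr0 //.
      by apply: eq_bigr => j _; rewrite -powR_mulrn ?powR_ge0 // -powRrM mulNr.
    by move=> x y; rewrite powRD // pnatr_eq0 implybT.
  rewrite -powRD ?pnatr_eq0 ?implybT //; case: ifP => [|_]; last exact: powR_ge0.
  rewrite inE => kB; rewrite -[leLHS](powRr0 2); apply: ler_powR; first lra.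
  lra.
rewrite -mulr_sumr mulrC; apply: ler_wpM2r; first exact: powR_ge0.
rewrite -(bigA_distr_bigA (fun j (i : 'I_K.+1) => (2 `^ (- c j)) ^+ i)) /=.
apply: (@le_trans _ _ (\prod_j expR (2 * 2 `^ (- c j)))).
  apply: ler_prod => j _; rewrite sumr_ge0 /=; last first.
    by move=> i _; rewrite exprn_ge0 ?powR_ge0.
  apply: le_trans (expR_ge1Dx _); apply: geometric_le; first exact: powR_ge0.
  by rewrite -powR_inv1 //; apply: ler_powR; [lra|rewrite lerN2].
rewrite -expR_sum ler_expR -mulr_sumr; lra.
Qed.

(** One ball for each value of the code, centred at the image of any point of
    the unit ball that has this value. *)
Lemma entropy_le_code (U : Type) (W : zmodType) (X : set U) (nX : U -> R)
    (Y : set W) (nY : W -> R) (A : U -> W) (k : nat) (eps : R)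
    (K : finType) (S : {set K}) (code : U -> K) :
  0 < eps -> Y !=set0 -> (#|S| <= 2 ^ k.-1)%N ->
  (forall x, X x -> Y (A x)) ->
  (forall x, X x -> nX x <= 1 -> code x \in S) ->
  (forall x x', X x -> nX x <= 1 -> X x' -> nX x' <= 1 ->
    code x = code x' -> nY (A x - A x') <= eps) ->
  (entropy_number X nX Y nY A k <= eps%:E)%E.
Proof.
move=> eps0 [y0 Yy0] cS XY codeS close.
apply: ereal_inf_lbound; exists eps => //; split=> //.
pose good (s : option K) x := [/\ X x, nX x <= 1 & Some (code x) = s].
pose y (i : 'I_(2 ^ k.-1)) : W :=
  if pselect (exists x, good (nth None [seq Some s | s <- enum S] i) x)
  is left e then A (sval (cid e)) else y0.
exists y; split=> [i|x Xx x1].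
  rewrite /y; case: pselect => // e.
  by case: (cid e) => x [Xx _ _] /=; exact: XY.
have xS := codeS x Xx x1.
have iS : (index (code x) (enum S) < 2 ^ k.-1)%N.
  by apply: leq_trans cS; rewrite cardE index_mem mem_enum.
exists (Ordinal iS); rewrite /y; case: pselect => [e|[]] /=; last first.
  exists x; split=> //; rewrite (nth_map (code x)) ?nth_index ?mem_enum //.
  by rewrite index_mem mem_enum.
case: (cid e) => x' [Xx' x1'] /=.
rewrite (nth_map (code x)) ?nth_index ?mem_enum //; last first.
  by rewrite index_mem mem_enum.
by move=> [cx]; apply: close.
Qed.

(** A code is a vector of multiplicities of priced atoms.  Bounding its total
    price is more economical than bounding its entries: the length of a code
    adapts to the function that it describes. *)
Lemma entropy_le_atoms (U : Type) (W : zmodType) (X : set U) (nX : U -> R)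
    (Y : set W) (nY : W -> R) (A : U -> W) (k : nat) (eps : R)
    (J : finType) (c : J -> R) (B : R) (code : U -> J -> nat) :
  0 < eps -> Y !=set0 -> (forall x, X x -> Y (A x)) ->
  (forall j, 1 <= c j) -> \sum_j 2 `^ (- c j) <= 1 ->
  expR 2 * 2 `^ B <= (2 ^ k.-1)%:R ->
  (forall x, X x -> nX x <= 1 -> \sum_j c j * (code x j)%:R <= B) ->
  (forall x x', X x -> nX x <= 1 -> X x' -> nX x' <= 1 ->
    (forall j, code x j = code x' j) -> nY (A x - A x') <= eps) ->
  (entropy_number X nX Y nY A k <= eps%:E)%E.
Proof.
move=> eps0 Y0 XY c1 kraft count cost close.
pose K := Num.truncn B.
pose code' x : {ffun J -> 'I_K.+1} := [ffun j => inord (code x j)].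
have codeK x j : X x -> nX x <= 1 -> code' x j = code x j :> nat.
  move=> Xx x1; rewrite ffunE inordK // ltnS truncn_ge_nat; last first.
    by apply: le_trans (cost x Xx x1); apply: sumr_ge0 => i _;
       rewrite mulr_ge0 // (le_trans ler01).
  apply: le_trans (cost x Xx x1); rewrite (bigD1 j) //=.
  apply: (@le_trans _ _ (c j * (code x j)%:R)).
    by rewrite ler_peMl.
  rewrite lerDl; apply: sumr_ge0 => i _; by rewrite mulr_ge0 // (le_trans ler01).
apply: (@entropy_le_code _ _ X nX Y nY A k eps _
  [set k : {ffun J -> 'I_K.+1} | \sum_j c j * (k j)%:R <= B]%SET code') => //.
- rewrite -(ler_nat R); apply: le_trans count; exact: kraft_count.
- move=> x Xx x1; rewrite inE; apply: le_trans (cost x Xx x1).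
  by under eq_bigr do rewrite codeK //.
- move=> x x' Xx x1 Xx' x1' E; apply: close => // j.
  by rewrite -codeK // E codeK.
Qed.

End counting_codes.

(** * Absolutely continuous functions *)

Section absolutely_continuous.
Context {R : realType}.
Implicit Types (a b c : R) (f g : R -> R).

Local Notation leb := (@lebesgue_measure R).

(** Families of intervals are lists ordered from left to right, since they are
    built by adding intervals at the right end. *)
Definition disjoint_in a t (s : seq (R * R)) : Prop :=
  (forall i, (i < size s)%N ->
     [/\ a <= (nth (0, 0) s i).1, (nth (0, 0) s i).1 <= (nth (0, 0) s i).2
       & (nth (0, 0) s i).2 <= t]) /\
  (forall i j, (i < j)%N -> (j < size s)%N ->
     (nth (0, 0) s i).2 <= (nth (0, 0) s j).1).

Lemma disjoint_in_rcons a t v s : a <= t -> t <= v -> disjoint_in a t s ->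
  disjoint_in a v (rcons s (t, v)).
Proof.
move=> at_ tv [s1 s2]; split=> [i|i j ij]; rewrite size_rcons ltnS.
  rewrite nth_rcons; case: ltngtP => // li _ /=.
  by have [? ? ?] := s1 _ li; split=> //; apply: le_trans tv.
rewrite !nth_rcons leq_eqVlt => /orP[/eqP jE|js].
  by subst j; rewrite ij ltnn eqxx /=; have [] := s1 i ij.
by rewrite js (ltn_trans ij js); exact: s2.
Qed.

Lemma disjoint_in_widen a t v s : t <= v -> disjoint_in a t s ->
  disjoint_in a v s.
Proof.
move=> tv [s1 s2]; split=> // i /s1[? ? ?]; split=> //; exact: le_trans tv.
Qed.

Lemma ac_small_on_null a b g : a < b -> abs_continuous_on a b g ->
  forall eps, 0 < eps -> exists2 delta, 0 < delta &
    forall s, disjoint_in a b s -> \sum_(p <- s) (p.2 - p.1) < delta ->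
      \sum_(p <- s) `|g p.2 - g p.1| < eps.
Proof.
move=> ab ac eps /ac[delta d0 H]; exists delta => // s [s1 s2] sd.
have E F : \sum_(p <- s) F p =
    \sum_(i < size s) F (nth (0, 0) s i) :> R.
  by rewrite (big_nth (0, 0)) big_mkord.
rewrite E in sd; rewrite E.
apply: (H (size s) (fun i => (nth (0, 0) s i).1)
                   (fun i => (nth (0, 0) s i).2)) => // [i|i j].
  exact: s1.
rewrite -val_eqE /= neq_ltn => /orP[ij|ji]; [left|right]; exact: s2.
Qed.

(** A gauge argument: points where [g' <= 0] have neighbourhoods on which [g]
    grows at rate at most [eta], and the exceptional null set is swallowed by an
    open set so small that absolute continuity makes the growth over it
    negligible. *)
Lemma ac_nonincreasing a b g : a < b -> abs_continuous_on a b g ->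
  {ae leb, forall y : R, a <= y <= b ->
     derivable g y 1 /\ derive1 g y <= 0} ->
  g b <= g a.
Proof.
move=> ab ac aeg; apply/ler_addgt0Pr => e e0.
have e2 : 0 < e / 2 by rewrite divr_gt0.
have [delta d0 small] := ac_small_on_null ab ac e2.
pose eta := e / 2 / (b - a).
have eta0 : 0 < eta by rewrite divr_gt0 // subr_gt0.
case: aeg => N [mN N0 badN].
have Noo : (leb N < +oo)%E by rewrite N0 ltry.
have [G [oG NG Gd]] := lebesgue_regularity_outer mN Noo d0.
have mG : measurable G by exact: open_measurable.
have muG : (leb G < delta%:E)%E.
  have -> : G = N `|` (G `\` N) by rewrite setDUK.
  have := measureU2 leb mN (measurableD mG mN).
  by move=> /le_lt_trans; apply; rewrite [X in (X + _)%E]N0 add0e.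
have fin (t : R) : leb (G `&` `]a, t]) \is a fin_num.
  rewrite ge0_fin_numE //; apply: (@le_lt_trans _ _ (leb G)).
    by apply: le_measure; rewrite ?inE //; apply: measurableI.
  by apply: lt_trans muG _; rewrite ltry.
pose m t := fine (leb (G `&` `]a, t])).
(* [m t] is the length of the part of [G] to the left of [t] *)
have mS t v : a <= t -> t <= v -> `]t, v] `<=` G -> m v = m t + (v - t).
  move=> at_ tv tvG; apply: EFin_inj; rewrite EFinD /m !fineK //.
  have -> : G `&` `]a, v] = (G `&` `]a, t]) `|` `]t, v].
    apply/seteqP; split=> x /=; rewrite !in_itv /=.
      move=> [Gx /andP[ax xv]]; case: (leP x t) => xt.
        by left; rewrite ax.
      by right; rewrite xv.
    case=> [[Gx /andP[ax xt]]|/andP[tx xv]].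
      by rewrite ax (le_trans xt tv).
    split; first by apply: tvG; rewrite /= in_itv /= tx.
    by rewrite (le_lt_trans at_ tx).
  rewrite measureU //; [|exact: measurableI|].
    congr (_ + _)%E.
    rewrite [LHS](lebesgue_measure_itv `]t, v]) /= lte_fin.
    by case: ltgtP tv => // -> _; rewrite subrr.
  by apply/seteqP; split=> // x /= [[_]]; rewrite !in_itv /=; lra.
have mmono t v : t <= v -> m t <= m v.
  move=> tv; apply: fine_le => //; apply: le_measure; rewrite ?inE;
    try exact: measurableI.
  by move=> x /= []; rewrite !in_itv /= => ? /andP[-> /le_trans->].
(* Up to the point [t], the growth of [g] beyond the rate [eta] is carried by
   intervals lying in [G]. *)
pose good t := a <= t <= b /\ exists s, [/\ disjoint_in a t s,
  \sum_(p <- s) (p.2 - p.1) <= m t &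
  g t - g a <= eta * (t - a) + \sum_(p <- s) `|g p.2 - g p.1|].
suff [_ [s [ds sm gs]]] : good b.
  have : \sum_(p <- s) `|g p.2 - g p.1| < e / 2.
    apply: small => //; apply: le_lt_trans sm _.
    rewrite /m -lte_fin fineK //; apply: le_lt_trans muG.
    by apply: le_measure; rewrite ?inE //; apply: measurableI.
  move: gs; rewrite /eta divfK ?subr_eq0 ?gt_eqF //; lra.
have gooda : good a.
  split; first by rewrite lexx ltW.
  exists [::]; split; rewrite ?big_nil ?subrr ?mulr0 ?addr0 //.
  by rewrite /m fine_ge0.
pose A := [set t | good t].
have supA : has_sup A.
  by split; [exists a|exists b => t [/andP[]]].
pose c := sup A.
have ac_ : a <= c by apply: ub_le_sup; [case: supA|].
have cb : c <= b by apply: ge_sup; [case: supA|move=> t [/andP[]]].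
(* a point at which the family can be prolonged on both sides must be b *)
have prolong r : 0 < r ->
    (forall t v, good t -> c - r < t -> t <= c -> c <= v -> v < c + r ->
       v <= b -> good v) -> good b.
  move=> r0 ext.
  have [t gt ct] : exists2 t, A t & c - r < t by apply: sup_adherent.
  have tc : t <= c by apply: ub_le_sup => //; case: supA.
  case: (leP b (c + r / 2)) => bc; first by apply: (ext t) => //; lra.
  have gv : good (c + r / 2) by apply: (ext t) => //; lra.
  have : c + r / 2 <= c by apply: ub_le_sup => //; case: supA.
  lra.
(* In [G] the interval itself is added to the family; outside [G] the derivative
   at [c] takes over. *)
have [Gc|nGc] := pselect (G c).
  have /nbhs_ballP[r /= r0 rG] : nbhs c G by apply: open_nbhs_nbhs.
  apply: (prolong r) => // t v [/andP[at_ tb] [s [ds sm gs]]] ct tc cv vr vb.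
  have tv : t <= v by apply: le_trans cv.
  split; first by rewrite vb (le_trans at_ tv).
  exists (rcons s (t, v)); rewrite -!cats1 !big_cat /= !big_seq1 /=.
  rewrite cats1; split; first exact: disjoint_in_rcons.
    rewrite (mS t v) ?lerD2r //.
    move=> x /=; rewrite in_itv /= => /andP[tx xv]; apply: rG.
    by rewrite /ball /= ltr_norml; lra.
  have := ler_norm (g v - g t); have : eta * t <= eta * v by rewrite ler_wpM2l // ltW.
  lra.
have [dc c0] : derivable g c 1 /\ derive1 g c <= 0.
  apply: contrapT => h; apply: nGc; apply: NG; apply: badN => /= h'.
  by apply: h; apply: h'; rewrite ac_ cb.
have cv : (fun h => h^-1 *: (g (h + c) - g c)) @ 0^' --> derive1 g c.
  have : cvg ((fun h => h^-1 *: (g (h + c) - g c)) @ 0^').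
    move: dc; rewrite /derivable /=.
    by under [X in cvg (X @ _) -> _]eq_fun do rewrite /GRing.scale /= mulr1.
  by [].
move/cvgrPdist_lt : cv => /(_ _ eta0) [r /= r0 rg].
have close v : `|v - c| < r -> v != c -> (g v - g c) / (v - c) < eta.
  move=> vr vc; have := rg (v - c); rewrite /= sub0r normrN => /(_ vr).
  rewrite subr_eq0 => /(_ vc); rewrite subrK /GRing.scale /= mulrC.
  rewrite ltr_norml; lra.
apply: (prolong r) => // t v [/andP[at_ tb] [s [ds sm gs]]] ct tc cv vr vb.
have tv : t <= v by apply: le_trans cv.
split; first by rewrite vb (le_trans at_ tv).
exists s; split; [exact: disjoint_in_widen ds| exact: le_trans (mmono _ _ tv)|].
have gv : g v - g c <= eta * (v - c).
  have [->|vc] := eqVneq v c; first by rewrite !subrr mulr0.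
  rewrite -ler_pdivrMr ?subr_gt0 ?lt_neqAle 1?eq_sym ?vc //.
  by apply/ltW/close => //; rewrite ltr_norml; lra.
have gt_ : g c - g t <= eta * (c - t).
  have [->|tc'] := eqVneq t c; first by rewrite !subrr mulr0.
  have : (g t - g c) / (t - c) < eta by apply: close => //; rewrite ltr_norml; lra.
  have -> : (g t - g c) / (t - c) = (g c - g t) / (c - t).
    by rewrite -[in RHS]opprB -[in RHS](opprB t c) invrN mulrNN.
  have ct0 : 0 < c - t by rewrite subr_gt0 lt_neqAle tc'.
  by rewrite ltr_pdivrMr // => /ltW.
lra.
Qed.

End absolutely_continuous.

(** * Potter bounds for slowly varying functions *)

Section potter.
Context {R : realType}.
Implicit Types (a b c : R) (f g : R -> R).

Lemma powR_div (x y b : R) : 0 < x -> 0 < y -> (x / y) `^ b = x `^ b / y `^ b.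
Proof.
move=> x0 y0; rewrite powRM ?invr_ge0 ?ltW // -(powR_inv1 (ltW y0)) -powRrM.
by rewrite mulN1r powRN.
Qed.

(** Valid whatever the sign of [c], hence of the monotony of the power. *)
Lemma powR_le_ends a b z c : 0 < a -> a <= z -> z <= b ->
  z `^ c <= a `^ c + b `^ c.
Proof.
move=> a0 az zb; have [z0 b0] : 0 < z /\ 0 < b by split; lra.
have [c0|c0] := leP 0 c.
  have := powR_ge0 a c; suff : z `^ c <= b `^ c by lra.
  by apply: ge0_ler_powR; rewrite ?nnegrE // ltW.
have := powR_ge0 b c; suff : z `^ c <= a `^ c by lra.
rewrite -[c]opprK !(powRN _ (- c)) lef_pV2 ?posrE ?powR_gt0 //.
by apply: ge0_ler_powR; rewrite ?nnegrE; lra.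
Qed.

Lemma ac_bounded a b f : a <= b -> abs_continuous_on a b f ->
  exists M : R, forall x, a <= x <= b -> `|f x| <= M.
Proof.
move=> ab ac.
have cf : {within `[a, b], continuous (fun x => `|f x|)}.
  apply/subspace_continuousP => x /= xab; apply/cvgrPdist_lt => e e0.
  have [d d0 H] := ac e e0.
  have H2 u v : a <= u -> u <= v -> v <= b -> v - u < d -> `|f v - f u| < e.
    move=> au uv vb vud.
    have := H 1%N (fun=> u) (fun=> v); rewrite !big_ord1; apply=> //.
    by move=> i j; rewrite !ord1 eqxx.
  move: xab; rewrite in_itv /= => /andP[ax xb].
  exists d => //= y xy; rewrite in_itv /= => /andP[ay yb].
  apply: le_lt_trans (ler_dist_dist _ _) _.
  move: xy; rewrite /ball /= ltr_norml => /andP[xy1 xy2].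
  have [yx|xy] := leP y x; first by apply: H2; lra.
  by rewrite distrC; apply: H2; lra.
have [c _ H] := EVT_max ab cf; exists `|f c| => x xab; exact: H.
Qed.

Lemma ac_mul a b f g : a <= b -> abs_continuous_on a b f ->
  abs_continuous_on a b g -> abs_continuous_on a b (fun x => f x * g x).
Proof.
move=> ab acf acg e e0.
have [M1 H1] := ac_bounded ab acf; have [M2 H2] := ac_bounded ab acg.
pose M := `|M1| + `|M2| + 1.
have M0 : 0 < M by rewrite /M; have := normr_ge0 M1; have := normr_ge0 M2; lra.
have Mf x : a <= x <= b -> `|f x| <= M.
  by move=> /H1; have := ler_norm M1; have := normr_ge0 M2; rewrite /M; lra.
have Mg x : a <= x <= b -> `|g x| <= M.
  by move=> /H2; have := ler_norm M2; have := normr_ge0 M1; rewrite /M; lra.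
have eM : 0 < e / (2 * M) by rewrite divr_gt0 // mulr_gt0.
have [d1 d10 D1] := acf _ eM; have [d2 d20 D2] := acg _ eM.
exists (Num.min d1 d2) => [|n x y xy dis]; first by rewrite lt_min d10.
rewrite lt_min => /andP[s1 s2].
have := D1 n x y xy dis s1; have := D2 n x y xy dis s2.
rewrite !ltr_pdivlMr ?mulr_gt0 // => F2 F1.
suff : \sum_(i < n) `|f (y i) * g (y i) - f (x i) * g (x i)| <=
    M * \sum_(i < n) `|f (y i) - f (x i)| + M * \sum_(i < n) `|g (y i) - g (x i)|.
  lra.
rewrite !mulr_sumr -big_split /=; apply: ler_sum => i _.
have [ax xyi yb] := xy i.
have -> : f (y i) * g (y i) - f (x i) * g (x i) =
   (f (y i) - f (x i)) * g (y i) + f (x i) * (g (y i) - g (x i)) by ring.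
apply: le_trans (ler_normD _ _) _; rewrite !normrM; apply: lerD.
  by rewrite mulrC; apply: ler_wpM2r => //; apply: Mg; lra.
by apply: ler_wpM2r => //; apply: Mf; lra.
Qed.

Lemma ac_powR a b c : 0 < a -> a <= b ->
  abs_continuous_on a b (fun x => x `^ c).
Proof.
move=> a0 ab.
pose L := `|c| * (a `^ (c - 1) + b `^ (c - 1)).
have L0 : 0 <= L by rewrite mulr_ge0 // addr_ge0 // powR_ge0.
have lip u v : a <= u -> u <= v -> v <= b ->
    `|v `^ c - u `^ c| <= L * (v - u).
  move=> au uv vb.
  have D x : x \in `]u, v[ -> is_derive x 1 (fun x => x `^ c) (c * x `^ (c - 1)).
    by rewrite in_itv /= => /andP[ux xv]; apply: is_derive1_powR; lra.
  have cn : {within `[u, v], continuous (fun x => x `^ c)}.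
    apply: derivable_within_continuous => x; rewrite in_itv /= => /andP[ux xv].
    by apply: derivable_powR; rewrite in_itv /= andbT; lra.
  have [w] := MVT_segment uv D cn.
  rewrite in_itv /= => /andP[uw wv] ->.
  rewrite !normrM (ger0_norm (_ : 0 <= v - u)) ?subr_ge0 //.
  apply: ler_wpM2r; first by rewrite subr_ge0.
  rewrite (ger0_norm (powR_ge0 _ _)); apply: ler_wpM2l => //.
  by apply: powR_le_ends; lra.
move=> e e0; exists (e / (L + 1)); first by rewrite divr_gt0 //; lra.
move=> n x y xy dis; rewrite ltr_pdivlMr; last by lra.
suff : \sum_(i < n) `|y i `^ c - x i `^ c| <= L * \sum_(i < n) (y i - x i).
  have : 0 <= \sum_(i < n) (y i - x i).
    by apply: sumr_ge0 => i _; have [_ ? _] := xy i; rewrite subr_ge0.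
  lra.
by rewrite mulr_sumr; apply: ler_sum => i _; have [? ? ?] := xy i; apply: lip.
Qed.

Lemma abs_continuousZ a b k f : abs_continuous_on a b f ->
  abs_continuous_on a b (fun x => k * f x).
Proof.
move=> acf e e0.
have k0 : 0 < e / (`|k| + 1) by rewrite divr_gt0 // ltr_wpDl.
have [d d0 D] := acf _ k0; exists d => // n x y xy dis xyd.
have := D n x y xy dis xyd; rewrite ltr_pdivlMr ?ltr_wpDl // => H.
under eq_bigr do rewrite -mulrBr normrM.
rewrite -mulr_sumr.
have : 0 <= \sum_(i < n) `|f (y i) - f (x i)| by apply: sumr_ge0.
lra.
Qed.

(** Slow variation makes [y^-a f(y)] decrease and [y^a f(y)] increase far out:
    the sign of either derivative is that of [y f'(y) / f(y) -+ a]. *)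
Lemma slowly_varying_potter f : slowly_varying f -> forall a, 0 < a ->
  exists2 X0 : R, 1 <= X0 & forall x y, X0 <= x -> x <= y ->
    f y <= f x * (y / x) `^ a /\ f x <= f y * (y / x) `^ a.
Proof.
move=> [f0 fac flim] a a0; have [M HM] := flim a a0.
exists (`|M| + 1) => [|x y Mx xy]; first by rewrite lerDr.
have M1 := normr_ge0 M; have M2 := ler_norm M.
have x0 : 0 < x by lra.
have y0 : 0 < y by lra.
have [<-|xy'] := eqVneq x y; first by rewrite divff ?gt_eqF // powR1 mulr1.
have {xy'}xy' : x < y by rewrite lt_neqAle xy'.
(* [c] is [- a] or [a], and [s] turns both claims into a decrease *)
have key (s c : R) : `|c| = a -> s * c = - a -> `|s| = 1 ->
    s * (f y * y `^ c) <= s * (f x * x `^ c).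
  move=> ca sc s1.
  apply: (@ac_nonincreasing R x y (fun z => s * (f z * z `^ c)) xy').
    apply: abs_continuousZ; apply: ac_mul => //; first exact: fac.
    exact: ac_powR.
  case: HM => N [mN N0 HN]; exists N; split=> // z /= nz.
  apply: HN => Hz; apply: nz => /andP[xz zy].
  have z0 : 0 < z by lra.
  have [df fl] : derivable f z 1 /\ `|z * derive1 f z / f z| < a by apply: Hz; lra.
  have fz0 := f0 z z0.
  have dg : is_derive z 1 (fun z => s * (f z * z `^ c))
      (s * (f z * (c * z `^ (c - 1)) + z `^ c * derive1 f z)).
    have d1 : is_derive z (1:R) f (derive1 f z) by rewrite derive1E; apply: derivableP.
    have d2 := is_derive1_powR c z0.
    have d3 := @is_deriveM R R f (fun z => z `^ c) z 1 _ _ d1 d2.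
    have d4 := @is_deriveZ R R R (f \* (fun z => z `^ c)) s z 1 _ d3.
    exact: d4.
  split; first by case: dg.
  rewrite derive1E; have [_ ->] := dg.
  have -> : z `^ c = z * z `^ (c - 1).
    by rewrite -[X in X * _](powRr1 (ltW z0)) -powRD ?(gt_eqF z0) ?implybT //;
       congr (_ `^ _); lra.
  have -> : s * (f z * (c * z `^ (c - 1)) + z * z `^ (c - 1) * derive1 f z) =
     (s * c + s * (z * derive1 f z / f z)) * (f z * z `^ (c - 1)).
    by field; rewrite gt_eqF.
  rewrite pmulr_lle0 ?mulr_gt0 ?powR_gt0 //.
  have : `|s * (z * derive1 f z / f z)| < a by rewrite normrM s1 mul1r.
  rewrite ltr_norml; lra.
have px : 0 < x `^ a by apply: powR_gt0.
have py : 0 < y `^ a by apply: powR_gt0.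
rewrite powR_div // !mulrA !ler_pdivlMr //; split.
  have := key 1 (- a); rewrite normrN gtr0_norm // normr1 mul1r => /(_ erefl erefl erefl).
  rewrite !mul1r !powRN ler_pdivrMr // mulrAC ler_pdivlMr //; lra.
have := key (- 1) a; rewrite gtr0_norm // normrN normr1 mulN1r => /(_ erefl erefl erefl).
by rewrite !mulN1r lerN2.
Qed.

End potter.

(** * Coordinates in finite-dimensional seminormed spaces *)

Section almost_auerbach.
Context {R : realType} (E : lmodType R) (N : E -> R).
Hypothesis N_tri : forall x y, N (x + y) <= N x + N y.
Hypothesis N_hom : forall a x, N (a *: x) = `|a| * N x.

Let N0 : N 0 = 0.
Proof. by rewrite -(scale0r 0) N_hom normr0 mul0r. Qed.

Let NN x : N (- x) = N x.
Proof. by rewrite -scaleN1r N_hom normrN normr1 mul1r. Qed.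

Let N_ge0 x : 0 <= N x.
Proof. by have := N_tri x (- x); rewrite subrr N0 NN; lra. Qed.

Let N_sum r (a : nat -> R) (e : nat -> E) : (forall i, N (e i) <= 1) ->
  N (\sum_(i < r) a i *: e i) <= \sum_(i < r) `|a i|.
Proof.
move=> e1; elim: r => [|r IH]; first by rewrite !big_ord0 N0.
rewrite !big_ord_recr /=; apply: le_trans (N_tri _ _) _; apply: lerD => //.
by rewrite N_hom ler_piMr.
Qed.

Let N_sub x y : N y = 0 -> N (x - y) <= N x.
Proof. by move=> y0; have := N_tri x (- y); rewrite NN y0 addr0. Qed.

Let span (b : nat -> E) r : set E :=
  [set x | exists a : nat -> R, x = \sum_(i < r) a i *: b i].

Let spanD b r x y t : span b r x -> span b r y -> span b r (x + t *: y).
Proof.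
move=> [a ->] [c ->]; exists (fun i => a i + t * c i).
rewrite scaler_sumr -big_split; apply: eq_bigr => i _ /=.
by rewrite scalerDl scalerA.
Qed.

Let span0 b r : span b r 0.
Proof. by exists (fun=> 0); rewrite big1 // => i _; rewrite scale0r. Qed.

Let span_sum b r s (a : nat -> R) (e : nat -> E) : (forall i, span b r (e i)) ->
  span b r (\sum_(i < s) a i *: e i).
Proof.
move=> h; elim: s => [|s IH]; first by rewrite big_ord0; apply: span0.
by rewrite big_ord_recr /=; apply: spanD.
Qed.

(** Equality with the combination of the [e i] is required only modulo the kernel
    of [N], which is a seminorm; vectors of [e] may vanish. *)
Let system b r C (e : nat -> E) : Prop :=
  [/\ forall i, span b r (e i), forall i, N (e i) <= 1 &
      forall x, span b r x -> exists a : nat -> R,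
        (forall i, `|a i| <= C * N x) /\ N (x - \sum_(i < r) a i *: e i) = 0].

(** A finite-dimensional space is complete for the seminorm, so that the
    distance to it is attained when it vanishes. *)
Let dist_attained b r C e v : 0 <= C -> system b r C e ->
  (forall eps, 0 < eps -> exists2 s, span b r s & N (v - s) < eps) ->
  exists2 s, span b r s & N (v - s) = 0.
Proof.
move=> C0 [eS e1 sys] H.
have gk0 (k : nat) : 0 < (2^-1) ^+ k :> R by rewrite exprn_gt0 // invr_gt0.
have /choice[s Hs] : forall k : nat, exists s,
    span b r s /\ N (v - s) < (2^-1) ^+ k.
  by move=> k; have [s sS sN] := H _ (gk0 k); exists s.
have /choice[a Ha] : forall k : nat, exists a : nat -> R,
    (forall i, `|a i| <= C * (2 * (2^-1) ^+ k)) /\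
    N (s k.+1 - s k - \sum_(i < r) a i *: e i) = 0.
  move=> k; have [|a [a1 a2]] := sys (s k.+1 - s k).
    by rewrite -scaleN1r; apply: spanD; [have [] := Hs k.+1|have [] := Hs k].
  exists a; split=> // i; apply: le_trans (a1 i) _; apply: ler_wpM2l => //.
  have -> : s k.+1 - s k = (v - s k) - (v - s k.+1) by rewrite opprB [RHS]addrC [RHS]addrA subrK.
  have := N_tri (v - s k) (- (v - s k.+1)); rewrite NN.
  have [_] := Hs k; have [_] := Hs k.+1; rewrite exprS; have := gk0 k; lra.
pose A i := series (fun k => a k i).
have cvgA i : cvgn (A i).
  apply: normed_cvg.
  apply: (@series_le_cvg _ _ (geometric (C * 2) (2^-1))) => [k|k|k|].
  - exact: normr_ge0.
  - by rewrite /geometric /= mulr_ge0 ?mulr_ge0 // ltW.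
  - by rewrite /geometric /= -mulrA; have [h _] := Ha k.
  - by apply: is_cvg_geometric_series; rewrite ger0_norm ?invr_ge0 //; lra.
pose S := s 0%N + \sum_(i < r) limn (A i) *: e i.
exists S.
  have := spanD 1 (Hs 0%N).1 (span_sum r (fun i => limn (A i)) eS).
  by rewrite scale1r.
have telescope K : N (s K - (s 0%N + \sum_(i < r) A i K *: e i)) = 0.
  elim: K => [|K IH].
    rewrite big1 ?addr0 ?subrr // => i _.
    by rewrite /A /series /= big_geq // scale0r.
  apply/eqP; rewrite eq_le N_ge0 andbT.
  have -> : s K.+1 - (s 0%N + \sum_(i < r) A i K.+1 *: e i) =
     (s K - (s 0%N + \sum_(i < r) A i K *: e i)) +
     (s K.+1 - s K - \sum_(i < r) a K i *: e i).
    under eq_bigr do rewrite /A seriesSr /= scalerDl.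
    rewrite big_split /= addrA opprD addrA [RHS]addrA; congr (_ - _).
    by rewrite [RHS]addrC [RHS]addrA subrK.
  by apply: le_trans (N_tri _ _) _; rewrite IH (Ha K).2 addr0.
have bound K : N (v - S) <= (2^-1) ^+ K + \sum_(i < r) `|A i K - limn (A i)|.
  have -> : v - S = (v - s K) + ((s K - (s 0%N + \sum_(i < r) A i K *: e i)) +
     \sum_(i < r) (A i K - limn (A i)) *: e i).
    under [X in _ + (_ + X)]eq_bigr do rewrite scalerBl.
    rewrite sumrB /S opprD !addrA subrK.
    by rewrite opprD !addrA subrK.
  apply: le_trans (N_tri _ _) _; apply: lerD; first by have [_ /ltW] := Hs K.
  apply: le_trans (N_tri _ _) _; rewrite telescope add0r.
  exact: (@N_sum r (fun i => A i K - limn (A i)) e e1).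
apply/eqP; rewrite eq_le N_ge0 andbT.
have gen m : \sum_(i < m) `|A i K - limn (A i)| @[K --> \oo] --> (0 : R).
  elim: m => [|m IH].
    by under eq_fun do rewrite big_ord0; exact: cvg_cst.
  have Am : `|A m K - limn (A m)| @[K --> \oo] --> (0 : R).
    by apply/norm_cvg0P/subr_cvg0; exact: cvgA.
  have := cvgD IH Am; rewrite addr0 => /(_ _).
  suff -> : (fun K => \sum_(i < m.+1) `|A i K - limn (A i)|) =
    (fun K => \sum_(i < m) `|A i K - limn (A i)|) \+
    (fun K => `|A m K - limn (A m)|) by [].
  by apply/funext => K; rewrite big_ord_recr.
have half0 : (2^-1 : R) ^+ K @[K --> \oo] --> (0 : R).
  by apply: cvg_expr; rewrite ger0_norm ?invr_ge0 //; lra.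
have lim0 : (2^-1) ^+ K + \sum_(i < r) `|A i K - limn (A i)| @[K --> \oo]
    --> (0 : R).
  by have := cvgD half0 (gen r); rewrite addr0 => /(_ _).
rewrite -(cvg_lim _ lim0) //; apply: limr_ge; first exact: (cvgP _ lim0).
exact: nearW.
Qed.

(** A weak form of Auerbach's lemma.  The coordinates need only be bounded by a
    constant depending on the dimension, so that the new vector of the system
    is taken at less than twice the minimal distance to the span of the previous ones.  *)
Lemma almost_auerbach b r : exists e, system b r (3 ^+ r) e.
Proof.
elim: r => [|r [e sys]].
  exists (fun=> 0); split=> [i|i|x [a ->]].
  - exact: span0.
  - by rewrite N0.
  by exists (fun=> 0); rewrite !big_ord0 subrr N0; split=> // i; rewrite normr0 mulr0.
have [eS e1 coord] := sys.
have up x : span b r x -> span b r.+1 x.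
  move=> [a ->]; exists (fun i => if (i < r)%N then a i else 0).
  rewrite big_ord_recr /= ltnn scale0r addr0.
  by apply: eq_bigr => i _; rewrite ltn_ord.
have decomp x : span b r.+1 x -> exists t s, span b r s /\ x = s + t *: b r.
  by move=> [a ->]; exists (a r), (\sum_(i < r) a i *: b i); rewrite big_ord_recr; split=> //; exists a.
have C0 : 0 <= 3 ^+ r :> R by rewrite exprn_ge0.
(* either the new vector is in the span modulo the kernel, or it is far from it *)
have [[s0 s0S s00]|far] := pselect (exists2 s, span b r s & N (b r - s) = 0).
  exists (fun i => if (i < r)%N then e i else 0); split=> [i|i|x].
  - by case: ifP => _; [apply/up/eS|apply: span0].
  - by case: ifP => _; rewrite ?N0.
  move=> /decomp[t [s [sS ->]]].
  have z : N (t *: (b r - s0)) = 0 by rewrite N_hom s00 mulr0.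
  have E1 : s + t *: b r - t *: (b r - s0) = s + t *: s0.
    by rewrite scalerBr opprB addrA addrAC addrK.
  have [a [a1 a2]] := coord (s + t *: s0) (spanD t sS s0S).
  exists a; split=> [i|].
    apply: le_trans (a1 i) _; rewrite exprS -mulrA.
    have : N (s + t *: s0) <= N (s + t *: b r) by rewrite -E1; apply: N_sub.
    move=> h; have := ler_wpM2l C0 h; have := N_ge0 (s + t *: s0).
    move=> h0; have := mulr_ge0 C0 h0; lra.
  rewrite big_ord_recr /= ltnn scaler0 addr0.
  under eq_bigr do rewrite ltn_ord.
  apply/eqP; rewrite eq_le N_ge0 andbT.
  have -> : s + t *: b r = (s + t *: s0) + t *: (b r - s0) by rewrite -E1 subrK.
  rewrite addrAC; apply: le_trans (N_tri _ _) _; by rewrite z a2 addr0.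
have [d d0 dN] : exists2 d, 0 < d & forall s, span b r s -> d <= N (b r - s).
  apply: contrapT => nd; apply: far; apply: (dist_attained C0 sys) => eps eps0.
  apply: contrapT => ns; apply: nd; exists eps => // s sS.
  by rewrite leNgt; apply/negP => lt; apply: ns; exists s.
pose D := [set N (b r - s) | s in span b r].
have infD : has_inf D.
  by split; [exists (N (b r - 0)), 0 => //; apply: span0|exists d => _ [s sS <-]; apply: dN].
pose m := inf D.
have m0 : 0 < m.
  apply: lt_le_trans d0 _; apply: lb_le_inf; first by case: infD.
  by move=> _ [s sS <-]; apply: dN.
have mN s : span b r s -> m <= N (b r - s).
  by move=> sS; apply: ge_inf; [case: infD|exists s].
(* the factor two of near-minimality is what turns [3 ^+ r] into [3 ^+ r.+1] *)
have [_ [s0 s0S <-] s0N] : exists2 y, D y & y < m + m by apply: inf_adherent.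
have n0 : 0 < N (b r - s0) by apply: lt_le_trans m0 (mN _ s0S).
pose er := (N (b r - s0))^-1 *: (b r - s0).
exists (fun i => if (i < r)%N then e i else er); split=> [i|i|x].
- case: ifP => _; first exact/up/eS.
  have br : span b r.+1 (b r).
    exists (fun i => (i == r)%:R); rewrite big_ord_recr /= eqxx scale1r.
    by rewrite big1 ?add0r // => j _; rewrite ltn_eqF // scale0r.
  have := spanD (N (b r - s0))^-1 (span0 b r.+1) (spanD (- 1) br (up _ s0S)).
  by rewrite add0r scaleN1r.
- case: ifP => // _; rewrite /er N_hom ger0_norm ?invr_ge0 ?N_ge0 //.
  by rewrite mulVf ?gt_eqF.
move=> /decomp[t [s [sS ->]]].
have tN : `|t| * m <= N (s + t *: b r).
  have [->|tn] := eqVneq t 0; first by rewrite normr0 mul0r.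
  have -> : s + t *: b r = t *: (b r - (0 + (- t^-1) *: s)).
    by rewrite add0r scalerBr scaleNr scalerN opprK scalerA divff // scale1r addrC.
  rewrite N_hom; apply: ler_wpM2l => //; apply: mN; exact: spanD (span0 _ _) sS.
have E1 : s + t *: b r - t *: (b r - s0) = s + t *: s0.
  by rewrite scalerBr opprB addrA addrAC addrK.
have [a [a1 a2]] := coord (s + t *: s0) (spanD t sS s0S).
have tD : `|t| * N (b r - s0) <= 2 * N (s + t *: b r).
  have : `|t| * N (b r - s0) <= `|t| * (m + m) by apply: ler_wpM2l => //; exact: ltW.
  lra.
have sN : N (s + t *: s0) <= 3 * N (s + t *: b r).
  rewrite -E1; apply: le_trans (N_tri _ _) _; rewrite NN N_hom; lra.
have C1 : 1 <= 3 ^+ r :> R by apply: exprn_ege1; lra.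
have X0 := N_ge0 (s + t *: b r).
exists (fun i => if (i < r)%N then a i else t * N (b r - s0)); split=> [i|].
  case: ifP => _.
    apply: le_trans (a1 i) _; rewrite exprSr -mulrA; exact: ler_wpM2l.
  rewrite normrM (ger0_norm (N_ge0 (b r - s0))); apply: le_trans tD _.
  by apply: ler_wpM2r => //; rewrite exprS; lra.
rewrite big_ord_recr /= ltnn.
under eq_bigr do rewrite ltn_ord.
have -> : (t * N (b r - s0)) *: er = t *: (b r - s0).
  by rewrite /er scalerA mulfK ?gt_eqF.
by rewrite opprD addrA addrAC E1.
Qed.

End almost_auerbach.

(** * Function spaces with decomposable seminorms *)

Section lp_space.
Context {d : measure_display} {T : measurableType d} {R : realType}.
Variable mu : {measure set T -> \bar R}.

(** What the two scales of spaces have in common, so that each fact below is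
    proved once for both of them. *)
Record lp_space (p : R) (Z : set T -> set (T -> R))
    (nZ : set T -> (T -> R) -> R) : Prop := LpSpace {
  lp_gt0 : 0 < p;
  lp_subspace : forall E, measurable E -> ae_subspace mu E (Z E);
  lp_seminorm : forall E, measurable E -> ae_seminorm mu E (Z E) (nZ E);
  lp_restrict : forall E, measurable E -> Z E = ae_restrict mu (Z [set: T]) E;
  lp_null : forall E, measurable E -> mu E = 0%E -> ae_dim mu E (Z E) 0;
  lp_decomp : lp_decomposable mu p Z nZ }.

Lemma function_spaces_X p q X nX Y nY : 0 < p ->
  function_spaces mu p q X nX Y nY -> lp_space p X nX.
Proof. by move=> p0 []. Qed.

Lemma function_spaces_Y p q X nX Y nY : 0 < q ->
  function_spaces mu p q X nX Y nY -> lp_space q Y nY.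
Proof. by move=> q0 []. Qed.

Lemma mu_sub0 (A B : set T) : measurable A -> measurable B -> A `<=` B ->
  mu B = 0%E -> mu A = 0%E.
Proof.
move=> mA mB AB B0; apply/eqP; rewrite eq_le measure_ge0 andbT -B0.
by apply: le_measure; rewrite ?inE.
Qed.

Lemma measurable_sym (A B : set T) : measurable A -> measurable B ->
  measurable (A `+` B).
Proof.
by move=> mA mB; apply: measurableU; apply: measurableD.
Qed.

Variables (p : R) (Z : set T -> set (T -> R)) (nZ : set T -> (T -> R) -> R).
Hypothesis hZ : lp_space p Z nZ.
Implicit Types (E : set T) (f g : T -> R).

Local Notation p0 := (lp_gt0 hZ).

Lemma lp_in E f : measurable E -> Z [set: T] f -> Z E f.
Proof.
by move=> mE Zf; rewrite (lp_restrict hZ mE); exists f => //; apply: nearW.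
Qed.

Lemma lp_inD E f g : measurable E -> Z E f -> Z E g -> Z E (f \+ g).
Proof.
move=> mE Zf Zg; have := ae_subspaceP (lp_subspace hZ mE) 1 Zf Zg.
by congr (Z E _); apply/funext => x /=; rewrite mul1r.
Qed.

Lemma lp_inZ E a f : measurable E -> Z E f -> Z E (fun x => a * f x).
Proof.
move=> mE Zf; have sE := lp_subspace hZ mE.
have := ae_subspaceP sE a Zf (ae_subspace0 sE).
by congr (Z E _); apply/funext => x /=; rewrite addr0.
Qed.

Lemma lp_inB E f g : measurable E -> Z E f -> Z E g -> Z E (f \- g).
Proof.
move=> mE Zf Zg; have := ae_subspaceP (lp_subspace hZ mE) (- 1) Zg Zf.
by congr (Z E _); apply/funext => x /=; rewrite mulN1r addrC.
Qed.

Lemma lp_in0 E : measurable E -> Z E (fun=> 0).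
Proof. by move=> mE; apply: (ae_subspace0 (lp_subspace hZ mE)). Qed.

Lemma lp_ge0 E f : measurable E -> Z E f -> 0 <= nZ E f.
Proof. by move=> mE; apply: (ae_seminorm_ge0 (lp_seminorm hZ mE)). Qed.

Lemma lp_ae E f g : measurable E -> Z E f -> f = g %[ae mu in E] ->
  nZ E f = nZ E g.
Proof.
by move=> mE Zf fg; apply: (ae_seminormE (lp_seminorm hZ mE)).
Qed.

Lemma lp_nZZ E a f : measurable E -> Z E f ->
  nZ E (fun x => a * f x) = `|a| * nZ E f.
Proof. by move=> mE; apply: (ae_seminormZ (lp_seminorm hZ mE)). Qed.

Lemma lp_nZ0 E : measurable E -> nZ E (fun=> 0) = 0.
Proof.
move=> mE; have H := lp_nZZ 0 mE (lp_in0 mE).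
rewrite normr0 (mul0r (nZ E _)) in H; rewrite -[RHS]H.
by congr nZ; apply/funext => x; rewrite mul0r.
Qed.

Lemma lp_nZD E f g : measurable E -> Z E f -> Z E g ->
  nZ E (f \+ g) <= nZ E f + nZ E g.
Proof. by move=> mE; apply: (ae_seminormD (lp_seminorm hZ mE)). Qed.

Lemma lp_nZN E f g : measurable E -> Z E f -> Z E g ->
  nZ E (f \- g) = nZ E (g \- f).
Proof.
move=> mE Zf Zg; have := lp_nZZ (- 1) mE (lp_inB mE Zg Zf).
rewrite normrN normr1 mul1r => <-; congr nZ; apply/funext => x /=; ring.
Qed.

Lemma lp_nZB E f g : measurable E -> Z E f -> Z E g ->
  nZ E (f \- g) <= nZ E f + nZ E g.
Proof.
move=> mE Zf Zg; have := lp_nZD mE Zf (lp_inZ (- 1) mE Zg).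
rewrite lp_nZZ // normrN normr1 mul1r; apply: le_trans.
by rewrite le_eqVlt; apply/orP; left; apply/eqP; congr nZ; apply/funext => x /=;
  rewrite mulN1r.
Qed.

Lemma lp_null0 E f : measurable E -> mu E = 0%E -> Z E f -> nZ E f = 0.
Proof.
move=> mE E0 Zf; have [b [_ _ H]] := lp_null hZ mE E0.
have [c fc] := H f Zf; rewrite (lp_ae mE Zf fc).
by rewrite -[RHS](lp_nZ0 mE); congr nZ; apply/funext => x; rewrite big_ord0.
Qed.

Lemma lp_norm_finite (a : nat -> R) n : (forall j, 0 <= a j) ->
  (forall j, (n <= j)%N -> a j = 0) ->
  (lp_norm p a `^ p = (\sum_(j < n) a j `^ p)%:E)%E.
Proof.
move=> a0 an; rewrite /lp_norm Lnorm_counting ?p0 //.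
rewrite -poweRrM mulVf ?gt_eqF ?p0 // poweRe1; last first.
  by apply: nneseries_ge0 => *; exact: poweR_ge0.
rewrite (nneseries_split 0 n); last by move=> *; exact: poweR_ge0.
rewrite add0n [X in (_ + X)%E]eseries0 ?adde0; last first.
  move=> i ni _ /=; rewrite an // normr0 powR0 ?gt_eqF ?p0 //.
rewrite big_mkord -sumEFin; apply: eq_bigr => i _ /=.
by rewrite ger0_norm.
Qed.

Lemma lp_sum_exact (n : nat) (D : nat -> set T) E f :
  (forall j, (j < n)%N -> measurable (D j)) ->
  (forall i j, (i < n)%N -> (j < n)%N -> i <> j -> mu (D i `&` D j) = 0%E) ->
  E = \bigcup_(j in `I_n) D j -> Z [set: T] f ->
  nZ E f `^ p = \sum_(j < n) nZ (D j) f `^ p.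
Proof.
move=> mD D0 ED Zf.
pose G j := if (j < n)%N then D j else set0.
have mG j : measurable (G j) by rewrite /G; case: ifP => // /mD.
have EG : E = \bigcup_j G j.
  rewrite ED; apply/seteqP; split=> x [j]; rewrite /= => jn Dx.
    by exists j => //; rewrite /G jn.
  by move: Dx; rewrite /G; case: ifP => // jn' Dx; exists j.
have mE : measurable E by rewrite EG; apply: bigcupT_measurable.
have := lp_decomp hZ mE mG EG _ (lp_in mE Zf).
have G0 : forall i j, i <> j -> mu (G i `&` G j) = 0%E.
  move=> i j ij; rewrite /G; case: ifP => ni; last by rewrite set0I measure0.
  by case: ifP => nj; [apply: D0|rewrite setI0 measure0].
move=> /(_ G0) /(congr1 (fun x => (x `^ p)%E)).
rewrite (@lp_norm_finite _ n).
- rewrite poweR_EFin => -[->]; apply: eq_bigr => i _.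
  by rewrite /G ltn_ord.
- by move=> j; apply: lp_ge0 => //; apply: lp_in.
- move=> j nj; rewrite /G ltnNge nj /=; apply: lp_null0 => //.
  exact: lp_in.
Qed.

Let powp_inj x y : 0 <= x -> 0 <= y -> x `^ p = y `^ p -> x = y.
Proof.
by move=> x0 y0; apply: (powR_injective p0); rewrite ?nnegrE.
Qed.

Let powp_le x y : 0 <= x -> 0 <= y -> x `^ p <= y `^ p -> x <= y.
Proof.
move=> x0 y0; apply: contraTT; rewrite -!ltNge => yx.
by apply: (gt0_ltr_powR p0); rewrite ?nnegrE.
Qed.

Lemma lp_sum2 A B f : measurable A -> measurable B -> mu (A `&` B) = 0%E ->
  Z [set: T] f -> nZ (A `|` B) f `^ p = nZ A f `^ p + nZ B f `^ p.
Proof.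
move=> mA mB AB Zf.
have -> := @lp_sum_exact 2 (fun j => if j is 0%N then A else B) (A `|` B) f.
- by rewrite !big_ord_recr big_ord0 /= add0r.
- by move=> [|j].
- by move=> [|[|i]] [|[|j]] // _ _ _; rewrite setIC.
- apply/seteqP; split=> x /=; first by case=> [Ax|Bx]; [exists 0%N|exists 1%N].
  by move=> [[|j] _] /=; [left|right].
- by [].
Qed.

Lemma lp_mono A B f : measurable A -> measurable B -> A `<=` B ->
  Z [set: T] f -> nZ A f <= nZ B f.
Proof.
move=> mA mB AB Zf; have mBA := measurableD mB mA.
apply: powp_le; rewrite ?lp_ge0 //; try exact: lp_in.
have -> : B = A `|` (B `\` A) by rewrite setDUK.
rewrite lp_sum2 //; first by rewrite lerDl powR_ge0.
by rewrite setDIK measure0.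
Qed.

Lemma lp_sub_ae A B f : measurable A -> measurable B -> A `<=` B ->
  mu (B `\` A) = 0%E -> Z [set: T] f -> nZ A f = nZ B f.
Proof.
move=> mA mB AB BA0 Zf; have mBA := measurableD mB mA.
apply: powp_inj; rewrite ?lp_ge0 //; try exact: lp_in.
have -> : B = A `|` (B `\` A) by rewrite setDUK.
rewrite lp_sum2 //; last first.
  by rewrite setDIK measure0.
by rewrite (lp_null0 mBA) ?powR0 ?addr0 ?gt_eqF ?p0 //; apply: lp_in.
Qed.

Lemma lp_set_ae A B f : measurable A -> measurable B ->
  mu (A `+` B) = 0%E -> Z [set: T] f -> nZ A f = nZ B f.
Proof.
move=> mA mB AB Zf; have mAB := measurable_sym mA mB.
have mI := measurableI _ _ mA mB.
rewrite -(@lp_sub_ae (A `&` B) A) ?(@lp_sub_ae (A `&` B) B) //.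
- apply: mu_sub0 AB => //; first exact: measurableD.
  by move=> x [Bx nAB]; right; split=> // Ax; apply: nAB.
- apply: mu_sub0 AB => //; first exact: measurableD.
  by move=> x [Ax nAB]; left; split=> // Bx; apply: nAB.
Qed.

Lemma measurable_bigcup_seq (I : choiceType) (s : seq I) (D : I -> set T) :
  (forall i, i \in s -> measurable (D i)) ->
  measurable (\bigcup_(i in [set` s]) D i).
Proof.
by move=> mD; rewrite bigcup_seq big_seq; apply: bigsetU_measurable.
Qed.

Lemma null_bigcup_seq (I : choiceType) (s : seq I) (D : I -> set T) :
  (forall i, i \in s -> measurable (D i)) ->
  (forall i, i \in s -> mu (D i) = 0%E) ->
  mu (\bigcup_(i in [set` s]) D i) = 0%E.
Proof.
rewrite bigcup_seq; elim: s => [|i s IH] mD D0; first by rewrite big_nil measure0.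
rewrite big_cons; apply: null_set_setU.
- by apply: mD; rewrite mem_head.
- rewrite big_seq; apply: bigsetU_measurable => j js.
  by apply: mD; rewrite inE js orbT.
- by apply: D0; rewrite mem_head.
- by apply: IH => j js; [apply: mD|apply: D0]; rewrite inE js orbT.
Qed.

(** Countable decompositions are completed by empty sets, and a covering up to a
    null set suffices, because the seminorms ignore null sets. *)
Lemma lp_sum (I : choiceType) (s : seq I) (D : I -> set T) E f :
  uniq s -> measurable E -> (forall i, i \in s -> measurable (D i)) ->
  (forall i j, i \in s -> j \in s -> i <> j -> mu (D i `&` D j) = 0%E) ->
  mu (E `+` \bigcup_(i in [set` s]) D i) = 0%E -> Z [set: T] f ->
  nZ E f `^ p = \sum_(i <- s) nZ (D i) f `^ p.
Proof.
move=> us mE mD D0 ED Zf.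
case: s us mD D0 ED => [|i0 s] us mD D0 ED.
  rewrite big_nil (lp_null0 mE) ?powR0 ?gt_eqF ?p0 //; last exact: lp_in.
  by rewrite -[E]setY0 -ED; congr (mu (_ `+` _)); rewrite bigcup_seq big_nil.
set s' := i0 :: s in us mD D0 ED *.
have mU := measurable_bigcup_seq mD.
have eqU : \bigcup_(i in [set` s']) D i =
    \bigcup_(j in `I_(size s')) D (nth i0 s' j).
  apply/seteqP; split=> x [i /= si Dx].
    by exists (index i s'); [move: si; rewrite -index_mem|rewrite nth_index].
  by exists (nth i0 s' i) => //=; apply: mem_nth.
rewrite (lp_set_ae mE mU) // (lp_sum_exact (n := size s')
   (D := fun j => D (nth i0 s' j)) _ _ eqU) //.
- by rewrite (big_nth i0) big_mkord.
- by move=> j js; apply: mD; apply: mem_nth.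
- move=> i j si sj ij; apply: D0; rewrite ?mem_nth // => /eqP.
  by rewrite nth_uniq // => /eqP.
Qed.

Lemma lp_sum_le (I : choiceType) (s : seq I) (D : I -> set T) E f :
  uniq s -> measurable E -> (forall i, i \in s -> measurable (D i)) ->
  (forall i j, i \in s -> j \in s -> i <> j -> mu (D i `&` D j) = 0%E) ->
  (forall i, i \in s -> mu (D i `\` E) = 0%E) -> Z [set: T] f ->
  \sum_(i <- s) nZ (D i) f `^ p <= nZ E f `^ p.
Proof.
move=> us mE mD D0 DE Zf.
pose U := \bigcup_(i in [set` s]) D i.
have mU : measurable U by apply: measurable_bigcup_seq.
have UU : mu (U `+` U) = 0%E by rewrite setYK measure0.
rewrite -(lp_sum us mU mD D0 UU Zf).
have mUE := measurableI _ _ mU mE.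
rewrite -(@lp_sub_ae (U `&` E) U) //; last first.
  rewrite setDIr setDv set0U -(@null_bigcup_seq _ s (fun i => D i `\` E)) //.
    by congr (mu _); rewrite setD_bigcupl.
  by move=> i /mD mDi; apply: measurableD.
apply: ge0_ler_powR; rewrite ?nnegrE ?lp_ge0 ?(ltW p0) //; try exact: lp_in.
by apply: lp_mono.
Qed.

End lp_space.

(** * Trees, branches and heavy vertices *)

Lemma counting_seq {R : realType} (I : choiceType) (A : set I) (c : R) :
  (counting A <= c%:E :> \bar R)%E ->
  exists s : seq I, [/\ uniq s, (forall x, x \in s <-> A x) &
    (size s)%:R <= c].
Proof.
rewrite /counting; case: ifPn => [/asboolP fin|_]; last by rewrite leye_eq.
rewrite lee_fin => le; exists (fset_set A).
by split=> // x; rewrite -[x \in _]/(x \in fset_set A) in_fset_set //; split=>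
  [/set_mem|/mem_set].
Qed.

Section tree_order.
Context {R : realType}.
Variables (V : countType) (e : rel V) (root : V).
Hypothesis tr : is_tree e.

Let e_sym : symmetric e. Proof. by case: tr. Qed.

Lemma path_back x s : path e x s ->
  [/\ path e (last x s) (rev (belast x s)),
      last (last x s) (rev (belast x s)) = x
    & forall z, z \in rev (belast x s) -> z \in x :: s].
Proof.
move=> ps; split.
- by rewrite rev_path; apply: sub_path ps => a b; rewrite e_sym.
- by case: s {ps} => //= a s; rewrite rev_cons last_rcons.
- by move=> z; rewrite mem_rev => /mem_belast.
Qed.

(** Two simple paths that separate at a vertex and meet again would close a simple
    cycle there. *)
Lemma simple_path_unique x y s s' :
  simple_path e x y s -> simple_path e x y s' -> s = s'.
Proof.
elim: s x s' => [|a s IH] x s'.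
  move=> [_ _ /= xy] [_ us' ls']; case: s' us' ls' => //= b s'.
  by rewrite -xy => /andP[xs _] ls; rewrite -{1}ls mem_last in xs.
move=> [/= /andP[xa pa] /andP[xs us] la]; case: s' => [|b s'].
  by move=> [_ _ /= xy]; rewrite xy -la mem_last in xs.
move=> [/= /andP[xb pb] /andP[xs' us'] lb].
have [ab|ab] := eqVneq a b.
  by subst b; congr (a :: _); apply: (IH a).
exfalso.
have [pb' lb' mb'] := path_back pb.
rewrite lb in pb' lb'.
pose w := s ++ rev (belast b s').
have pw : path e a w by rewrite cat_path pa la.
have lw : last a w = b by rewrite last_cat la.
have xw : x \notin a :: w.
  rewrite -cat_cons mem_cat negb_or xs /=.
  by apply/negP => /mb' h; rewrite h in xs'.
case: (shortenP pw) lw xw => w' pw' uw' sw' lw xw.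
case: tr => _ _ _ /(_ [:: x, a & w']); apply.
  case: w' lw {pw' uw' sw'} => //= l; by rewrite l eqxx in ab.
rewrite /ucycle /= rcons_path xa pw' lw e_sym xb /=.
move: uw'; rewrite /= => -> ; rewrite andbT.
apply/negP => xin; move/negP: xw; apply; move: xin; rewrite !inE.
by case/orP=> [->//|/sw' ->]; rewrite orbT.
Qed.

Lemma root_path_ex y : exists s, simple_path e root y s.
Proof.
case: tr => _ _ conn _; have [s ps ls] := conn root y.
case: (shortenP ps) ls => s' ps' us' _ ls'.
by exists s'.
Qed.

Definition root_path y : seq V := sval (cid (root_path_ex y)).

Lemma root_pathP y : simple_path e root y (root_path y).
Proof. by rewrite /root_path; case: cid. Qed.

Lemma root_path_eq y s : simple_path e root y s -> root_path y = s.
Proof. by move=> sp; apply: simple_path_unique sp; exact: root_pathP. Qed.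

Lemma last_root_path y : last root (root_path y) = y.
Proof. by have [] := root_pathP y. Qed.

Lemma root_path_cat y s1 s2 : root_path y = s1 ++ s2 ->
  root_path (last root s1) = s1.
Proof.
move=> E; apply: root_path_eq; have [] := root_pathP y; rewrite E.
rewrite cat_path => /andP[p1 _]; rewrite -cat_cons cat_uniq => /andP[u1 _] _.
by split.
Qed.

Lemma root_path_inj x y : root_path x = root_path y -> x = y.
Proof.
by move=> E; rewrite -(last_root_path x) E last_root_path.
Qed.

Definition depth y := size (root_path y).

Local Notation "x <=t y" := (tree_le e root x y) (at level 70).

Lemma root_path_root : root_path root = [::].
Proof. by apply: root_path_eq; split. Qed.

Lemma tree_leP x y : x <=t y <-> exists s, root_path y = root_path x ++ s.
Proof.
split=> [[s sp]|[s E]].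
  rewrite -(root_path_eq sp) inE => /orP[/eqP->|].
    by exists (root_path y); rewrite root_path_root.
  move=> xy; have [s1 [s2 E]] : exists s1 s2, root_path y = s1 ++ x :: s2.
    by case/splitPr: xy => s1 s2; exists s1, s2.
  exists s2.
  have := @root_path_cat y (rcons s1 x) s2.
  by rewrite last_rcons cat_rcons => /(_ E) ->; rewrite E cat_rcons.
exists (root_path y); first exact: root_pathP.
rewrite E -cat_cons mem_cat; apply/orP; left.
by rewrite -{1}(last_root_path x) mem_last.
Qed.

Lemma tree_le_refl x : x <=t x.
Proof. by apply/tree_leP; exists [::]; rewrite cats0. Qed.

Lemma tree_le_root x : root <=t x.
Proof. by apply/tree_leP; exists (root_path x); rewrite root_path_root. Qed.

Lemma tree_le_trans y x z : x <=t y -> y <=t z -> x <=t z.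
Proof.
move=> /tree_leP[s sE] /tree_leP[t tE]; apply/tree_leP.
by exists (s ++ t); rewrite tE sE catA.
Qed.

Lemma tree_le_anti x y : x <=t y -> y <=t x -> x = y.
Proof.
move=> /tree_leP[s sE] /tree_leP[t tE]; apply: root_path_inj.
have := congr1 size sE; have := congr1 size tE; rewrite !size_cat.
case: t tE => [|b t] tE /=; last by lia.
by rewrite tE cats0.
Qed.

Lemma tree_lt_depth x y : x <=t y -> x <> y -> (depth x < depth y)%N.
Proof.
move=> /tree_leP[s sE] xy; rewrite /depth sE size_cat -addn1 leq_add2l.
case: s sE => // sE; case: xy; apply: root_path_inj; by rewrite sE cats0.
Qed.

(** Both points lie on the simple path to [z]. *)
Lemma tree_le_total x y z : x <=t z -> y <=t z -> x <=t y \/ y <=t x.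
Proof.
move=> /tree_leP[s sE] /tree_leP[t tE].
wlog le : x y s t sE tE / (size (root_path x) <= size (root_path y))%N.
  move=> H; case/orP: (leq_total (size (root_path x)) (size (root_path y))).
    exact: H sE tE.
  by move=> h; case: (H _ _ _ _ tE sE h); [right|left].
left; apply/tree_leP; exists (drop (size (root_path x)) (root_path y)).
have := congr1 (take (size (root_path x))) tE.
rewrite sE take_size_cat // takel_cat // => {1}->.
by rewrite cat_take_drop.
Qed.

Definition parent y := last root (belast root (root_path y)).

Lemma root_path_parent y : y <> root ->
  root_path y = rcons (root_path (parent y)) y.
Proof.
move=> yr; rewrite /parent; have := last_root_path y.
have [E|[s [z E]]] : root_path y = [::] \/ exists s z, root_path y = rcons s z.
  by case: (lastP (root_path y)) => [|s z]; [left|right; exists s, z].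
  by rewrite E /= => ry; case: yr.
rewrite E last_rcons belast_rcons /= => zy; subst z.
by rewrite (@root_path_cat y s [:: y]) // E cats1.
Qed.

Lemma parent_le y : y <> root -> parent y <=t y.
Proof.
by move=> /root_path_parent E; apply/tree_leP; exists [:: y]; rewrite E cats1.
Qed.

Lemma parent_depth y : y <> root -> depth y = (depth (parent y)).+1.
Proof. by move=> /root_path_parent E; rewrite /depth E size_rcons. Qed.

Lemma parent_neq y : y <> root -> parent y <> y.
Proof.
by move=> yr E; have := parent_depth yr; rewrite E => /n_Sn.
Qed.

Lemma parent_edge y : y <> root -> e (parent y) y.
Proof.
move=> /root_path_parent E; have [] := root_pathP y.
by rewrite E rcons_path last_root_path => /andP[].
Qed.

Lemma parent_child y : y <> root -> children e root (parent y) y.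
Proof.
move=> yr; split; last exact: parent_edge.
split; last exact: parent_le.
by move=> E; apply: (parent_neq yr).
Qed.

Lemma tree_lt_parent x y : x <=t y -> x <> y -> y <> root /\ x <=t parent y.
Proof.
move=> /tree_leP[s sE] xy.
have yr : y <> root.
  move=> yr; apply: xy; apply: root_path_inj; rewrite yr root_path_root.
  have := congr1 size sE; rewrite yr root_path_root size_cat /= => h.
  by apply: size0nil; lia.
split=> //; apply/tree_leP; move: sE; rewrite (root_path_parent yr).
case: (lastP s) => [|t z].
  by rewrite cats0 -(root_path_parent yr) => /root_path_inj yx; case: xy.
by rewrite -rcons_cat => /rcons_inj[-> _]; exists t.
Qed.

(** The order grows away from the root: a branch is what remains of the subtree
    rooted at [x] once the subtrees rooted at further points of [H] are removed. *)
Definition branch (H : set V) x : set V :=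
  [set z | x <=t z /\ forall h, H h -> x <=t h -> h <> x -> ~ h <=t z].

Lemma branch_self H x : branch H x x.
Proof.
split; first exact: tree_le_refl.
by move=> h _ xh hx hx'; apply: hx; apply: tree_le_anti.
Qed.

Lemma branch_rooted H x : subtree_rooted_at e root x (branch H x).
Proof.
have up z : branch H x z ->
    exists s, [/\ path e x s, last x s = z & forall y, y \in s -> branch H x y].
  have [n] := ubnP (depth z); elim: n z => // n IH z zn Bz.
  have [->|zx] := pselect (z = x); first by exists [::].
  have [zr xp] := tree_lt_parent Bz.1 (fun E => zx (esym E)).
  have Bp : branch H x (parent z).
    split=> // h Hh xh hx hp; apply: (Bz.2 h Hh xh hx).
    by apply: tree_le_trans hp _; apply: parent_le.
  have [|s [ps ls Bs]] := IH (parent z) _ Bp.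
    by move: zn; rewrite (parent_depth zr) !ltnS.
  exists (rcons s z); split.
  - by rewrite rcons_path ps ls /= parent_edge.
  - by rewrite last_rcons.
  - by move=> y; rewrite mem_rcons inE => /orP[/eqP->|/Bs].
split; last by split; [exact: branch_self|move=> y []].
split; first by exists x; apply: branch_self.
move=> y z /up[s [ps ls Bs]] /up[t [pt lt Bt]].
have [pb lb mb] := path_back ps; rewrite ls in pb lb.
exists (rev (belast x s) ++ t); split.
- by rewrite cat_path pb lb.
- by rewrite last_cat lb.
- move=> w; rewrite mem_cat => /orP[/mb|/Bt//].
  by rewrite inE => /orP[/eqP->|/Bs//]; apply: branch_self.
Qed.

(** The condition on [x] depends on [H] itself through its branch, but only
    through the points of [H] deeper than [x]: the circularity is resolved by
    deciding the vertices one depth after the other, the deepest first. *)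
Lemma heavy_set_exists (W : set V) (D : nat) (heavy : V -> set V -> Prop) :
  (forall x, W x -> (depth x <= D)%N) ->
  exists H : set V, H `<=` W /\
    forall x, W x -> (H x <-> heavy x (branch H x)).
Proof.
move=> WD.
suff key k : exists H : set V, [/\ H `<=` W,
    forall x, H x -> (D < depth x + k)%N &
    forall x, W x -> (D < depth x + k)%N -> (H x <-> heavy x (branch H x))].
  have [H [HW _ HP]] := key D.+1; exists H; split=> // x Wx.
  by apply: HP => //; rewrite addnS ltnS leq_addl.
elim: k => [|k [H [HW Hd HP]]].
  exists set0; split=> // x Wx; rewrite addn0 => lt.
  by have := WD x Wx; rewrite leqNgt lt.
pose H' := H `|` [set x | [/\ W x, (depth x + k = D)%N & heavy x (branch H x)]].
have same x : (D < depth x + k.+1)%N -> branch H' x = branch H x.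
  move=> dx; apply/seteqP; split=> z [xz h]; split=> // y Hy.
    by apply: h; left.
  case: Hy; first exact: h.
  move=> [_ dy _] xy yx; have := tree_lt_depth xy (fun E => yx (esym E)).
  by lia.
exists H'; split.
- by move=> x [/HW|[]].
- by move=> x [/Hd|[_ <- _]]; lia.
- move=> x Wx dx; rewrite same //; split.
    case=> [Hx|[]//]; by apply/HP => //; apply: Hd.
  move=> hx; have [lt|ge] := ltnP D (depth x + k).
    by left; apply/HP.
  by right; split=> //; lia.
Qed.

Section cut.
Variable H : set V.
Hypothesis Hroot : H root.

(** The branches at the children of [H] outside [H], together with the points
    of [H], make up a partition of the tree. *)
Definition light x := [/\ ~ H x, x <> root & H (parent x)].

Lemma light_cover z : H z \/ exists2 x, light x & branch H x z.
Proof.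
have [n] := ubnP (depth z); elim: n z => // n IH z zn.
have [|nHz] := pselect (H z); first by left.
have zr : z <> root by move=> E; apply: nHz; rewrite E.
right; have [Hp|nHp] := pselect (H (parent z)).
  by exists z => //; apply: branch_self.
case: (IH (parent z)); first by move: zn; rewrite (parent_depth zr) !ltnS.
  by [].
move=> [x lx [xp Bx]]; exists x => //; split.
  by apply: tree_le_trans xp _; apply: parent_le.
move=> h Hh xh hx hz; have hz' : h <> z by move=> E; apply: nHz; rewrite -E.
have [_ hp] := tree_lt_parent hz hz'.
exact: (Bx h Hh xh hx).
Qed.

Lemma light_disjoint x y z : light x -> light y ->
  branch H x z -> branch H y z -> x = y.
Proof.
wlog le : x y / x <=t y.
  move=> W lx ly Bx By; case: (tree_le_total Bx.1 By.1) => le.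
    exact: W.
  by apply/esym/W.
move=> [nHx _ _] [_ yr Hp] Bx By; apply: contrapT => xy.
have [_ xp] := tree_lt_parent le xy.
apply: (Bx.2 _ Hp xp).
  by move=> E; apply: nHx; rewrite -E.
by apply: tree_le_trans By.1; apply: parent_le.
Qed.

Lemma light_heavy x z : light x -> H z -> ~ branch H x z.
Proof.
move=> [nHx _ _] Hz [xz B]; apply: (B z Hz xz _ (tree_le_refl z)).
by move=> E; apply: nHx; rewrite -E.
Qed.

Lemma heavy_disjoint x y z : H x -> H y ->
  branch H x z -> branch H y z -> x = y.
Proof.
wlog le : x y / x <=t y.
  move=> W lx ly Bx By; case: (tree_le_total Bx.1 By.1) => le.
    exact: W.
  by apply/esym/W.
move=> Hx Hy Bx By; apply: contrapT => xy.
by apply: (Bx.2 y Hy le) => [E|]; [apply: xy|exact: By.1].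
Qed.

End cut.

Lemma children_seq (c1 : R) (x : V) : (counting (children e root x) <= c1%:E)%E ->
  exists s : seq V, [/\ uniq s, (size s)%:R <= c1 &
    forall y, y <> root -> parent y = x -> y \in s].
Proof.
move=> /counting_seq[s [us sA sc]]; exists s; split=> // y yr yx; subst x.
exact/sA/parent_child.
Qed.

End tree_order.

(** * Partitions of the sets of the vertices *)

Section vertex_partitions.
Context {d : measure_display} {T : measurableType d} {R : realType}.
Variable mu : {measure set T -> \bar R}.
Variables (X : set T -> set (T -> R)) (nX : set T -> (T -> R) -> R).
Variables (Y : set T -> set (T -> R)) (nY : set T -> (T -> R) -> R).
Variable P : set (T -> R).

(** The partitions of the second assumption as sequences of sets completed by
    empty sets, with approximants in [P] itself instead of its restrictions: the
    increments between two scales are then elements of [P] and have coordinates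
    on any set. *)
Record indexed_partitions (G : set T) (N : nat) (wtx delta c2 : R)
    (K : nat -> nat) (D : nat -> nat -> set T)
    (op : nat -> nat -> (T -> R) -> T -> R) : Prop := IndexedPartitions {
  ip_card : forall m, (K m)%:R <= c2 * (2 ^ m * N)%N%:R;
  ip_measurable : forall m i, measurable (D m i);
  ip_disjoint : forall m i j, i <> j -> mu (D m i `&` D m j) = 0%E;
  ip_cover : forall m,
    mu (G `+` \bigcup_(i in [set` iota 0 (K m)]) D m i) = 0%E;
  ip_op : forall m i f, P (op m i f);
  ip_bound : forall m i f, X [set: T] f -> nY (D m i) (f \- op m i f) <=
    (2 ^ m * N)%N%:R `^ (- delta) * wtx * nX (D m i) f;
  ip_next : forall m i, (\sum_(j < K m.+1)
    (0 < mu (D m i `&` D m.+1 j))%E%:R) <= c2 :> R;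
  ip_prev : forall m j, (\sum_(i < K m)
    (0 < mu (D m i `&` D m.+1 j))%E%:R) <= c2 :> R }.

Lemma overlap_count (s : seq (set T)) (A : set (set T)) (c : R)
    (a : set T -> bool) : uniq s -> (counting A <= c%:E)%E ->
  (forall E, E \in s -> a E -> A E) ->
  \sum_(j < size s) (a (nth set0 s j))%:R <= c.
Proof.
move=> us /counting_seq[t [ut tA tc]] aA; apply: le_trans tc.
rewrite -(big_mkord xpredT (fun j => (a (nth set0 s j))%:R)).
rewrite -(big_nth set0 xpredT (fun E => (a E)%:R)) /=.
have -> : \sum_(E <- s) (a E)%:R = (count a s)%:R :> R.
  rewrite -sum1_count natr_sum [RHS]big_mkcond /=.
  by apply: eq_bigr => E _; case: (a E).
rewrite ler_nat -size_filter.
apply: uniq_leq_size; first exact: filter_uniq.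
by move=> E; rewrite mem_filter => /andP[aE Es]; apply/tA/aA.
Qed.

Variables (p q : R) (hX : lp_space mu p X nX) (hY : lp_space mu q Y nY).
Hypothesis XY : X [set: T] `<=` Y [set: T].
Hypothesis PX : P `<=` X [set: T].
Hypothesis P0 : P (fun=> 0).

Lemma indexed_partitions_ex (V : countType) (F : V -> set T) (wt : V -> R)
    (delta c2 : R) : 1 <= c2 -> (forall x, 0 <= wt x) ->
  assumption2 mu F X nX Y nY P wt delta c2 ->
  forall x N, (0 < N)%N -> exists K D op,
    indexed_partitions (F x) N (wt x) delta c2 K D op.
Proof.
move=> c21 wt0 H x N N0; have [Tm HT] := H x N N0.
have /choice[s hs] : forall m, exists s : seq (set T),
    [/\ uniq s, (forall E, E \in s <-> Tm m E) &
    (size s)%:R <= c2 * (2 ^ m * N)%N%:R].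
  move=> m; have [_ + _ _] := HT m; move/counting_seq => [s [us sT ss]].
  by exists s.
pose D m i := nth set0 (s m) i.
have inD m i : (i < size (s m))%N -> Tm m (D m i).
  by move=> im; have [_ h _] := hs m; apply/h; apply: mem_nth.
have outD m i : (size (s m) <= i)%N -> D m i = set0.
  by move=> mi; rewrite /D nth_default.
have mD m i : measurable (D m i).
  have [im|mi] := ltnP i (size (s m)); last by rewrite outD.
  by have [[_ h _ _] _ _ _] := HT m; apply/h/inD.
have /choice[op hop] : forall z : nat * nat * (T -> R), exists g, P g /\
   (X [set: T] z.2 -> nY (D z.1.1 z.1.2) (z.2 \- g) <=
     (2 ^ z.1.1 * N)%N%:R `^ (- delta) * wt x * nX (D z.1.1 z.1.2) z.2).
  move=> [[m i] f] /=.
  have [Xf|nXf] := pselect (X [set: T] f); last by exists (fun=> 0).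
  have Yf := XY Xf.
  have [im|mi] := ltnP i (size (s m)); last first.
    exists (fun=> 0); split=> // _.
    rewrite (lp_null0 hY (mD m i)).
    - by rewrite !mulr_ge0 ?powR_ge0 ?(lp_ge0 hX) //; exact: (lp_in hX).
    - by rewrite outD.
    - by apply: (lp_inB hY) => //; [exact: (lp_in hY)|exact: (lp_in0 hY)].
  have [_ _ hP _] := HT m; have [PE [lin bd]] := hP _ (inD m i im).
  have [g Pg gE] := lin_cont_op_in lin Yf.
  exists g; split=> // _; apply: le_trans (bd f Xf).
  rewrite le_eqVlt; apply/orP; left; apply/eqP; apply: (lp_ae hY) => //.
    by apply: (lp_inB hY) => //; apply: (lp_in hY) => //; apply/XY/PX.
  by apply: filterS gE => y gy Dy /=; rewrite gy.
exists (fun m => size (s m)), D, (fun m i f => op (m, i, f)); split.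
- by move=> m; have [] := hs m.
- exact: mD.
- move=> m i j ij; have [im|mi] := ltnP i (size (s m)); last first.
    by rewrite outD // set0I measure0.
  have [jm|mj] := ltnP j (size (s m)); last by rewrite (outD m j) // setI0 measure0.
  have [[_ _ h _] _ _ _] := HT m; apply: h; [exact: inD|exact: inD|].
  by have [us _ _] := hs m => /eqP; rewrite nth_uniq // => /eqP.
- move=> m; have [[_ _ _ h] _ _ _] := HT m; rewrite -h; congr (mu (_ `+` _)).
  have [_ sT _] := hs m.
  apply/seteqP; split=> y [i /= im Dy].
    by exists (D m i) => //; apply: inD; rewrite mem_iota in im.
  exists (index i (s m)); first by rewrite /= mem_iota /= index_mem; apply/sT.
  by rewrite /D nth_index //; apply/sT.
- by move=> m i f; have [] := hop (m, i, f).
- by move=> m i f; have [_] := hop (m, i, f).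
- move=> m i; have [im|mi] := ltnP i (size (s m)); last first.
    rewrite big1 => [|j _]; first lra.
    by rewrite outD // set0I measure0 ltxx.
  have [_ _ _ h] := HT m; have {}h := h m.+1 (or_introl erefl) _ (inD m i im).
  have [us sT _] := hs m.+1.
  apply: (overlap_count (a := fun E => (0 < mu (D m i `&` E))%E) us h).
  by move=> E /sT ?.
- move=> m j; have [jm|mj] := ltnP j (size (s m.+1)); last first.
    rewrite big1 => [|i _]; first lra.
    by rewrite (outD _ j) // setI0 measure0 ltxx.
  have [_ _ _ h] := HT m.+1.
  have {}h := h m (or_intror erefl) _ (inD m.+1 j jm).
  have [us sT _] := hs m.
  apply: (overlap_count (a := fun E => (0 < mu (E `&` D m.+1 j))%E) us h).
  by move=> E /sT ?; rewrite setIC.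
Qed.

End vertex_partitions.

(** * Coordinates of the null functions *)

Section coordinates.
Context {d : measure_display} {T : measurableType d} {R : realType}.
Variable mu : {measure set T -> \bar R}.
Variables (q : R) (Y : set T -> set (T -> R)) (nY : set T -> (T -> R) -> R).
Hypothesis hY : lp_space mu q Y nY.
Variables (P : set (T -> R)) (r0 : nat).
Hypothesis PY : P `<=` Y [set: T].
Hypothesis dimP : ae_dim mu [set: T] P r0.

Lemma lp_ae_all E f g : measurable E -> Y [set: T] f ->
  f = g %[ae mu in [set: T]] -> nY E f = nY E g.
Proof.
move=> mE Yf fg; apply: (lp_ae hY) => //; first exact: (lp_in hY).
by apply: filterS fg => x h _; apply: h.
Qed.

(** The signed coordinates of an almost Auerbach system are split into positive
    and negative parts, as codes are made of natural numbers.  The coordinates are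
    bounded by the seminorm on [E] with a constant that depends on [r0] alone. *)
Lemma coordinates_at E : measurable E -> exists Phi : (T -> R) -> 'I_r0 * bool -> R,
  (forall g i, P g -> 0 <= Phi g i <= 3 ^+ r0 * nY E g) /\
  (forall g g', P g -> P g' ->
     nY E (g \- g') <= \sum_i `|Phi g i - Phi g' i|).
Proof.
move=> mE; have [b [bP _ bspan]] := dimP.
pose comb (c : 'rV[R]_r0) : T -> R := fun x => \sum_i c 0 i * b i x.
have mT : measurable [set: T] by [].
have combY c : Y [set: T] (comb c).
  rewrite /comb; elim: (index_enum _) => [|i s IH].
    rewrite (_ : (fun x => _) = fun=> 0); first exact: (lp_in0 hY).
    by apply/funext => x; rewrite big_nil.
  rewrite (_ : (fun x => _) = (fun x => c 0 i * b i x) \+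
      (fun x => \sum_(j <- s) c 0 j * b j x)); last first.
    by apply/funext => x; rewrite big_cons.
  by apply: (lp_inD hY) => //; apply: (lp_inZ hY) => //; apply/PY/bP.
have combE c : Y E (comb c) by apply: (lp_in hY).
pose N c := nY E (comb c).
have N_tri c c' : N (c + c') <= N c + N c'.
  apply: le_trans (lp_nZD hY mE (combE c) (combE c')).
  rewrite le_eqVlt; apply/orP; left; apply/eqP; congr nY; apply/funext => x /=.
  by rewrite /comb -big_split; apply: eq_bigr => i _; rewrite mxE mulrDl.
have N_hom a c : N (a *: c) = `|a| * N c.
  rewrite -(lp_nZZ hY a mE (combE c)); congr nY; apply/funext => x /=.
  by rewrite /comb mulr_sumr; apply: eq_bigr => i _; rewrite mxE mulrA.
pose delta (k : nat) : 'rV[R]_r0 := \row_(i < r0) ((i : nat) == k)%:R.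
have [e [_ e1 coord]] := almost_auerbach N_tri N_hom delta r0.
have spanD c : exists a : nat -> R, c = \sum_(i < r0) a i *: delta i.
  exists (fun k => \sum_(i < r0) c 0 i * ((i : nat) == k)%:R).
  apply/rowP => j; rewrite summxE (bigD1 j) //= !mxE eqxx mulr1.
  rewrite (bigD1 j) //= eqxx mulr1 big1 ?addr0 => [|i ij]; last first.
    by rewrite val_eqE (negbTE ij) mulr0.
  rewrite big1 ?addr0 // => i ij; rewrite !mxE val_eqE eq_sym (negbTE ij).
  by rewrite mulr0.
have /choice[a ha] : forall g, exists a : nat -> R, P g -> exists c,
    [/\ g = comb c %[ae mu in [set: T]], (forall i, `|a i| <= 3 ^+ r0 * N c) &
      N (c - \sum_(i < r0) a i *: e i) = 0].
  move=> g; have [Pg|nPg] := pselect (P g); last by exists (fun=> 0).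
  have [c gc] := bspan g Pg.
  have [a [a1 a2]] := coord (\row_i c i) (spanD _).
  exists a => _; exists (\row_i c i); split=> //.
  apply: filterS gc => x h _; rewrite (h I) /comb.
  by apply: eq_bigr => i _; rewrite mxE.
exists (fun g (i : 'I_r0 * bool) => Num.max (if i.2 then a g i.1 else - a g i.1) 0).
split=> [g [i s] Pg /=|g g' Pg Pg'].
  rewrite le_max lexx orbT /= ge_max.
  have [c [gc a1 _]] := ha g Pg.
  have -> : nY E g = N c by apply: lp_ae_all => //; apply: PY.
  have := a1 i; rewrite ler_norml => /andP[h1 h2].
  apply/andP; split; first by case: s; lra.
  by apply: le_trans (a1 i).
have [c [gc _ cN]] := ha g Pg; have [c' [gc' _ cN']] := ha g' Pg'.
have -> : nY E (g \- g') = N (c - c').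
  have -> : N (c - c') = nY E (comb c \- comb c').
    congr nY; apply/funext => x /=; rewrite /comb -sumrB.
    by apply: eq_bigr => i _; rewrite !mxE mulrBl.
  apply: lp_ae_all => //; first by apply: (lp_inB hY) => //; apply: PY.
  by apply: filterS2 gc gc' => x h h' _ /=; rewrite h // h'.
have NN x : N (- x) = N x by rewrite -scaleN1r N_hom normrN normr1 mul1r.
pose A := \sum_(i < r0) a g i *: e i; pose A' := \sum_(i < r0) a g' i *: e i.
have -> : c - c' = (c - A) + ((A - A') + (- (c' - A'))).
  by rewrite opprB (addrA (A - A')) subrK [RHS]addrA subrK.
apply: le_trans (N_tri _ _) _; rewrite cN add0r.
apply: le_trans (N_tri _ _) _; rewrite NN cN' addr0.
have -> : A - A' = \sum_(i < r0) (a g i - a g' i) *: e i.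
  by rewrite -sumrB; apply: eq_bigr => i _; rewrite scalerBl.
have N0 : N 0 = 0 by rewrite -(scale0r 0) N_hom normr0 mul0r.
apply: (@le_trans _ _ (\sum_(i < r0) `|a g i - a g' i|)).
  move: (a g) (a g') => u v.
  suff tri r : N (\sum_(i < r) (u i - v i) *: e i) <=
      \sum_(i < r) `|u i - v i| by exact: tri.
  elim: r => [|r IH]; first by rewrite !big_ord0 N0.
  rewrite !big_ord_recr /=; apply: le_trans (N_tri _ _) _; apply: lerD => //.
  by rewrite N_hom ler_piMr.
rewrite -(pair_big xpredT xpredT (fun (i : 'I_r0) s =>
  `|Num.max (if s then a g i else - a g i) 0 -
    Num.max (if s then a g' i else - a g' i) 0|)) /=.
apply: ler_sum => i _; rewrite big_bool /=.
set u := a g i; set v := a g' i.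
have -> : u - v = (Num.max u 0 - Num.max v 0) - (Num.max (- u) 0 - Num.max (- v) 0).
  have h (w : R) : Num.max w 0 - Num.max (- w) 0 = w.
    by have [w0|w0] := leP w 0; have [v0|v0] := leP (- w) 0; lra.
  by rewrite -{1}(h u) -{1}(h v); lra.
by apply: le_trans (ler_normB _ _) _.
Qed.

Lemma coordinates_ex : exists Phi : set T -> (T -> R) -> 'I_r0 * bool -> R,
  forall E, measurable E ->
  (forall g i, P g -> 0 <= Phi E g i <= 3 ^+ r0 * nY E g) /\
  (forall g g', P g -> P g' ->
     nY E (g \- g') <= \sum_i `|Phi E g i - Phi E g' i|).
Proof.
have /choice[Phi h] : forall E, exists Phi : (T -> R) -> 'I_r0 * bool -> R,
  measurable E ->
  (forall g i, P g -> 0 <= Phi g i <= 3 ^+ r0 * nY E g) /\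
  (forall g g', P g -> P g' ->
     nY E (g \- g') <= \sum_i `|Phi g i - Phi g' i|).
  move=> E; have [mE|nmE] := pselect (measurable E); last by exists (fun _ _ => 0).
  by have [Phi h] := coordinates_at mE; exists Phi.
by exists Phi.
Qed.

End coordinates.

(** * Approximation at several scales *)

Section multiscale.
Context {d : measure_display} {T : measurableType d} {R : realType}.
Variable mu : {measure set T -> \bar R}.

Record finite_partition (I : choiceType) (s : seq I) (D : I -> set T) : Prop :=
  FinitePartition {
  fp_uniq : uniq s;
  fp_measurable : forall i, i \in s -> measurable (D i);
  fp_disjoint : forall i j, i \in s -> j \in s -> i <> j ->
    mu (D i `&` D j) = 0%E;
  fp_cover : mu (~` \bigcup_(i in [set` s]) D i) = 0%E }.

Variables (q : R) (Y : set T -> set (T -> R)) (nY : set T -> (T -> R) -> R).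
Hypothesis hY : lp_space mu q Y nY.
Hypothesis Y_ind : forall E f, measurable E -> Y [set: T] f ->
    Y [set: T] (fun x => f x * \1_E x).

Local Notation q0 := (lp_gt0 hY).

Lemma fp_measurableU (I : choiceType) (s : seq I) D : finite_partition s D ->
  measurable (\bigcup_(i in [set` s]) D i).
Proof. by move=> h; apply: measurable_bigcup_seq; apply: fp_measurable h. Qed.

Lemma fp_sum (I : choiceType) (s : seq I) D f : finite_partition s D ->
  Y [set: T] f -> nY [set: T] f `^ q = \sum_(i <- s) nY (D i) f `^ q.
Proof.
move=> h Yf; apply: (lp_sum hY) => //.
- exact: fp_uniq h.
- exact: fp_measurable h.
- exact: fp_disjoint h.
- rewrite -(fp_cover h) ; congr (mu _).
  by apply/seteqP; split=> x /=; [case=> -[]|left].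
Qed.

Lemma fp_sum2 (I I' : choiceType) (s : seq I) D (s' : seq I') D' f :
  finite_partition s D -> finite_partition s' D' -> Y [set: T] f ->
  nY [set: T] f `^ q = \sum_(i <- s) \sum_(j <- s') nY (D i `&` D' j) f `^ q.
Proof.
move=> h h' Yf; rewrite (fp_sum h Yf); apply: eq_big_seq => i si.
have mD := fp_measurable h si.
have mD' := fp_measurable h'; have mU := fp_measurableU h'.
apply: (lp_sum hY) => //.
- exact: fp_uniq h'.
- by move=> j sj; apply: measurableI => //; apply: mD'.
- move=> j k sj sk jk; apply: (mu_sub0 (B := D' j `&` D' k)).
  + by apply: measurableI; apply: measurableI => //; apply: mD'.
  + by apply: measurableI; apply: mD'.
  + by move=> x [[_ ?] [_ ?]].
  + exact: (fp_disjoint h').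
- rewrite -setI_bigcupr; apply: (mu_sub0 _ _ _ (fp_cover h')).
  + by apply: measurable_sym => //; apply: measurableI.
  + exact: measurableC.
  + by move=> x [[Dx nDU]|[[Dx _] nDx]] // Ux; apply: nDU.
Qed.

Definition glue (I : choiceType) (s : seq I) (D : I -> set T)
    (g : I -> T -> R) : T -> R :=
  fun x => \sum_(i <- s) g i x * \1_(D i) x.

Lemma glue_in (I : choiceType) (s : seq I) D g :
  (forall i, i \in s -> measurable (D i)) -> (forall i, Y [set: T] (g i)) ->
  Y [set: T] (glue s D g).
Proof.
rewrite /glue; elim: s => [|i s IH] mD Yg.
  rewrite (_ : (fun x => _) = fun=> 0); first exact: (lp_in0 hY).
  by apply/funext => x; rewrite big_nil.
rewrite (_ : (fun x => _) = (fun x => g i x * \1_(D i) x) \+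
    (fun x => \sum_(j <- s) g j x * \1_(D j) x)); last first.
  by apply/funext => x; rewrite big_cons.
apply: (lp_inD hY) => //.
  by apply: Y_ind => //; apply: mD; rewrite mem_head.
by apply: IH => // j sj; apply: mD; rewrite inE sj orbT.
Qed.

Lemma glue_on (I : choiceType) (s : seq I) D g i : finite_partition s D ->
  i \in s -> glue s D g = g i %[ae mu in D i].
Proof.
move=> h si; pose N := \bigcup_(j in [set` [seq j <- s | j != i]]) (D i `&` D j).
exists N; split.
- apply: measurable_bigcup_seq => j; rewrite mem_filter => /andP[_ sj].
  by apply: measurableI; apply: (fp_measurable h).
- apply: null_bigcup_seq => j; rewrite mem_filter => /andP[/eqP ji sj].
    by apply: measurableI; apply: (fp_measurable h).
  by apply: (fp_disjoint h) => // E; apply: ji.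
move=> x /= nx; apply: contrapT => nN; apply: nx => Dx.
rewrite /glue (bigD1_seq i) //=; last exact: fp_uniq h.
rewrite indicE mem_set // mulr1 big1_seq ?addr0 // => j /andP[ji sj].
rewrite indicE memNset ?mulr0 // => Dj; apply: nN.
by exists j => //=; rewrite mem_filter ji.
Qed.

Lemma glue_nY (I : choiceType) (s : seq I) D g i E f : finite_partition s D ->
  (forall i, Y [set: T] (g i)) -> Y [set: T] f -> measurable E ->
  i \in s -> E `<=` D i -> nY E (f \- glue s D g) = nY E (f \- g i).
Proof.
move=> h Yg Yf mE si ED; apply: (lp_ae hY) => //.
  apply: (lp_in hY) => //; apply: (lp_inB hY) => //.
  by apply: glue_in => //; apply: (fp_measurable h).
by apply: filterS (glue_on g h si) => x H Ex /=; rewrite H //; apply: ED.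
Qed.

Let powq_le x y : 0 <= y -> 0 <= x -> x `^ q <= y `^ q -> x <= y.
Proof.
move=> y0 x0; apply: contraTT; rewrite -!ltNge => yx.
by apply: (gt0_ltr_powR q0); rewrite ?nnegrE.
Qed.

(** Each function is the sum of its coarsest approximant, of the increments from
    one scale to the next and of a remainder.  On the
    intersection of two pieces of consecutive partitions an increment is a
    difference of two approximants, and there the two functions are compared. *)
Lemma multiscale_close (I : choiceType) (s : nat -> seq I) (D : nat -> I -> set T)
    (op op' : nat -> I -> T -> R) (f f' : T -> R) (M : nat) (A C : R)
    (B : nat -> R) :
  (forall m, finite_partition (s m) (D m)) ->
  (forall m i, Y [set: T] (op m i)) -> (forall m i, Y [set: T] (op' m i)) ->
  Y [set: T] f -> Y [set: T] f' ->
  0 <= A -> 0 <= C -> (forall m, 0 <= B m) ->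
  \sum_(i <- s M) nY (D M i) (f \- op M i) `^ q <= A `^ q ->
  \sum_(i <- s M) nY (D M i) (f' \- op' M i) `^ q <= A `^ q ->
  (forall m, (m < M)%N -> \sum_(i <- s m) \sum_(j <- s m.+1)
     nY (D m i `&` D m.+1 j)
        ((op m.+1 j \- op m i) \- (op' m.+1 j \- op' m i)) `^ q <= B m `^ q) ->
  \sum_(i <- s 0%N) nY (D 0%N i) (op 0%N i \- op' 0%N i) `^ q <= C `^ q ->
  nY [set: T] (f \- f') <= 2 * A + \sum_(m < M) B m + C.
Proof.
move=> hs Yo Yo' Yf Yf' A0 C0 B0 Af Af' Bm Cm.
have mT : measurable [set: T] by [].
pose S m := glue (s m) (D m) (op m); pose S' m := glue (s m) (D m) (op' m).
have YS m : Y [set: T] (S m).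
  by apply: glue_in => //; apply: (fp_measurable (hs m)).
have YS' m : Y [set: T] (S' m).
  by apply: glue_in => //; apply: (fp_measurable (hs m)).
have tail g o : (forall m i, Y [set: T] (o m i)) -> Y [set: T] g ->
    \sum_(i <- s M) nY (D M i) (g \- o M i) `^ q <= A `^ q ->
    nY [set: T] (g \- glue (s M) (D M) (o M)) <= A.
  move=> Yom Yg le; have YG : Y [set: T] (glue (s M) (D M) (o M)).
    by apply: glue_in => //; apply: (fp_measurable (hs M)).
  apply: powq_le => //; first by apply: (lp_ge0 hY) => //; apply: (lp_inB hY).
  apply: le_trans le; rewrite (fp_sum (hs M)); last exact: (lp_inB hY).
  rewrite !big_seq; apply: ler_sum => i si.
  by rewrite (@glue_nY _ _ _ _ i) //; apply: (fp_measurable (hs M)).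
have zero : nY [set: T] (S 0%N \- S' 0%N) <= C.
  have YB : Y [set: T] (S 0%N \- S' 0%N) by apply: (lp_inB hY).
  apply: powq_le => //; first exact: (lp_ge0 hY).
  apply: le_trans Cm; rewrite (fp_sum (hs 0%N)) //.
  rewrite !big_seq; apply: ler_sum => i si.
  have mD := fp_measurable (hs 0%N) si.
  rewrite (@glue_nY _ _ _ _ i) // (lp_nZN hY) //; try exact: (lp_in hY).
  rewrite (@glue_nY _ _ _ _ i) // (lp_nZN hY) //; exact: (lp_in hY).
have step m : (m < M)%N ->
    nY [set: T] ((S m.+1 \- S m) \- (S' m.+1 \- S' m)) <= B m.
  move=> mM; have YB : Y [set: T] ((S m.+1 \- S m) \- (S' m.+1 \- S' m)).
    by apply: (lp_inB hY) => //; apply: (lp_inB hY).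
  apply: powq_le => //; first exact: (lp_ge0 hY).
  apply: le_trans (Bm m mM); rewrite (fp_sum2 (hs m) (hs m.+1)) //.
  rewrite !big_seq; apply: ler_sum => i si; rewrite !big_seq; apply: ler_sum => j sj.
  have mI : measurable (D m i `&` D m.+1 j).
    by apply: measurableI; [apply: (fp_measurable (hs m))|
       apply: (fp_measurable (hs m.+1))].
  rewrite le_eqVlt; apply/orP; left; apply/eqP; congr (_ `^ _).
  apply: (lp_ae hY) => //; first exact: (lp_in hY).
  have h1 := glue_on (op m) (hs m) si; have h2 := glue_on (op' m) (hs m) si.
  have h3 := glue_on (op m.+1) (hs m.+1) sj.
  have h4 := glue_on (op' m.+1) (hs m.+1) sj.
  apply: filterS2 (filterI h1 h2) (filterI h3 h4) => x [e1 e2] [e3 e4] [Dx Dx'] /=.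
  by rewrite /S /S' e1 // e2 // e3 // e4.
have tel : nY [set: T] ((S M \- S 0%N) \- (S' M \- S' 0%N)) <= \sum_(m < M) B m.
  have : forall m, (m <= M)%N ->
    nY [set: T] ((S m \- S 0%N) \- (S' m \- S' 0%N)) <= \sum_(k < m) B k.
    elim=> [|m IH] mM.
      rewrite big_ord0 (_ : (_ \- _) = fun=> 0) ?(lp_nZ0 hY) //.
      by apply/funext => x /=; rewrite !subrr.
    rewrite big_ord_recr /=.
    have -> : (S m.+1 \- S 0%N) \- (S' m.+1 \- S' 0%N) =
       ((S m \- S 0%N) \- (S' m \- S' 0%N)) \+ ((S m.+1 \- S m) \- (S' m.+1 \- S' m)).
      by apply/funext => x /=; ring.
    have Y1 : Y [set: T] ((S m \- S 0%N) \- (S' m \- S' 0%N)).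
      by apply: (lp_inB hY) => //; apply: (lp_inB hY).
    have Y2 : Y [set: T] ((S m.+1 \- S m) \- (S' m.+1 \- S' m)).
      by apply: (lp_inB hY) => //; apply: (lp_inB hY).
    by apply: le_trans (lp_nZD hY mT Y1 Y2) _; apply: lerD; [apply/IH/ltnW|apply: step].
  by apply.
have -> : f \- f' = ((f \- S M) \- (f' \- S' M)) \+
    (((S M \- S 0%N) \- (S' M \- S' 0%N)) \+ (S 0%N \- S' 0%N)).
  by apply/funext => x /=; ring.
have Y1 : Y [set: T] (f \- S M) by apply: (lp_inB hY).
have Y2 : Y [set: T] (f' \- S' M) by apply: (lp_inB hY).
have Y3 : Y [set: T] ((S M \- S 0%N) \- (S' M \- S' 0%N)).
  by apply: (lp_inB hY) => //; apply: (lp_inB hY).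
have Y4 : Y [set: T] (S 0%N \- S' 0%N) by apply: (lp_inB hY).
have := lp_nZD hY mT (lp_inB hY mT Y1 Y2) (lp_inD hY mT Y3 Y4).
have := lp_nZB hY mT Y1 Y2; have := lp_nZD hY mT Y3 Y4.
have := tail f op Yo Yf Af; have := tail f' op' Yo' Yf' Af'.
rewrite -/(S M) -/(S' M); lra.
Qed.

End multiscale.

(** * The partition of the tree given by the heavy vertices *)

Section cells.
Context {d : measure_display} {T : measurableType d} {R : realType}.
Variable mu : {measure set T -> \bar R}.

Lemma null_bigcup_count (I : countType) (S : set I) (D : I -> set T) :
  (forall i, measurable (D i)) -> (forall i, S i -> mu (D i) = 0%E) ->
  mu (\bigcup_(i in S) D i) = 0%E.
Proof.
move=> mD D0.
pose G n := if @choice.unpickle I n is Some i then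
  (if `[< S i >] then D i else set0) else set0.
have mG n : measurable (G n).
  by rewrite /G; case: choice.unpickle => // i; case: asboolP.
have G0 n : mu (G n) = 0%E.
  by rewrite /G; case: choice.unpickle => [i|]; [case: asboolP => [/D0//|_]|]; exact: measure0.
have -> : \bigcup_(i in S) D i = \bigcup_n G n.
  apply/seteqP; split=> [x [i Si Dx]|x [n _]].
    by exists (choice.pickle i) => //; rewrite /G choice.pickleK asboolT.
  by rewrite /G; case: choice.unpickle => // i; case: asboolP => // Si Dx; exists i.
apply/eqP; rewrite eq_le measure_ge0 andbT.
apply: (le_trans (measure_sigma_subadditive _ mG _ (@subset_refl _ _))) => //.
  exact: bigcupT_measurable.
by rewrite eseries0 // => i _ _; exact: G0.
Qed.

Variables (V : countType) (e : rel V) (root : V) (F : V -> set T).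
Hypothesis tr : is_tree e.
Hypothesis mF : forall x, measurable (F x).
Hypothesis F_disj : forall x y, x <> y -> mu (F x `&` F y) = 0%E.
Hypothesis F_cover : mu (~` \bigcup_x F x) = 0%E.

Lemma measurable_domain S : measurable (tree_domain F S).
Proof.
rewrite /tree_domain bigcup_mkcond; apply: countable_bigcupT_measurable => //.
by move=> x; case: ifP.
Qed.

Lemma domain_disjoint S S' : S `&` S' = set0 ->
  mu (tree_domain F S `&` tree_domain F S') = 0%E.
Proof.
move=> SS'.
apply: (mu_sub0 (B := \bigcup_(z in S `*` S') (F z.1 `&` F z.2))).
- by apply: measurableI; apply: measurable_domain.
- rewrite bigcup_mkcond; apply: countable_bigcupT_measurable => // z.
  by case: ifP => // _; apply: measurableI.
- by move=> t [[x Sx Fx] [y Sy Fy]]; exists (x, y).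
apply: null_bigcup_count => [z|[x y] [/= Sx Sy]]; first exact: measurableI.
apply: F_disj => xy; have : (S `&` S') x by split=> //; rewrite xy.
by rewrite SS'.
Qed.

Variables (W : seq V) (H : set V) (ch : V -> seq V).
Hypothesis uW : uniq W.
Hypothesis HW : forall x, H x -> x \in W.
Hypothesis Hroot : H root.
Hypothesis chP : forall x y, y <> root -> parent root tr y = x -> y \in ch x.

Local Notation light := (light root tr H).
Local Notation branch := (branch e root H).

(** [H] is the set of the heavy vertices; it is finite, being contained in [W]. *)
Definition heavies := [seq x <- W | `[< H x >]].
Definition lights :=
  [seq y <- undup (flatten [seq ch x | x <- heavies]) | `[< light y >]].
Definition cells := heavies ++ lights.

Lemma mem_heavies x : (x \in heavies) = `[< H x >].
Proof.
rewrite mem_filter; apply: andb_idr => /asboolP; exact: HW.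
Qed.

Lemma mem_lights y : (y \in lights) = `[< light y >].
Proof.
rewrite mem_filter; apply: andb_idr => /asboolP [_ yr Hp].
rewrite mem_undup; apply/flatten_mapP; exists (parent root tr y).
  by rewrite mem_heavies; apply/asboolP.
exact: chP.
Qed.

Lemma size_lights : (size lights <= \sum_(x <- heavies) size (ch x))%N.
Proof.
rewrite size_filter; apply: leq_trans (count_size _ _) _.
apply: leq_trans (size_undup _) _.
by rewrite size_flatten /shape -map_comp sumnE big_map.
Qed.

Lemma uniq_cells : uniq cells.
Proof.
rewrite cat_uniq !filter_uniq ?undup_uniq // andbT /=.
apply/hasPn => y; rewrite mem_lights mem_heavies => /asboolP[nHy _ _].
by apply/negP => /asboolP.
Qed.

(** A heavy vertex is a cell of its own, and each maximal branch without heavy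
    vertices is one cell.  The rest of the branch of a heavy vertex consists of
    such light branches, one for each light child. *)
Definition cell_set x : set V := if `[< H x >] then [set x] else branch x.

Lemma cell_set_disjoint x y : x \in cells -> y \in cells -> x <> y ->
  cell_set x `&` cell_set y = set0.
Proof.
rewrite !mem_cat !mem_heavies !mem_lights /cell_set.
have lH z : light z -> `[< H z >] = false by case=> nHz _ _; apply: asboolF.
case/orP => [hx|/asboolP lx]; case/orP => [hy|/asboolP ly] xy;
  rewrite ?hx ?hy ?(lH _ lx) ?(lH _ ly); rewrite -subset0 => z [].
- by move=> /= -> E; apply: xy.
- by move=> /= -> ; apply: light_heavy ly _; apply/asboolP.
- by move=> + /= E; rewrite E; apply: light_heavy lx _; apply/asboolP.
- by move=> Bx By; apply: xy; apply: (light_disjoint lx ly Bx By).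
Qed.

Lemma cell_set_cover z : exists2 x, x \in cells & cell_set x z.
Proof.
have [Hz|[x lx Bz]] := light_cover tr Hroot z.
  exists z; first by rewrite mem_cat mem_heavies asboolT.
  by rewrite /cell_set asboolT.
exists x; first by rewrite mem_cat mem_lights (asboolT lx) orbT.
by rewrite /cell_set asboolF //; case: lx.
Qed.

Variables (X : set T -> set (T -> R)) (nX : set T -> (T -> R) -> R).
Variables (p : R) (hX : lp_space mu p X nX).

Lemma sum_domain_le (s : seq V) (S : V -> set V) f : uniq s ->
  X [set: T] f -> nX [set: T] f <= 1 ->
  (forall x y, x \in s -> y \in s -> x <> y -> S x `&` S y = set0) ->
  \sum_(x <- s) nX (tree_domain F (S x)) f `^ p <= 1.
Proof.
move=> us Xf f1 dS.
apply: (@le_trans _ _ (nX [set: T] f `^ p)).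
  apply: (lp_sum_le hX) => // [x _|x y sx sy xy|x _].
  - exact: measurable_domain.
  - by apply: domain_disjoint; apply: dS.
  - by rewrite setDT measure0.
have <- : 1 `^ p = 1 :> R by rewrite powR1.
apply: ge0_ler_powR; rewrite ?nnegrE //.
  by apply: ltW; apply: (lp_gt0 hX).
by apply: (lp_ge0 hX).
Qed.

Variables (Y : set T -> set (T -> R)) (nY : set T -> (T -> R) -> R).
Variables (P : set (T -> R)) (N : V -> nat) (wt : V -> R) (delta c2 : R).
Variables (K : V -> nat -> nat) (D : V -> nat -> nat -> set T).
Variable op : V -> nat -> nat -> (T -> R) -> T -> R.
Hypothesis ip : forall x, indexed_partitions mu X nX nY P (F x) (N x) (wt x)
  delta c2 (K x) (D x) (op x).

(** At scale [m] a heavy vertex is cut by its partition of that scale, while the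
    light branches are left whole at all scales. *)
Definition pieces m : seq (V * nat) :=
  [seq (x, i) | x <- cells, i <- iota 0 (if `[< H x >] then K x m else 1)].

Definition piece m (z : V * nat) : set T :=
  if `[< H z.1 >] then D z.1 m z.2 else tree_domain F (branch z.1).

Lemma mem_pieces m x i : ((x, i) \in pieces m) =
  (x \in cells) && (i < if `[< H x >] then K x m else 1)%N.
Proof.
apply/allpairsPdep/andP => [[y [j [yc ji [-> ->]]]]|[xc ix]].
  by move: ji; rewrite mem_iota.
by exists x, i; rewrite mem_iota.
Qed.

Lemma uniq_pieces m : uniq (pieces m).
Proof.
apply: allpairs_uniq_dep; first exact: uniq_cells.
  by move=> x _; apply: iota_uniq.
by move=> [x i] [y j] _ _ /= [-> ->].
Qed.

Lemma measurable_piece m z : measurable (piece m z).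
Proof.
rewrite /piece; case: ifP => _; last exact: measurable_domain.
exact: ip_measurable (ip _) _ _.
Qed.

Lemma piece_cell m x i : (x, i) \in pieces m ->
  mu (piece m (x, i) `\` tree_domain F (cell_set x)) = 0%E.
Proof.
rewrite mem_pieces /piece /cell_set /=; case: asboolP => [Hx|nHx] /andP[_ iK];
  last by rewrite setDv measure0.
have mDx := ip_measurable (ip x) m.
apply: mu_sub0 (ip_cover (ip x) m).
- by apply: measurableD => //; apply: measurable_domain.
- by apply: measurable_sym => //; apply: measurable_bigcup_seq.
move=> t [Dt nFt]; right; split.
  by exists i => //=; rewrite mem_iota.
by move=> Ft; apply: nFt; exists x.
Qed.

Lemma piece_disjoint m m' x y i j : (x, i) \in pieces m ->
  (y, j) \in pieces m' -> x <> y -> mu (piece m (x, i) `&` piece m' (y, j)) = 0%E.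
Proof.
move=> xi yj xy.
have mx := measurable_piece m (x, i); have my := measurable_piece m' (y, j).
have mcx := measurable_domain (cell_set x); have mcy := measurable_domain (cell_set y).
apply: (mu_sub0 (B := (tree_domain F (cell_set x) `&` tree_domain F (cell_set y))
  `|` (piece m (x, i) `\` tree_domain F (cell_set x)
  `|` (piece m' (y, j) `\` tree_domain F (cell_set y))))).
- exact: measurableI.
- by apply: measurableU; [exact: measurableI|apply: measurableU; exact: measurableD].
- move=> t [ta tb]; have [cx|ncx] := pselect (tree_domain F (cell_set x) t).
    have [cy|ncy] := pselect (tree_domain F (cell_set y) t); first by left.
    by right; right.
  by right; left.
have xc : x \in cells by move: xi; rewrite mem_pieces => /andP[].
have yc : y \in cells by move: yj; rewrite mem_pieces => /andP[].
have mx' := measurableD mx mcx; have my' := measurableD my mcy.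
have mxy := measurableI _ _ mcx mcy; have mU := measurableU _ _ mx' my'.
apply: null_set_setU => //.
  by apply: domain_disjoint; apply: cell_set_disjoint.
by apply: null_set_setU => //; exact: piece_cell.
Qed.

Lemma pieces_partition m : finite_partition mu (pieces m) (piece m).
Proof.
split.
- exact: uniq_pieces.
- by move=> z _; apply: measurable_piece.
- move=> [x i] [y j] xi yj xiyj.
  have [xy|xy] := pselect (x = y); last exact: piece_disjoint.
  subst y; move: xi yj; rewrite !mem_pieces /piece /=.
  case: asboolP => [Hx|nHx] /andP[_ iK] /andP[_ jK].
    by apply: (ip_disjoint (ip x)) => ij; apply: xiyj; rewrite ij.
  by exfalso; apply: xiyj; case: i j iK jK => [|//] [|//].
pose bad x := F x `+` \bigcup_(i in [set` iota 0 (K x m)]) D x m i.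
have mbad x : measurable (bad x).
  apply: measurable_sym => //; apply: measurable_bigcup_seq => i _.
  exact: ip_measurable (ip _) _ _.
have mU : measurable (\bigcup_x F x).
  exact: (measurable_domain [set: V]).
apply: (mu_sub0 (B := (~` (\bigcup_x F x)) `|` \bigcup_(x in [set: V]) bad x)).
- by apply: measurableC; apply: measurable_bigcup_seq => z _; apply: measurable_piece.
- apply: measurableU; first exact: measurableC.
  by apply: countable_bigcupT_measurable.
- move=> t nt; have [[v _ Fv]|] := pselect ((\bigcup_x F x) t); last by left.
  right; have [x xc cx] := cell_set_cover v.
  move: cx; rewrite /cell_set; case: asboolP => [Hx /= vx|nHx Bv].
    subst v; exists x => //; left; split=> // -[i /= iK Dt]; apply: nt.
    exists (x, i); last by rewrite /piece asboolT.
    by rewrite /= mem_pieces xc asboolT //; rewrite mem_iota in iK.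
  exfalso; apply: nt; exists (x, 0%N); first by rewrite /= mem_pieces xc asboolF.
  by rewrite /piece asboolF //; exists v.
have mbadU : measurable (\bigcup_(x in [set: V]) bad x).
  by apply: countable_bigcupT_measurable.
have mCU := measurableC mU.
apply: null_set_setU => //.
by apply: null_bigcup_count => // x _; apply: (ip_cover (ip x)).
Qed.

Lemma sum_pieces m (G : V * nat -> R) : \sum_(z <- pieces m) G z =
  \sum_(x <- heavies) \sum_(i < K x m) G (x, i : nat) +
  \sum_(y <- lights) G (y, 0%N).
Proof.
rewrite big_allpairs_dep big_cat /=; congr (_ + _); apply: eq_big_seq => x.
  by rewrite mem_heavies => ->; rewrite -{1}[K x m]subn0 -/(index_iota 0 _) big_mkord.
rewrite mem_lights => /asboolP[nHx _ _].
by rewrite asboolF //= big_seq1.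
Qed.

End cells.

(** * The code of a function *)

Section power_inequalities.
Context {R : realType}.

(** The integer part vanishes below [1], and beyond [1] powers only increase: this
    is what lets the masses pay for the entries of a code. *)
Lemma truncn_le_powR (z p : R) : 0 <= z -> 1 <= p -> (Num.truncn z)%:R <= z `^ p.
Proof.
move=> z0 p1; have [z1|z1] := ltP z 1.
  rewrite (_ : Num.truncn z = 0%N) ?powR_ge0 //.
  by apply/eqP; rewrite -leqn0 truncn_le_nat.
apply: (@le_trans _ _ z); first by rewrite truncn_le.
exact: le1r_powR.
Qed.

Lemma powR_add_le (a b p : R) : 0 <= a -> 0 <= b -> 0 <= p ->
  (a + b) `^ p <= 2 `^ p * (a `^ p + b `^ p).
Proof.
move=> a0 b0 p0; wlog ab : a b a0 b0 / a <= b.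
  move=> W; have [|/ltW ba] := leP a b; first exact: W.
  by rewrite addrC [X in _ * X]addrC; apply: W.
apply: (@le_trans _ _ ((2 * b) `^ p)).
  by apply: ge0_ler_powR; rewrite ?nnegrE; lra.
rewrite powRM //; apply: ler_wpM2l; first exact: powR_ge0.
by rewrite lerDr powR_ge0.
Qed.

Lemma truncn_eq_dist (x y e : R) : 0 < e -> 0 <= x -> 0 <= y ->
  Num.truncn (x / e) = Num.truncn (y / e) ->
  `|x - y| <= e /\ `|x - y| <= x + y.
Proof.
move=> e0 x0 y0 E; split; last by rewrite ler_norml; lra.
have hx : 0 <= x / e by apply: divr_ge0 => //; apply: ltW.
have hy : 0 <= y / e by apply: divr_ge0 => //; apply: ltW.
have := truncn_itv hx; have := truncn_itv hy; rewrite -E -natr1.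
rewrite !ler_pdivlMr // !ltr_pdivrMr // mulrDl mul1r ler_norml; lra.
Qed.

(** The gain of the passage from the exponent [p] to the exponent [q]: terms of a
    convergent sum are small because they are bounded by [h]. *)
Lemma powR_interp (x h p q : R) : 0 <= x -> 0 <= h -> x <= h -> 0 < p -> p <= q ->
  x `^ q <= h `^ (q - p) * x `^ p.
Proof.
move=> x0 h0 xh p0 pq.
have -> : x `^ q = x `^ (q - p) * x `^ p.
  have [->|xn] := eqVneq x 0.
    by rewrite (@powR0 _ q) ?(@powR0 _ p) ?mulr0 // gt_eqF //; lra.
  by rewrite -powRD ?xn ?implybT // subrK.
apply: ler_wpM2r; first exact: powR_ge0.
by apply: ge0_ler_powR; rewrite ?nnegrE; lra.
Qed.

Lemma sum_ltn_le (m k : nat) : \sum_(i < m) (i < k)%N%:R <= k%:R :> R.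
Proof.
rewrite -natr_sum ler_nat; elim: m => [|m IH]; first by rewrite big_ord0.
have [km|mk] := leqP k m.
  by rewrite big_ord_recr /= ltnNge km addn0.
apply: (@leq_trans (\sum_(i < m.+1) 1)%N); last by rewrite sum1_card card_ord.
by apply: leq_sum => i _; exact: leq_b1.
Qed.

(** Only one value [z.2] is marked for each box. *)
Lemma box_sum_le (A B : finType) (L : nat) (Pr : A -> bool) (v : A -> B -> nat) :
  \sum_(z : A * B * 'I_L) (Pr z.1.1 && (z.2 == v z.1.1 z.1.2 :> nat))%:R
    <= #|B|%:R * \sum_i (Pr i)%:R :> R.
Proof.
rewrite -(pair_bigA _ (fun (z : A * B) (l : 'I_L) =>
  (Pr z.1 && (l == v z.1 z.2 :> nat))%:R)) /=.
rewrite -(pair_bigA _ (fun (i : A) (c : B) =>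
  \sum_(l < L) (Pr i && (l == v i c :> nat))%:R)) /=.
rewrite mulr_sumr; apply: ler_sum => i _.
apply: (@le_trans _ _ (\sum_(c : B) (Pr i)%:R)); last first.
  by rewrite sumr_const -[leLHS]mulr_natl.
apply: ler_sum => c _; case: (Pr i) => /=; last by rewrite big1.
have [lt|ge] := ltnP (v i c) L; last first.
  rewrite big1 // => l _; case: eqP => // lv.
  by move: (ltn_ord l); rewrite lv ltnNge ge.
rewrite (bigD1 (Ordinal lt)) //= eqxx big1 ?addr0 // => l.
by rewrite -val_eqE /= => /negbTE ->.
Qed.

End power_inequalities.

(** The parameters of the code.  [W] is the finite set of vertices that may be
    heavy, [U] the set of those that are heavy for every function, [Lam x] the
    price of an atom at [x] up to the factor [a].  [tau x] is the mass from which
    on a branch at [x] makes [x] heavy.  [omega x m] is the approximation error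
    at scale [m] on the set of [x], and [hh x m ^ p] the mass of a piece from
    which on the code records its increment, [eta x m] being the unit of this
    record.  The factor [2 `^ (al m)] makes increments cheaper at finer scales,
    at the expense of half of the decay of [omega]. *)
Section core.
Context {d : measure_display} {T : measurableType d} {R : realType}.
Variable mu : {measure set T -> \bar R}.
Variables (p q : R).
Hypotheses (p1 : 1 < p) (pq : p < q).
Variables (V : countType) (e : rel V) (root : V) (F : V -> set T).
Hypothesis tr : is_tree e.
Hypothesis mF : forall x, measurable (F x).
Hypothesis F_disj : forall x y, x <> y -> mu (F x `&` F y) = 0%E.
Hypothesis F_cover : mu (~` \bigcup_x F x) = 0%E.
Variables (X : set T -> set (T -> R)) (nX : set T -> (T -> R) -> R).
Variables (Y : set T -> set (T -> R)) (nY : set T -> (T -> R) -> R).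
Hypotheses (hX : lp_space mu p X nX) (hY : lp_space mu q Y nY).
Hypothesis XY : X [set: T] `<=` Y [set: T].
Hypothesis Y_ind : forall E f, measurable E -> Y [set: T] f ->
    Y [set: T] (fun x => f x * \1_E x).
Variables (P : set (T -> R)) (r0 : nat).
Hypothesis PX : P `<=` X [set: T].
Hypothesis P_sub : forall f g, P f -> P g -> P (f \- g).
Variable Phi : set T -> (T -> R) -> 'I_r0 * bool -> R.
Hypothesis PhiP : forall E, measurable E ->
  (forall g i, P g -> 0 <= Phi E g i <= 3 ^+ r0 * nY E g) /\
  (forall g g', P g -> P g' ->
     nY E (g \- g') <= \sum_i `|Phi E g i - Phi E g' i|).
Variables (w wt : V -> R) (op0 : V -> (T -> R) -> T -> R).
Hypotheses (w0 : forall x, 0 <= w x) (wt0 : forall x, 0 < wt x).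
Hypothesis op0_in : forall x f, P (op0 x f).
Hypothesis op0_bound : forall x f S, X [set: T] f ->
  subtree_rooted_at e root x S ->
  nY (tree_domain F S) (f \- op0 x f) <= w x * nX (tree_domain F S) f.
Variables (delta c1 c2 : R) (N : V -> nat).
Hypotheses (delta0 : 0 < delta) (c21 : 1 <= c2) (N0 : forall x, (0 < N x)%N).
Variables (K : V -> nat -> nat) (D : V -> nat -> nat -> set T).
Variable op : V -> nat -> nat -> (T -> R) -> T -> R.
Hypothesis ip : forall x, indexed_partitions mu X nX nY P (F x) (N x) (wt x)
  delta c2 (K x) (D x) (op x).
Variable ch : V -> seq V.
Hypothesis ch_size : forall x, (size (ch x))%:R <= c1.
Hypothesis chP : forall x y, y <> root -> parent root tr y = x -> y \in ch x.
Variables (W : seq V) (U : V -> Prop) (Lam : V -> R) (n a kap kap' eps : R).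
Hypotheses (uW : uniq W) (UW : forall x, U x -> x \in W) (Uroot : U root).
Hypotheses (Lam0 : forall x, 0 < Lam x) (n0 : 0 < n) (kap0 : 0 < kap).
Hypotheses (kap'0 : 0 < kap') (eps0 : 0 < eps).
Hypothesis NU : forall x, x \in W -> ~ U x -> N x = 1%N.
Hypothesis aLam : forall x, x \in W -> 1 <= a * Lam x.

Let th := p^-1 - q^-1.
Let al := delta / (2 * th).
Let r2 : R := #|{: 'I_r0 * bool}|%:R.
Let cr : R := 3 ^+ r0.
Let omega x m : R := (2 ^ m * N x)%N%:R `^ (- delta) * wt x.
Let hh x m : R := (Lam x * 2 `^ (al * m%:R) / (kap' * n)) `^ p^-1.
Let eta x m := cr * omega x m * hh x m.
Let mesh := eps / n.
Let tau x := Lam x / (kap * n).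

Let p0 : 0 < p. Proof. exact: lt_trans p1. Qed.
Let q0 : 0 < q. Proof. exact: lt_trans pq. Qed.
Let th0 : 0 < th.
Proof. by rewrite /th subr_gt0 ltf_pV2 ?posrE. Qed.
Let qth : (q - p) / p = q * th.
Proof. by rewrite /th; field; rewrite !gt_eqF. Qed.
Let al0 : 0 < al. Proof. by rewrite /al divr_gt0 // mulr_gt0. Qed.
Let omega0 x m : 0 < omega x m.
Proof. by rewrite mulr_gt0 // powR_gt0 // ltr0n muln_gt0 expn_gt0 /=. Qed.
Let hh0 x m : 0 < hh x m.
Proof.
apply: powR_gt0; apply: divr_gt0; last exact: mulr_gt0.
by apply: mulr_gt0 => //; exact: powR_gt0.
Qed.
Let cr0 : 0 < cr. Proof. by rewrite exprn_gt0. Qed.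
Let eta0 x m : 0 < eta x m. Proof. by rewrite /eta; apply: mulr_gt0 => //; apply: mulr_gt0. Qed.
Let mesh0 : 0 < mesh. Proof. by rewrite divr_gt0. Qed.
Let PY : P `<=` Y [set: T]. Proof. by move=> f /PX/XY. Qed.
Let mD x m i : measurable (D x m i). Proof. exact: (ip_measurable (ip x)). Qed.
Let mdom S : measurable (tree_domain F S). Proof. exact: measurable_domain. Qed.
Let op_in x m i f : P (op x m i f). Proof. exact: (ip_op (ip x)). Qed.

Let hhp x m : (hh x m) `^ p = Lam x * 2 `^ (al * m%:R) / (kap' * n).
Proof.
rewrite /hh -powRrM mulVf ?gt_eqF // powRr1 //.
apply: divr_ge0; last by apply: mulr_ge0; exact: ltW.
by apply: mulr_ge0; [exact: ltW|exact: powR_ge0].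
Qed.

Let omegaS x m : omega x m.+1 <= omega x m.
Proof.
apply: ler_wpM2r; first exact: ltW.
have h k : 0 < (2 ^ k * N x)%N%:R :> R by rewrite ltr0n muln_gt0 expn_gt0 /=.
rewrite !powRN lef_pV2 ?posrE ?powR_gt0 //.
apply: ge0_ler_powR; [exact: ltW|by rewrite nnegrE ltW|by rewrite nnegrE ltW|].
by rewrite ler_nat leq_mul2r leq_exp2l // leqnSn orbT.
Qed.

Let omegaE x m : omega x m = 2 `^ (- (delta * m%:R)) * (wt x * (N x)%:R `^ (- delta)).
Proof.
rewrite /omega natrM natrX powRM ?exprn_ge0 //.
rewrite -powR_mulrn // -powRrM mulrN [X in - X]mulrC.
by rewrite -mulrA [X in _ * X]mulrC.
Qed.

(** ** Sums over overlapping pieces of consecutive scales *)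

Let ov x m i j : R := (0 < mu (D x m i `&` D x m.+1 j))%E%:R.

Let sum_pieces_at f x m : X [set: T] f ->
  \sum_(i < K x m) nX (D x m i) f `^ p = nX (F x) f `^ p.
Proof.
move=> Xf; rewrite (lp_sum hX (s := iota 0 (K x m)) (D := D x m)) //.
- by rewrite -(big_mkord xpredT (fun i => nX (D x m i) f `^ p)) /index_iota subn0.
- exact: iota_uniq.
- by move=> i j _ _; apply: (ip_disjoint (ip x)).
- exact: (ip_cover (ip x)).
Qed.

(** Each piece meets at most [c2] pieces of a neighbouring scale. *)
Let overlap_sum f x m : X [set: T] f ->
  \sum_(i < K x m) \sum_(j < K x m.+1)
    ov x m i j * (nX (D x m i) f + nX (D x m.+1 j) f) `^ p
  <= 2 `^ p * (2 * c2) * nX (F x) f `^ p.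
Proof.
move=> Xf; have nX0 k i : 0 <= nX (D x k i) f.
  by apply: (lp_ge0 hX) => //; apply: (lp_in hX).
have ov0 i j : 0 <= ov x m i j by rewrite ler0n.
apply: (@le_trans _ _ (\sum_(i < K x m) \sum_(j < K x m.+1)
   2 `^ p * (ov x m i j * nX (D x m i) f `^ p + ov x m i j * nX (D x m.+1 j) f `^ p))).
  apply: ler_sum => i _; apply: ler_sum => j _.
  by rewrite -mulrDr mulrCA; apply: ler_wpM2l => //; apply: powR_add_le => //; apply: ltW.
under eq_bigr do rewrite -mulr_sumr big_split /=.
rewrite -mulr_sumr big_split /= -mulrA; apply: ler_wpM2l; first exact: powR_ge0.
rewrite mulrDl mul1r mulrDl; apply: lerD.
  rewrite -{1}(sum_pieces_at x m Xf) mulr_sumr; apply: ler_sum => i _.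
  rewrite -mulr_suml; apply: ler_wpM2r; first exact: powR_ge0.
  exact: (ip_next (ip x)).
rewrite exchange_big /= -(sum_pieces_at x m.+1 Xf) mulr_sumr.
apply: ler_sum => j _.
rewrite -mulr_suml; apply: ler_wpM2r; first exact: powR_ge0.
exact: (ip_prev (ip x)).
Qed.

(** Both approximants are close to [f] on the intersection. *)
Let overlap_bound f x m i j : X [set: T] f ->
  nY (D x m i `&` D x m.+1 j) (op x m.+1 j f \- op x m i f) <=
    ov x m i j * (omega x m * (nX (D x m i) f + nX (D x m.+1 j) f)).
Proof.
move=> Xf; set E := D x m i `&` D x m.+1 j.
have mE : measurable E by apply: measurableI.
have Yg : Y [set: T] (op x m.+1 j f \- op x m i f) by apply/PY/P_sub.
rewrite /ov; case: ltP => [mu0|]; last first.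
  rewrite measure_le0 => /eqP E0; rewrite (lp_null0 hY mE E0) ?mul0r //.
  exact: (lp_in hY).
rewrite mul1r.
have -> : op x m.+1 j f \- op x m i f =
    (f \- op x m i f) \- (f \- op x m.+1 j f).
  by apply/funext => t /=; ring.
have Yf := XY Xf.
have Y1 k l : Y [set: T] (f \- op x k l f) by apply: (lp_inB hY) => //; apply: PY.
apply: le_trans (lp_nZB hY mE (lp_in hY mE (Y1 _ _)) (lp_in hY mE (Y1 _ _))) _.
have h1 : nY E (f \- op x m i f) <= omega x m * nX (D x m i) f.
  apply: le_trans (ip_bound (ip x) m i Xf).
  by apply: (lp_mono hY) => // t [].
have h2 : nY E (f \- op x m.+1 j f) <= omega x m * nX (D x m.+1 j) f.
  apply: (@le_trans _ _ (omega x m.+1 * nX (D x m.+1 j) f)).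
    apply: le_trans (ip_bound (ip x) m.+1 j Xf).
    by apply: (lp_mono hY) => // t [].
  apply: ler_wpM2r => //; apply: (lp_ge0 hX) => //; exact: (lp_in hX).
by rewrite mulrDr; apply: lerD.
Qed.

(** ** Heavy vertices *)

Let mass f S := nX (tree_domain F S) f `^ p.

Let heavy_ex f : exists H : set V, (forall x, H x -> x \in W) /\
  forall x, x \in W ->
    (H x <-> (U x \/ tau x < mass f (branch e root H x))).
Proof.
have [|H [HW HP]] := @heavy_set_exists V e root tr [set` W]
  (\max_(x <- W) depth root tr x) (fun x B => U x \/ tau x < mass f B).
  by move=> x xW; apply: leq_bigmax_seq.
by exists H.
Qed.

Let Hf f : set V := sval (cid (heavy_ex f)).

Let HfW f x : Hf f x -> x \in W.
Proof. by move=> h; have := proj1 (svalP (cid (heavy_ex f))); apply. Qed.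

Let HfP f x : x \in W ->
  (Hf f x <-> (U x \/ tau x < mass f (branch e root (Hf f) x))).
Proof. exact: (proj2 (svalP (cid (heavy_ex f)))). Qed.

Let Hf_root f : Hf f root.
Proof. by apply/HfP; [exact: UW|left]. Qed.

Let Hf_light f x : x \in W -> ~ Hf f x ->
  ~ U x /\ mass f (branch e root (Hf f) x) <= tau x.
Proof.
move=> xW nH; split=> [Ux|]; first by apply/nH/HfP => //; left.
by rewrite leNgt; apply/negP => h; apply/nH/HfP => //; right.
Qed.

Let hv f := heavies W (Hf f).

Let mem_hv f x : (x \in hv f) = `[< Hf f x >].
Proof. by apply: mem_heavies; exact: HfW. Qed.

Let uniq_hv f : uniq (hv f). Proof. exact: filter_uniq. Qed.

Local Notation pieces_of f m := (pieces root tr W (Hf f) ch K m).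
Local Notation piece_of f m := (piece e root F (Hf f) D m).

(** A heavy vertex outside [U] has a branch of mass more than [tau x], and the
    branches of the heavy vertices are disjoint. *)
Let sum_tau f : X [set: T] f -> nX [set: T] f <= 1 ->
  \sum_(x <- hv f | ~~ `[< U x >]) tau x <= 1.
Proof.
move=> Xf f1.
apply: (@le_trans _ _ (\sum_(x <- hv f) mass f (branch e root (Hf f) x))).
  rewrite big_mkcond big_seq [leRHS]big_seq; apply: ler_sum => x.
  rewrite mem_hv => /asboolP Hx; case: asboolP => /= nUx; first exact: powR_ge0.
  by have [//|/ltW] := proj1 (HfP f (HfW Hx)) Hx.
apply: (sum_domain_le mF F_disj hX) => // x y.
rewrite !mem_hv => /asboolP Hx /asboolP Hy xy.
rewrite -subset0 => z [Bx By]; apply: xy.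
exact: (heavy_disjoint tr (H := Hf f) Hx Hy Bx By).
Qed.

(** ** Codes *)

Variables (M Kw Kc Lb : nat) (Wm : R).
Hypothesis capK : forall x m, x \in W -> (m <= M)%N -> (K x m <= Kw)%N.

Let Co := ('I_r0 * bool)%type.

(** The atoms at a heavy vertex: a mark, the values of the coordinates of the
    approximants on the pieces of the coarsest partition and on the branches at
    the children, and the increments of the coordinates between consecutive
    scales. *)
Let Loc := (unit + 'I_Kw * Co * 'I_Lb + 'I_Kc * Co * 'I_Lb
  + 'I_M * 'I_Kw * 'I_Kw * Co)%type.

Let child x i := nth root (ch x) i.
Let valE f x i c : nat := Num.truncn (Phi (D x 0 i) (op x 0 i f) c / mesh).
Let valC f y c : nat :=
  Num.truncn (Phi (tree_domain F (branch e root (Hf f) y)) (op0 y f) c / mesh).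
Let valW f x m i j c : nat := Num.truncn
  (Phi (D x m i `&` D x m.+1 j) (op x m.+1 j f \- op x m i f) c / eta x m).

Let code f x (l : Loc) : nat :=
  if `[< Hf f x >] then
    match l with
    | inl (inl (inl _)) => 1%N
    | inl (inl (inr z)) =>
        nat_of_bool ((z.1.1 < K x 0)%N && (z.2 == valE f x z.1.1 z.1.2 :> nat))
    | inl (inr z) =>
        nat_of_bool
          (((z.1.1 < size (ch x))%N && `[< light root tr (Hf f) (child x z.1.1) >])
           && (z.2 == valC f (child x z.1.1) z.1.2 :> nat))
    | inr z =>
        if (z.1.1.2 < K x z.1.1.1)%N && (z.1.2 < K x z.1.1.1.+1)%N
        then valW f x z.1.1.1 z.1.1.2 z.1.2 z.2 else 0%N
    end
  else 0%N.

Let Ball f := [/\ X [set: T] f, nX [set: T] f <= 1 & nY [set: T] f <= Wm].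

Let nXD_ge0 x m i f : X [set: T] f -> 0 <= nX (D x m i) f.
Proof. by move=> Xf; apply: (lp_ge0 hX) => //; apply: (lp_in hX). Qed.

Let Phi_overlap f x m i j c : X [set: T] f ->
  0 <= Phi (D x m i `&` D x m.+1 j) (op x m.+1 j f \- op x m i f) c
    <= cr * omega x m * (ov x m i j * (nX (D x m i) f + nX (D x m.+1 j) f)).
Proof.
move=> Xf; have mE : measurable (D x m i `&` D x m.+1 j) by apply: measurableI.
have Pg : P (op x m.+1 j f \- op x m i f) by apply: P_sub.
have /andP[-> /le_trans] := (PhiP mE).1 _ c Pg; apply.
rewrite -/cr -mulrA; apply: ler_wpM2l; first exact: ltW.
by rewrite mulrCA; exact: overlap_bound.
Qed.

(** An increment contributes a positive integer only if the pieces carry a mass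
    of order [hh x m `^ p], and the integer is bounded by the quotient. *)
Let valW_le f x m i j c : X [set: T] f -> (valW f x m i j c)%:R <=
  ov x m i j * (nX (D x m i) f + nX (D x m.+1 j) f) `^ p / hh x m `^ p.
Proof.
move=> Xf; have /andP[h0 h1] := Phi_overlap x m i j c Xf.
rewrite /valW; set Q := Phi _ _ _ in h0 h1 *.
have s0 : 0 <= nX (D x m i) f + nX (D x m.+1 j) f by rewrite addr_ge0 // nXD_ge0.
have Qe : 0 <= Q / eta x m by rewrite divr_ge0 // ltW.
apply: le_trans (truncn_le_powR Qe (ltW p1)) _.
have Qs : Q / eta x m <= ov x m i j * (nX (D x m i) f + nX (D x m.+1 j) f) / hh x m.
  rewrite ler_pdivrMr //; apply: le_trans h1 _.
  rewrite le_eqVlt; apply/orP; left; apply/eqP.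
  by rewrite /eta; field; rewrite gt_eqF.
move: Qs; rewrite /ov; case: (0 < _)%E => /= Qs; last first.
  have -> : Q / eta x m = 0.
    by apply/eqP; rewrite eq_le Qe andbT; move: Qs; rewrite !mul0r.
  by rewrite powR0 ?gt_eqF // !mul0r.
rewrite mul1r in Qs *.
apply: (@le_trans _ _ (((nX (D x m i) f + nX (D x m.+1 j) f) / hh x m) `^ p)).
  by apply: ge0_ler_powR; rewrite ?nnegrE ?(ltW p0) // divr_ge0 // ltW.
have hge := ltW (hh0 x m).
rewrite powRM ?invr_ge0 // mul1r; apply: ler_wpM2l; first exact: powR_ge0.
by rewrite -{1}(powR_inv1 hge) -powRrM mulN1r powRN.
Qed.

Let mass1 f x := nX (F x) f `^ p.

Let walk_cost f x (m : 'I_M) : X [set: T] f -> x \in W ->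
  \sum_(z : 'I_Kw * 'I_Kw * Co)
     (if (z.1.1 < K x m)%N && (z.1.2 < K x m.+1)%N
      then valW f x m z.1.1 z.1.2 z.2 else 0%N)%:R
  <= r2 * (2 `^ p * (2 * c2) * mass1 f x / hh x m `^ p).
Proof.
move=> Xf xW.
pose t (i j : nat) := ov x m i j * (nX (D x m i) f + nX (D x m.+1 j) f) `^ p / hh x m `^ p.
have t0 i j : 0 <= t i j.
  by rewrite /t !mulr_ge0 ?invr_ge0 ?powR_ge0 // ler0n.
apply: (@le_trans _ _ (\sum_(z : 'I_Kw * 'I_Kw * Co)
   (if (z.1.1 < K x m)%N && (z.1.2 < K x m.+1)%N then t z.1.1 z.1.2 else 0))).
  by apply: ler_sum => z _; case: ifP => // _; exact: valW_le.
rewrite -(pair_bigA _ (fun (u : 'I_Kw * 'I_Kw) (c : Co) =>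
   if (u.1 < K x m)%N && (u.2 < K x m.+1)%N then t u.1 u.2 else 0)) /=.
rewrite -(pair_bigA _ (fun (i j : 'I_Kw) => \sum_(c : Co)
   if (i < K x m)%N && (j < K x m.+1)%N then t i j else 0)) /=.
under eq_bigr do under eq_bigr do rewrite sumr_const -mulr_natl.
under eq_bigr do rewrite -mulr_sumr.
rewrite -mulr_sumr; apply: ler_wpM2l; first exact: ler0n.
have mM : (m <= M)%N by apply: ltnW.
have E : \sum_(i < Kw) \sum_(j < Kw)
     (if (i < K x m)%N && (j < K x m.+1)%N then t i j else 0) =
   \sum_(i < K x m) \sum_(j < K x m.+1) t i j.
  rewrite (big_ord_widen _ (fun i => \sum_(j < K x m.+1) t i j) (capK xW mM)).
  rewrite [RHS]big_mkcond; apply: eq_bigr => i _ /=; case: ifP => _ /=.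
    rewrite (big_ord_widen _ (t i) (capK xW (ltn_ord m))).
    by rewrite [RHS]big_mkcond.
  by rewrite big1.
rewrite E; under eq_bigr do rewrite -mulr_suml.
rewrite -mulr_suml; apply: ler_wpM2r; first by rewrite invr_ge0 powR_ge0.
exact: overlap_sum.
Qed.

Let r2_ge0 : 0 <= r2. Proof. exact: ler0n. Qed.

Let local_cost f x : Ball f -> x \in W -> Hf f x ->
  \sum_(l : Loc) (code f x l)%:R <=
   1 + (1 + r2) * (c2 * (N x)%:R + c1) +
   \sum_(m < M) r2 * (2 `^ p * (2 * c2) * mass1 f x / hh x m `^ p).
Proof.
move=> [Xf f1 _] xW Hx.
rewrite /code (asboolT Hx) !big_sumType /=.
have KN : (K x 0)%:R <= c2 * (N x)%:R.
  by have := ip_card (ip x) 0; rewrite expn0 mul1n.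
have A1 : \sum_(z : 'I_Kw * Co * 'I_Lb)
   ((z.1.1 < K x 0)%N && (z.2 == valE f x z.1.1 z.1.2 :> nat))%:R <= r2 * (c2 * (N x)%:R).
  apply: le_trans (box_sum_le _ (fun i : 'I_Kw => i < K x 0)%N (valE f x)) _.
  by apply: ler_wpM2l => //; apply: le_trans KN; exact: sum_ltn_le.
have A2 : \sum_(z : 'I_Kc * Co * 'I_Lb)
   (((z.1.1 < size (ch x))%N && `[< light root tr (Hf f) (child x z.1.1) >])
        && (z.2 == valC f (child x z.1.1) z.1.2 :> nat))%:R <= r2 * c1.
  apply: le_trans (box_sum_le _ (fun i : 'I_Kc => (i < size (ch x))%N &&
     `[< light root tr (Hf f) (child x i) >]) (fun i => valC f (child x i))) _.
  apply: ler_wpM2l => //; apply: le_trans (ch_size x).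
  apply: le_trans (sum_ltn_le Kc _); apply: ler_sum => i _.
  by rewrite ler_nat; case: (_ < _)%N => //=; exact: leq_b1.
have A3 : \sum_(z : 'I_M * 'I_Kw * 'I_Kw * Co)
     (if (z.1.1.2 < K x z.1.1.1)%N && (z.1.2 < K x z.1.1.1.+1)%N
        then valW f x z.1.1.1 z.1.1.2 z.1.2 z.2 else 0%N)%:R <=
     \sum_(m < M) r2 * (2 `^ p * (2 * c2) * mass1 f x / hh x m `^ p).
  apply: (@le_trans _ _ (\sum_(m < M) \sum_(z : 'I_Kw * 'I_Kw * Co)
     (if (z.1.1 < K x m)%N && (z.1.2 < K x m.+1)%N
      then valW f x m z.1.1 z.1.2 z.2 else 0%N)%:R)); last first.
    by apply: ler_sum => m _; exact: walk_cost.
  rewrite le_eqVlt; apply/orP; left; apply/eqP.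
  rewrite [RHS]pair_bigA /=.
  rewrite (reindex (fun z : 'I_M * ('I_Kw * 'I_Kw * Co) =>
     (z.1, z.2.1.1, z.2.1.2, z.2.2))) //=.
  exists (fun z => (z.1.1.1, (z.1.1.2, z.1.2, z.2))) => z _ /=.
    by case: z => m [[i j] c].
  by case: z => [[[m i] j] c].
have N1 : 0 <= (N x)%:R :> R by [].
have c10 : 0 <= c1 by apply: le_trans (ch_size x).
have A0 : \sum_(u : unit) 1%:R = 1 :> R by rewrite big_const card_unit /= addr0.
have c2N : 0 <= c2 * (N x)%:R by rewrite mulr_ge0 // (le_trans ler01).
apply: lerD; last exact: A3.
have -> : \sum_(i : unit) 1 = 1 :> R by rewrite -[RHS]A0.
lra.
Qed.

Variables (B1 Sal : R).
Let local (x : V) : R := a * Lam x * (1 + (1 + r2) * (c2 * (N x)%:R + c1)).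
Let G : R := 1 + (1 + r2) * (c2 + c1).
Hypothesis budgetU : \sum_(x <- W | `[< U x >]) local x <= B1.
Hypothesis SalP : forall k, \sum_(m < k) 2 `^ (- (al * m%:R)) <= Sal.

Let c1_ge0 : 0 <= c1. Proof. by apply: le_trans (ch_size root). Qed.

Let a0 : 0 < a.
Proof.
have := aLam (UW Uroot) => h.
by rewrite -(pmulr_lgt0 _ (Lam0 root)); apply: lt_le_trans h.
Qed.

Let local_ge0 x : 0 <= local x.
Proof.
have N1 : 0 <= (N x)%:R :> R by [].
have c2N : 0 <= c2 * (N x)%:R by rewrite mulr_ge0 // (le_trans ler01).
rewrite /local; apply: mulr_ge0; first by rewrite mulr_ge0 // ltW.
by rewrite addr_ge0 // mulr_ge0 // addr_ge0.
Qed.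

(** On the heavy vertices outside [U] the prices are multiples of [tau x]. *)
Let heavy_cost f : X [set: T] f -> nX [set: T] f <= 1 ->
  \sum_(x <- hv f) local x <= B1 + a * G * (kap * n).
Proof.
move=> Xf f1; rewrite (bigID (fun x => `[< U x >])) /=; apply: lerD.
  apply: le_trans budgetU; rewrite /hv /heavies big_filter_cond /=.
  rewrite big_mkcond [leRHS]big_mkcond /=; apply: ler_sum => x _.
  by case: asboolP => _ /=; case: asboolP => //.
have G0 : 0 <= G.
  rewrite /G; apply: addr_ge0 => //; apply: mulr_ge0; first exact: addr_ge0.
  by apply: addr_ge0 => //; apply: le_trans c21.
apply: (@le_trans _ _ (a * G * (kap * n) * \sum_(x <- hv f | ~~ `[< U x >]) tau x)).
  rewrite mulr_sumr big_seq_cond [leRHS]big_seq_cond; apply: ler_sum => x.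
  rewrite mem_hv => /andP[/asboolP Hx /asboolP nUx].
  rewrite /local (NU (HfW Hx) nUx) mulr1 -/G /tau.
  rewrite le_eqVlt; apply/orP; left; apply/eqP.
  by field; rewrite !gt_eqF.
rewrite -[leRHS]mulr1; apply: ler_wpM2l; last exact: sum_tau.
by rewrite !mulr_ge0 // ltW.
Qed.

Let mass1_sum f : X [set: T] f -> nX [set: T] f <= 1 ->
  \sum_(x <- hv f) mass1 f x <= 1.
Proof.
move=> Xf f1.
have E x : tree_domain F [set x] = F x by rewrite /tree_domain bigcup_set1.
under eq_bigr do rewrite /mass1 -E.
apply: (sum_domain_le mF F_disj hX (S := fun x => [set x])) => // x y _ _ xy.
by rewrite -subset0 => z /= [-> ] yx; apply: xy.
Qed.

(** The price [a * Lam x] cancels the factor [Lam x] of [hh x m `^ p], so that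
    the increments cost a multiple of the total mass. *)
Let total_cost f : Ball f ->
  \sum_(j : 'I_(size W) * Loc) a * Lam (nth root W j.1) *
     (code f (nth root W j.1) j.2)%:R
  <= B1 + a * G * (kap * n) + a * r2 * (2 `^ p * (2 * c2)) * (kap' * n) * Sal.
Proof.
move=> Bf; have [Xf f1 _] := Bf.
rewrite -(pair_bigA _ (fun (i : 'I_(size W)) (l : Loc) => a * Lam (nth root W i) *
     (code f (nth root W i) l)%:R)) /=.
rewrite -(big_mkord xpredT (fun i => \sum_(l : Loc) a * Lam (nth root W i) *
     (code f (nth root W i) l)%:R)).
rewrite -(big_nth root xpredT (fun x => \sum_(l : Loc) a * Lam x * (code f x l)%:R)) /=.
under eq_bigr do rewrite -mulr_sumr.
have -> : \sum_(x <- W) a * Lam x * \sum_(l : Loc) (code f x l)%:R =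
   \sum_(x <- hv f) a * Lam x * \sum_(l : Loc) (code f x l)%:R.
  rewrite /hv /heavies big_filter [RHS]big_mkcond; apply: eq_bigr => x _.
  case: asboolP => // nH; rewrite big1 ?mulr0 // => l _.
  by rewrite /code asboolF.
pose walk x : R := \sum_(m < M) r2 * (2 `^ p * (2 * c2) * mass1 f x / hh x m `^ p).
apply: (@le_trans _ _ (\sum_(x <- hv f) (local x + a * Lam x * walk x))).
  rewrite !big_seq; apply: ler_sum => x; rewrite mem_hv => /asboolP Hx.
  rewrite /local -mulrDr; apply: ler_wpM2l; first by rewrite mulr_ge0 ?ltW.
  exact: (local_cost Bf (HfW Hx) Hx).
rewrite big_split /=; apply: lerD; first exact: heavy_cost.
have walkE x : a * Lam x * walk x = a * r2 * (2 `^ p * (2 * c2)) * (kap' * n) *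
    mass1 f x * \sum_(m < M) 2 `^ (- (al * m%:R)).
  rewrite /walk !mulr_sumr; apply: eq_bigr => m _.
  rewrite hhp powRN; have := powR_gt0 (al * m%:R) (ltr0n R 2).
  move: (2 `^ (al * m%:R)) => z z0; field.
  by rewrite !gt_eqF.
under eq_bigr do rewrite walkE.
rewrite -mulr_suml -mulr_sumr.
set Z := a * r2 * _ * _.
have Z0 : 0 <= Z.
  rewrite /Z !mulr_ge0 ?powR_ge0 ?(ltW a0) ?(ltW n0) ?(ltW kap'0) //; exact: le_trans c21.
have m0 : 0 <= \sum_(x <- hv f) mass1 f x by apply: sumr_ge0 => *; exact: powR_ge0.
apply: ler_pM => //.
- exact: mulr_ge0.
- by apply: sumr_ge0 => *; exact: powR_ge0.
- by rewrite -[leRHS]mulr1; apply: ler_wpM2l => //; exact: mass1_sum.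
Qed.

(** ** Functions with the same code are close *)

Variable S2 : R.
Hypothesis n1 : 1 <= n.
Hypothesis w_light : forall x, x \in W -> ~ U x -> w x * (Lam x / n) `^ th <= eps.
Hypothesis w_out : forall x, x \notin W -> w x <= eps.
Hypothesis wt_small : forall x, x \in W ->
  wt x * (N x)%:R `^ (- delta) * (Lam x / n) `^ th <= eps.
Hypotheses (w_Wm : forall x, w x <= Wm) (wt_Wm : forall x, wt x <= Wm).
Hypothesis M_large : 2 `^ (- (delta * M%:R)) * Wm <= eps.
Hypothesis Lb_large : cr * (Wm + Wm) / mesh < Lb%:R.
Hypothesis Kc_large : forall x, (size (ch x) <= Kc)%N.
Hypothesis few_pieces : B1 + a * G * (kap * n) <= n.
Hypothesis S2P : forall k, \sum_(m < k) 2 `^ (- (delta / 2 * m%:R)) <= S2.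

Let Npow_le1 x : (N x)%:R `^ (- delta) <= 1.
Proof.
rewrite -[leRHS](powRr0 (N x)%:R); apply: ler_powR; first by rewrite ler1n.
by rewrite oppr_le0 ltW.
Qed.

Let omega_Wm x m : omega x m <= 2 `^ (- (delta * m%:R)) * Wm.
Proof.
rewrite omegaE; apply: ler_wpM2l; first exact: powR_ge0.
apply: le_trans (wt_Wm x); rewrite -[leRHS]mulr1; apply: ler_wpM2l => //.
exact: ltW.
Qed.

Let nX_le1 E f : measurable E -> Ball f -> nX E f <= 1.
Proof.
move=> mE [Xf f1 _]; apply: le_trans f1.
by apply: (lp_mono hX).
Qed.

Let opz H f m (z : V * nat) : T -> R :=
  if `[< H z.1 >] then op z.1 m z.2 f else op0 z.1 f.

Let opz_in H f m z : P (opz H f m z).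
Proof. by rewrite /opz; case: ifP. Qed.

Let powq_scale x y b h : 0 <= y -> 0 <= x -> 0 <= b -> 0 <= h -> x <= h ->
  y <= b * x -> y `^ q <= b `^ q * h `^ (q - p) * x `^ p.
Proof.
move=> y0 x0 b0 h0 xh yb.
apply: (@le_trans _ _ ((b * x) `^ q)).
  by apply: ge0_ler_powR; rewrite ?nnegrE ?(ltW q0) ?mulr_ge0.
rewrite powRM // -mulrA; apply: ler_wpM2l; first exact: powR_ge0.
by apply: powR_interp => //; exact: ltW.
Qed.

Let Acst := eps * (1 + kap `^ (- th)).

Let Acst_ge : eps <= Acst.
Proof.
rewrite /Acst mulrDr mulr1 lerDl; apply: mulr_ge0; first exact: ltW.
exact: powR_ge0.
Qed.

(** The error on a light branch is [w x] times its norm, whose [q]-th power is at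
    most [(tau x) `^ ((q - p) / p)] times its mass. *)
Let tail_piece f z : Ball f -> z \in pieces_of f M ->
  nY (piece_of f M z) (f \- opz (Hf f) f M z) `^ q <=
  Acst `^ q * nX (piece_of f M z) f `^ p.
Proof.
move=> Bf; have [Xf f1 _] := Bf; case: z => x i _.
have mE : measurable (piece_of f M (x, i)).
  by apply: (measurable_piece e root mF _ ip).
set E := piece _ _ _ _ _ _ _ in mE *.
have x0 : 0 <= nX E f by apply: (lp_ge0 hX) => //; apply: (lp_in hX).
have Yf := XY Xf.
have y0 : 0 <= nY E (f \- opz (Hf f) f M (x, i)).
  apply: (lp_ge0 hY) => //; apply: (lp_in hY) => //; apply: (lp_inB hY) => //.
  exact/PY/opz_in.
have A0 : 0 <= Acst by apply: le_trans Acst_ge; apply: ltW.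
have x1 : nX E f <= 1 by apply: nX_le1.
have simple b : 0 <= b -> b <= eps -> nY E (f \- opz (Hf f) f M (x, i)) <= b * nX E f ->
    nY E (f \- opz (Hf f) f M (x, i)) `^ q <= Acst `^ q * nX E f `^ p.
  move=> b0 be le; have := powq_scale y0 x0 b0 ler01 x1 le.
  rewrite powR1 mulr1 => /le_trans; apply; apply: ler_wpM2r; first exact: powR_ge0.
  apply: ge0_ler_powR; rewrite ?nnegrE ?(ltW q0) //; exact: le_trans Acst_ge.
move: simple y0; rewrite /opz /E /piece /=; case: asboolP => [Hx|nHx] simple y0.
  apply: (simple (omega x M)); first exact: ltW.
    exact: le_trans (omega_Wm x M) M_large.
  exact: (ip_bound (ip x)).
have bd := op0_bound Xf (branch_rooted root tr (Hf f) x).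
have [xW|xW] := boolP (x \in W); last by apply: (simple (w x)) => //; apply: w_out.
have [nU lt] := Hf_light xW nHx.
set B := tree_domain F _ in bd y0 *; rewrite -/B in lt.
have mB : measurable B by exact: mdom.
have xB0 : 0 <= nX B f by apply: (lp_ge0 hX) => //; apply: (lp_in hX).
have tau0 : 0 <= tau x by rewrite /tau divr_ge0 ?mulr_ge0 ?ltW.
have xh : nX B f <= tau x `^ p^-1.
  have pV : p * p^-1 = 1 by rewrite divff ?gt_eqF.
  rewrite -[leLHS](powRr1 xB0) -pV powRrM.
  by apply: ge0_ler_powR; rewrite ?nnegrE ?invr_ge0 ?powR_ge0 ?(ltW p0).
apply: le_trans (powq_scale y0 xB0 (w0 x) (powR_ge0 _ _) xh bd) _.
apply: ler_wpM2r; first exact: powR_ge0.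
have -> : (tau x `^ p^-1) `^ (q - p) = (tau x `^ th) `^ q.
  by rewrite -!powRrM; congr (_ `^ _); rewrite mulrC qth mulrC.
have wt0' : 0 <= w x * tau x `^ th by rewrite mulr_ge0 ?powR_ge0.
rewrite -powRM ?powR_ge0 //; apply: ge0_ler_powR; rewrite ?nnegrE ?(ltW q0) //.
have -> : tau x = Lam x / n * kap^-1 by rewrite /tau; field; rewrite !gt_eqF.
have Ln : 0 <= Lam x / n by rewrite divr_ge0 // ltW.
have kv : 0 <= kap^-1 by rewrite invr_ge0 ltW.
rewrite powRM // mulrA.
have -> : kap^-1 `^ th = kap `^ (- th).
  by rewrite -(powR_inv1 (ltW kap0)) -powRrM mulN1r.
have := w_light xW nU => /(ler_wpM2r (powR_ge0 kap (- th))) /le_trans; apply.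
by rewrite /Acst mulrDr mulr1 lerDr ltW.
Qed.

Let H_partition f m : finite_partition mu (pieces_of f m)
  (piece_of f m).
Proof.
exact: (pieces_partition mF F_disj F_cover uW (@HfW f) (Hf_root f) chP ip).
Qed.

Let tail_bound f : Ball f ->
  \sum_(z <- pieces_of f M)
    nY (piece_of f M z) (f \- opz (Hf f) f M z) `^ q <= Acst `^ q.
Proof.
move=> Bf; have [Xf f1 _] := Bf.
apply: (@le_trans _ _ (Acst `^ q * nX [set: T] f `^ p)).
  rewrite (fp_sum hX (H_partition f M) Xf) mulr_sumr !big_seq.
  by apply: ler_sum => z; exact: tail_piece.
rewrite -[leRHS]mulr1; apply: ler_wpM2l; first exact: powR_ge0.
have <- : 1 `^ p = 1 :> R by rewrite powR1.
apply: ge0_ler_powR; rewrite ?nnegrE ?(ltW p0) //.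
by apply: (lp_ge0 hX).
Qed.

Let same f f' := forall x, x \in W -> forall l, code f x l = code f' x l.

(** The code marks the heavy vertices. *)
Let same_heavy f f' : same f f' -> Hf f = Hf f'.
Proof.
have half g g' x : same g g' -> Hf g x -> Hf g' x.
  move=> sgg' Hx; have := sgg' x (HfW Hx) (inl (inl (inl tt))).
  by rewrite /code asboolT //; case: asboolP.
move=> sff'; apply/seteqP; split=> x; apply: half => //.
by move=> y yW l; rewrite sff'.
Qed.

Let trunc_lt E g c : measurable E -> P g -> nY E g <= Wm + Wm ->
  (Num.truncn (Phi E g c / mesh) < Lb)%N.
Proof.
move=> mE Pg gW; have /andP[h0 h1] := (PhiP mE).1 g c Pg.
rewrite truncn_lt_nat; last by rewrite divr_ge0 // ltW.
apply: le_lt_trans Lb_large; apply: ler_wpM2r; first by rewrite invr_ge0 ltW.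
by apply: le_trans h1 _; apply: ler_wpM2l => //; exact: ltW.
Qed.

Let approx_norm E f g : measurable E -> Ball f -> P g ->
  nY E (f \- g) <= Wm -> nY E g <= Wm + Wm.
Proof.
move=> mE [Xf f1 fW] Pg fg; have Yf := XY Xf; have Yg := PY Pg.
have -> : g = f \- (f \- g) by apply/funext => t /=; ring.
have Yfg : Y [set: T] (f \- g) by apply: (lp_inB hY).
apply: le_trans (lp_nZB hY mE (lp_in hY mE Yf) (lp_in hY mE Yfg)) _.
apply: lerD => //; apply: le_trans fW; exact: (lp_mono hY).
Qed.

Let valE_lt f x i c : Ball f -> (valE f x i c < Lb)%N.
Proof.
move=> Bf; apply: trunc_lt => //; apply: (approx_norm _ Bf) => //.
have [Xf _ _] := Bf; apply: le_trans (ip_bound (ip x) 0 i Xf) _.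
rewrite -/(omega x 0); apply: (@le_trans _ _ (omega x 0)).
  by rewrite -[leRHS]mulr1; apply: ler_wpM2l; [exact: ltW|exact: nX_le1].
by have := omega_Wm x 0; rewrite mulr0 oppr0 powRr0 mul1r.
Qed.

Let valC_lt f x c : Ball f -> (valC f x c < Lb)%N.
Proof.
move=> Bf; apply: trunc_lt => //; apply: (approx_norm _ Bf) => //.
have [Xf _ _] := Bf.
apply: le_trans (op0_bound Xf (branch_rooted root tr (Hf f) x)) _.
apply: le_trans (w_Wm x); rewrite -[leRHS]mulr1; apply: ler_wpM2l => //.
exact: nX_le1.
Qed.

Let trunc_close E g g' : measurable E -> P g -> P g' ->
  (forall c, Num.truncn (Phi E g c / mesh) = Num.truncn (Phi E g' c / mesh)) ->
  nY E (g \- g') <= r2 * mesh.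
Proof.
move=> mE Pg Pg' same_c; apply: le_trans ((PhiP mE).2 g g' Pg Pg') _.
rewrite /r2 mulr_natl -sumr_const; apply: ler_sum => c _.
have /andP[h0 _] := (PhiP mE).1 g c Pg; have /andP[h0' _] := (PhiP mE).1 g' c Pg'.
by have [] := truncn_eq_dist mesh0 h0 h0' (same_c c).
Qed.

Let coarse_piece f f' z : Ball f -> Ball f' -> same f f' ->
  z \in pieces_of f 0 ->
  nY (piece_of f 0 z) (opz (Hf f) f 0 z \- opz (Hf f) f' 0 z)
    <= r2 * mesh.
Proof.
move=> Bf Bf' sff'; have EH := same_heavy sff'.
case: z => x i; rewrite mem_pieces mem_cat mem_hv (mem_lights (@HfW f) chP).
rewrite /piece /opz /=; case: asboolP => [Hx /= iK|nHx /= /andP[/asboolP lx i0]].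
  have xW := HfW Hx.
  apply: trunc_close => // c.
  have iKw : (i < Kw)%N by apply: leq_trans iK _; apply: capK.
  have := sff' x xW (inl (inl (inr (Ordinal iKw, c, Ordinal (valE_lt x i c Bf))))).
  rewrite /code -EH (asboolT Hx) /= iK /= eqxx /=.
  by case: eqP => // <- _.
apply: trunc_close => // c.
have [_ xr Hp] := lx; have pW := HfW Hp.
have xch := chP xr erefl.
have ic : (index x (ch (parent root tr x)) < size (ch (parent root tr x)))%N.
  by rewrite index_mem.
have iKc := leq_trans ic (Kc_large (parent root tr x)).
have := sff' _ pW (inl (inr (Ordinal iKc, c, Ordinal (valC_lt x c Bf)))).
rewrite /code -EH (asboolT Hp) /= ic /= /child nth_index // (asboolT lx) /=.
rewrite eqxx /= /valC -EH.
by case: eqP => // <- _.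
Qed.

Let number_of_pieces f : Ball f ->
  (size (pieces_of f 0))%:R <= n.
Proof.
move=> [Xf f1 _]; apply: le_trans few_pieces; apply: le_trans (heavy_cost Xf f1).
have -> : (size (pieces_of f 0))%:R =
    \sum_(z <- pieces_of f 0) 1 :> R.
  by rewrite big_const_seq count_predT iter_addr_0 -mulr_natl mulr1.
rewrite (sum_pieces (@HfW f) chP K 0 (fun=> 1)).
apply: (@le_trans _ _ (\sum_(x <- hv f) ((K x 0)%:R + (size (ch x))%:R))).
  rewrite big_split /=; apply: lerD.
    by apply: ler_sum => x _; rewrite sumr_const card_ord.
  rewrite big_const_seq count_predT iter_addr_0 -mulr_natl mulr1 -natr_sum ler_nat.
  exact: size_lights.
rewrite !big_seq; apply: ler_sum => x; rewrite mem_hv => /asboolP/HfW xW.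
have KN : (K x 0)%:R <= c2 * (N x)%:R.
  by have := ip_card (ip x) 0; rewrite expn0 mul1n.
have := ch_size x; have := aLam xW.
have c2N : 0 <= c2 * (N x)%:R by apply: le_trans KN.
rewrite /local => h1 h2.
apply: (@le_trans _ _ (c2 * (N x)%:R + c1)); first exact: lerD.
have s0 : 0 <= c2 * (N x)%:R + c1 by rewrite addr_ge0.
apply: (@le_trans _ _ (1 + (1 + r2) * (c2 * (N x)%:R + c1))).
  rewrite mulrDl mul1r; have := mulr_ge0 r2_ge0 s0; lra.
rewrite ler_peMl // addr_ge0 // mulr_ge0 // addr_ge0 //.
Qed.

(** There are at most [n] pieces, each with an error of order [eps / n], which is
    more than enough since [q > 1]. *)
Let coarse_bound f f' : Ball f -> Ball f' -> same f f' ->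
  \sum_(z <- pieces_of f 0)
    nY (piece_of f 0 z)
       (opz (Hf f) f 0 z \- opz (Hf f) f' 0 z) `^ q <= (r2 * eps) `^ q.
Proof.
move=> Bf Bf' sff'.
have rm : 0 <= r2 * mesh by rewrite mulr_ge0 // ltW.
apply: (@le_trans _ _ (\sum_(z <- pieces_of f 0) (r2 * mesh) `^ q)).
  rewrite !big_seq; apply: ler_sum => z zs.
  have mE : measurable (piece_of f 0 z).
    by apply: (measurable_piece e root mF _ ip).
  apply: ge0_ler_powR; rewrite ?nnegrE ?(ltW q0) //; last exact: coarse_piece.
  apply: (lp_ge0 hY) => //; apply: (lp_in hY) => //; apply: (lp_inB hY) => //;
  exact/PY/opz_in.
rewrite big_const_seq count_predT iter_addr_0 -mulr_natl.
apply: (@le_trans _ _ (n * (r2 * mesh) `^ q)).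
  by apply: ler_wpM2r; [exact: powR_ge0|exact: number_of_pieces].
have nn : 0 <= n by exact: ltW.
have nv : 0 <= n^-1 by rewrite invr_ge0.
have re : 0 <= r2 * eps by rewrite mulr_ge0 // ltW.
rewrite /mesh mulrA powRM // mulrCA -[leRHS]mulr1; apply: ler_wpM2l; first exact: powR_ge0.
rewrite -(powR_inv1 nn) -powRrM mulN1r -{1}(powRr1 nn) -powRD ?(gt_eqF n0) ?implybT //.
rewrite -[leRHS](powRr0 n); apply: ler_powR => //.
by rewrite subr_le0; apply: ltW; apply: lt_trans pq.
Qed.

Let beta m := eps * kap' `^ (- th) * 2 `^ (- (delta / 2 * m%:R)).

Let beta_ge0 m : 0 <= beta m.
Proof. by rewrite /beta !mulr_ge0 ?powR_ge0 // ltW. Qed.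

(** The exponent [al] is half of what the decay of [omega] would allow. *)
Let omega_hh x m : x \in W -> omega x m `^ q * hh x m `^ (q - p) <= beta m `^ q.
Proof.
move=> xW.
have -> : hh x m `^ (q - p) = (hh x m `^ p `^ th) `^ q.
  rewrite -!powRrM; congr (_ `^ _).
  by rewrite /th; field; rewrite !gt_eqF.
rewrite -powRM ?powR_ge0 ?(ltW (omega0 x m)) //.
apply: ge0_ler_powR; rewrite ?nnegrE ?(ltW q0) //.
  by rewrite mulr_ge0 ?powR_ge0 // ltW.
rewrite hhp omegaE.
have Ln : 0 <= Lam x / n by rewrite divr_ge0 // ltW.
have kv : 0 <= kap'^-1 by rewrite invr_ge0 ltW.
have -> : Lam x * 2 `^ (al * m%:R) / (kap' * n) =
    (Lam x / n) * (kap'^-1 * 2 `^ (al * m%:R)) by field; rewrite !gt_eqF.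
have tz : 0 <= 2 `^ (al * m%:R) :> R by exact: powR_ge0.
rewrite (powRM th Ln (mulr_ge0 kv tz)) (powRM th kv tz).
rewrite -(powR_inv1 (ltW kap'0)) -[(kap' `^ (-1)) `^ th]powRrM mulN1r.
rewrite -[(2 `^ _) `^ th]powRrM.
have -> : al * m%:R * th = delta / 2 * m%:R.
  by rewrite /al; field; rewrite gt_eqF.
have -> : forall A B C E G : R, A * B * (C * (E * G)) = (B * C) * (E * (A * G)).
  by move=> *; ring.
rewrite /beta -[leRHS]mulrA; apply: ler_pM.
- by rewrite !mulr_ge0 ?powR_ge0 // ltW.
- by rewrite !mulr_ge0 ?powR_ge0.
- exact: wt_small.
- rewrite -powRD ?pnatr_eq0 ?implybT //.
  by rewrite (_ : - (delta * m%:R) + delta / 2 * m%:R = - (delta / 2 * m%:R)) //; field.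
Qed.

Let dop f f' x m i j : T -> R :=
  (op x m.+1 j f \- op x m i f) \- (op x m.+1 j f' \- op x m i f').

(** Coordinates with the same integer part differ by at most the unit [eta], and
    by at most their sum: the first bound gives the gain of [powR_interp], the
    second the summability over the pieces. *)
Let increment_close f f' x m i j : Ball f -> Ball f' -> x \in W ->
  (forall c, valW f x m i j c = valW f' x m i j c) ->
  nY (D x m i `&` D x m.+1 j) (dop f f' x m i j) `^ q <=
   (r2 * cr * beta m) `^ q * (2 `^ p *
    (ov x m i j * (nX (D x m i) f + nX (D x m.+1 j) f) `^ p +
     ov x m i j * (nX (D x m i) f' + nX (D x m.+1 j) f') `^ p)).
Proof.
move=> [Xf f1 _] [Xf' f1' _] xW sv.
have mE : measurable (D x m i `&` D x m.+1 j) by apply: measurableI.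
set E := D x m i `&` D x m.+1 j in mE *.
set s := nX (D x m i) f + nX (D x m.+1 j) f.
set s' := nX (D x m i) f' + nX (D x m.+1 j) f'.
have s0 : 0 <= s by rewrite addr_ge0 // nXD_ge0.
have s'0 : 0 <= s' by rewrite addr_ge0 // nXD_ge0.
have o0 : 0 <= ov x m i j by rewrite ler0n.
pose M' := Num.min (hh x m) (ov x m i j * (s + s')).
have M0 : 0 <= M' by rewrite le_min ltW //= mulr_ge0 // addr_ge0.
have Pg : P (op x m.+1 j f \- op x m i f) by apply: P_sub.
have Pg' : P (op x m.+1 j f' \- op x m i f') by apply: P_sub.
have co : 0 < cr * omega x m by rewrite mulr_gt0.
have bd : nY E (dop f f' x m i j) <= r2 * cr * omega x m * M'.
  apply: le_trans ((PhiP mE).2 _ _ Pg Pg') _.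
  have -> : r2 * cr * omega x m * M' = r2 * (cr * omega x m * M') by ring.
  rewrite /r2 mulr_natl -sumr_const; apply: ler_sum => c _.
  have /andP[h0 h1] := Phi_overlap x m i j c Xf.
  have /andP[h0' h1'] := Phi_overlap x m i j c Xf'.
  have [d1 d2] := truncn_eq_dist (eta0 x m) h0 h0' (sv c).
  rewrite /M' minr_pMr; last exact: ltW.
  rewrite le_min; apply/andP; split; first exact: d1.
  apply: (le_trans d2); rewrite [ov x m i j * _]mulrDr mulrDr.
  exact: lerD.
have y0 : 0 <= nY E (dop f f' x m i j).
  apply: (lp_ge0 hY) => //; apply: (lp_in hY) => //.
  exact/PY/P_sub.
have b0 : 0 <= r2 * cr * omega x m by rewrite !mulr_ge0 // ltW.
have Mh : M' <= hh x m by rewrite ge_min lexx.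
apply: le_trans (powq_scale y0 M0 b0 (ltW (hh0 x m)) Mh bd) _.
have rc : 0 <= r2 * cr by rewrite mulr_ge0 // ltW.
have om := ltW (omega0 x m).
rewrite powRM // -[_ * omega x m `^ q * _]mulrA.
rewrite (powRM q rc (beta_ge0 m)); apply: ler_pM.
- by rewrite !mulr_ge0 ?powR_ge0.
- exact: powR_ge0.
- by apply: ler_wpM2l; [exact: powR_ge0|exact: omega_hh].
apply: (@le_trans _ _ ((ov x m i j * (s + s')) `^ p)).
  apply: ge0_ler_powR; rewrite ?nnegrE ?(ltW p0) //.
    by rewrite mulr_ge0 // addr_ge0.
  by rewrite ge_min lexx orbT.
rewrite -mulrDr mulrCA /ov; case: (0 < _)%E => /=.
  by rewrite !mul1r; apply: powR_add_le => //; exact: ltW.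
by rewrite !mul0r powR0 ?gt_eqF.
Qed.

Let Qcst : R := 2 `^ p * (2 `^ p * (2 * c2)) * 2.

Let Qcst1 : 1 <= Qcst.
Proof.
have h : 1 <= 2 `^ p :> R.
  by rewrite -[leLHS](powRr0 2); apply: ler_powR; [lra|exact: ltW].
rewrite /Qcst; apply: mulr_ege1; last by rewrite ler1n.
apply: mulr_ege1 => //; apply: mulr_ege1 => //; have := c21; lra.
Qed.

Let increments f f' m : Ball f -> Ball f' -> same f f' -> (m < M)%N ->
  \sum_(x <- hv f) \sum_(i < K x m) \sum_(j < K x m.+1)
    nY (D x m i `&` D x m.+1 j) (dop f f' x m i j) `^ q
  <= (r2 * cr * Qcst * beta m) `^ q.
Proof.
move=> Bf Bf' sff' mM; have EH := same_heavy sff'.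
have [Xf f1 _] := Bf; have [Xf' f1' _] := Bf'.
set Z := (r2 * cr * beta m) `^ q.
have Z0 : 0 <= Z by exact: powR_ge0.
have tp : 0 <= 2 `^ p :> R by exact: powR_ge0.
apply: (@le_trans _ _ (\sum_(x <- hv f) Z * (2 `^ p * (2 `^ p * (2 * c2) *
   (mass1 f x + mass1 f' x))))).
  rewrite !big_seq; apply: ler_sum => x; rewrite mem_hv => /asboolP Hx.
  have xW := HfW Hx.
  apply: (@le_trans _ _ (\sum_(i < K x m) \sum_(j < K x m.+1) Z * (2 `^ p *
    (ov x m i j * (nX (D x m i) f + nX (D x m.+1 j) f) `^ p +
     ov x m i j * (nX (D x m i) f' + nX (D x m.+1 j) f') `^ p)))).
    apply: ler_sum => i _; apply: ler_sum => j _.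
    apply: increment_close => // c.
    have iK : (i < Kw)%N by apply: leq_trans (ltn_ord i) _; apply: capK => //; exact: ltnW.
    have jK : (j < Kw)%N by apply: leq_trans (ltn_ord j) _; apply: capK.
    have := sff' x xW (inr (Ordinal mM, Ordinal iK, Ordinal jK, c)).
    by rewrite /code -EH (asboolT Hx) /= !ltn_ord.
  under eq_bigr do rewrite -mulr_sumr -mulr_sumr.
  rewrite -mulr_sumr -mulr_sumr; apply: ler_wpM2l => //; apply: ler_wpM2l => //.
  under eq_bigr do rewrite big_split /=.
  rewrite big_split /= mulrDr; apply: lerD; exact: overlap_sum.
rewrite -mulr_sumr -mulr_sumr -mulr_sumr big_split /=.
have h1 := mass1_sum Xf f1.
have h2 : \sum_(x <- hv f) mass1 f' x <= 1 by rewrite /hv EH; exact: mass1_sum.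
have rb : 0 <= r2 * cr * beta m.
  by apply: mulr_ge0 => //; apply: mulr_ge0 => //; exact: ltW.
rewrite [r2 * cr * Qcst * beta m]mulrAC (powRM q rb (le_trans ler01 Qcst1)).
apply: ler_wpM2l => //.
apply: (@le_trans _ _ Qcst).
  rewrite /Qcst -[leRHS]mulrA; apply: ler_wpM2l => //; apply: ler_wpM2l; last lra.
  by rewrite !mulr_ge0 // (le_trans ler01).
by apply: le1r_powR => //; apply: ltW; apply: lt_trans pq.
Qed.

(** Light branches have no increments, and pieces of distinct cells do not meet. *)
Let increments_pieces f f' m : Ball f -> Ball f' -> same f f' -> (m < M)%N ->
  \sum_(z <- pieces_of f m)
   \sum_(z' <- pieces_of f m.+1)
    nY (piece_of f m z `&` piece_of f m.+1 z')
      ((opz (Hf f) f m.+1 z' \- opz (Hf f) f m z) \-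
       (opz (Hf f) f' m.+1 z' \- opz (Hf f) f' m z)) `^ q
  <= (r2 * cr * Qcst * beta m) `^ q.
Proof.
move=> Bf Bf' sff' mM; apply: le_trans (increments Bf Bf' sff' mM).
set H := Hf f; pose s k := pieces root tr W H ch K k.
pose t z z' := nY (piece e root F H D m z `&` piece e root F H D m.+1 z')
      ((opz H f m.+1 z' \- opz H f m z) \- (opz H f' m.+1 z' \- opz H f' m z)) `^ q.
have mE k z : measurable (piece e root F H D k z).
  by apply: (measurable_piece e root mF _ ip).
have off x i y j : (x, i) \in s m -> (y, j) \in s m.+1 -> x <> y ->
    t (x, i) (y, j) = 0.
  move=> xi yj xy.
  rewrite /t (lp_null0 hY) ?powR0 ?gt_eqF //; first exact: measurableI.
    exact: (piece_disjoint mF F_disj (@HfW f) chP ip xi yj xy).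
  by apply: (lp_in hY); [exact: measurableI|apply/PY/P_sub; apply: P_sub; exact: opz_in].
have heavy_in x : x \in hv f -> x \in cells root tr W H ch.
  by move=> xh; rewrite mem_cat -/(hv f) xh.
have light_in y : y \in lights root tr W H ch -> y \in cells root tr W H ch.
  by move=> yl; rewrite mem_cat yl orbT.
have in_heavy k x i : x \in hv f -> (i < K x k)%N -> (x, i) \in s k.
  move=> xh iK; rewrite mem_pieces heavy_in //=.
  by move: xh; rewrite mem_hv -/H => ->.
have in_light k y : y \in lights root tr W H ch -> (y, 0%N) \in s k.
  move=> yl; rewrite mem_pieces light_in //=.
  move: yl; rewrite (mem_lights (@HfW f) chP) => /asboolP[nHy _ _].
  by rewrite asboolF.
have neq x y : x \in hv f -> y \in lights root tr W H ch -> x <> y.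
  move=> xh yl xy; move: xh yl; rewrite -xy mem_hv (mem_lights (@HfW f) chP).
  by move=> /asboolP Hx /asboolP[].
rewrite -/(s m) -/(s m.+1) (sum_pieces (@HfW f) chP K m
  (fun z => \sum_(z' <- s m.+1) t z z')) /= -/(hv f).
rewrite [X in _ + X]big1_seq ?addr0 => [|y /= yl]; last first.
  rewrite (sum_pieces (@HfW f) chP K m.+1 (t (y, 0%N))) -/(hv f).
  rewrite big1_seq ?add0r => [|x /= xh]; last first.
    rewrite big1 // => j _; apply: off; [exact: in_light|exact: in_heavy|].
    by move=> yx; apply: (neq _ _ xh yl).
  rewrite big1_seq // => y' /= yl'; have [yy'|yy'] := pselect (y = y'); last first.
    by apply: off => //; exact: in_light.
  subst y'; rewrite /t (_ : _ \- _ = fun=> 0) ?(lp_nZ0 hY) ?powR0 ?gt_eqF //.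
    exact: measurableI.
  apply/funext => u; rewrite /opz /=.
  move: yl; rewrite (mem_lights (@HfW f) chP) => /asboolP[nHy _ _].
  by rewrite asboolF //= !subrr.
rewrite !big_seq; apply: ler_sum => x xh; apply: ler_sum => i _.
rewrite (sum_pieces (@HfW f) chP K m.+1 (t (x, i : nat))) -/(hv f).
rewrite [X in _ + X]big1_seq ?addr0 => [|y /= yl]; last first.
  apply: off; [exact: in_heavy|exact: in_light|exact: neq].
rewrite (bigD1_seq x) //= [X in _ + X]big1_seq ?addr0 => [|y /andP[/eqP yx yh]]; last first.
  rewrite big1 // => j _; apply: off; [exact: in_heavy|exact: in_heavy|].
  by move=> xy; apply: yx.
apply: ler_sum => j _.
by move: xh; rewrite /t /piece /opz /dop mem_hv -/H /= => ->.
Qed.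

Definition core_const : R :=
  2 * (1 + kap `^ (- th)) + r2 * cr * Qcst * kap' `^ (- th) * S2 + r2.

Let close f f' : Ball f -> Ball f' -> same f f' ->
  nY [set: T] (f \- f') <= core_const * eps.
Proof.
move=> Bf Bf' sff'; have EH := same_heavy sff'.
have [Xf _ _] := Bf; have [Xf' _ _] := Bf'.
have A0 : 0 <= Acst by apply: le_trans Acst_ge; exact: ltW.
have C0 : 0 <= r2 * eps by rewrite mulr_ge0 // ltW.
have Q0 : 0 <= Qcst by apply: le_trans Qcst1.
have rcQ : 0 <= r2 * cr * Qcst.
  by apply: mulr_ge0 => //; apply: mulr_ge0 => //; exact: ltW.
have B0 m : 0 <= r2 * cr * Qcst * beta m by rewrite mulr_ge0.
have tail' : \sum_(z <- pieces_of f M)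
    nY (piece_of f M z) (f' \- opz (Hf f) f' M z) `^ q <= Acst `^ q.
  by rewrite EH; exact: tail_bound.
have := multiscale_close hY Y_ind (H_partition f)
  (fun m z => PY (opz_in (Hf f) f m z)) (fun m z => PY (opz_in (Hf f) f' m z))
  (XY Xf) (XY Xf') A0 C0 B0 (tail_bound Bf) tail'
  (fun m mM => increments_pieces Bf Bf' sff' mM) (coarse_bound Bf Bf' sff').
move=> /le_trans; apply.
rewrite /core_const /Acst ![(_ + _) * eps]mulrDl.
apply: lerD => //; apply: lerD; first by rewrite -mulrA [eps * _]mulrC.
rewrite -mulr_sumr /beta -mulr_sumr.
have ek : 0 <= eps * kap' `^ (- th) by rewrite mulr_ge0 ?powR_ge0 // ltW.
have -> : r2 * cr * Qcst * kap' `^ (- th) * S2 * eps =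
   r2 * cr * Qcst * (eps * kap' `^ (- th) * S2) by ring.
by apply: ler_wpM2l => //; apply: ler_wpM2l.
Qed.

Hypothesis kraft : (1 + Kw * #|{: 'I_r0 * bool}| * Lb
   + Kc * #|{: 'I_r0 * bool}| * Lb
   + M * Kw * Kw * #|{: 'I_r0 * bool}|)%N%:R * \sum_(x <- W) 2 `^ (- (a * Lam x)) <= 1.

Variable Phat : (T -> R) -> T -> R.
Hypothesis Phat_in : forall f, X [set: T] f -> P (Phat f).
Hypothesis P_null : forall g, P g -> nX [set: T] g = 0.
Hypothesis Phat_bound : forall f, X [set: T] f ->
  nY [set: T] (f \- Phat f) <= w root * nX [set: T] f.

(** The elements of the space [Xhat] are bounded in the target norm, since the
    projection does not change the seminorm of the source. *)
Let Xhat_Ball f : Xhat X Phat f -> nX [set: T] f <= 1 -> Ball f.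
Proof.
move=> [g Xg <-] g1; have mT : measurable [set: T] by [].
have Xf : X [set: T] (g \- Phat g) by apply: (lp_inB hX) => //; exact/PX/Phat_in.
split=> //; apply: le_trans (Phat_bound Xg) _; apply: le_trans (w_Wm root).
rewrite -[leRHS]mulr1; apply: ler_wpM2l => //; apply: le_trans g1.
have E : g = (g \- Phat g) \+ Phat g by apply/funext => t /=; ring.
rewrite [X in nX _ X <= _]E; apply: le_trans (lp_nZD hX mT Xf (PX (Phat_in Xg))) _.
by rewrite (P_null (Phat_in Xg)) addr0.
Qed.

Lemma core_entropy (k : nat) :
  expR 2 * 2 `^ (B1 + a * G * (kap * n)
    + a * r2 * (2 `^ p * (2 * c2)) * (kap' * n) * Sal) <= (2 ^ k.-1)%:R ->
  (entropy_number (Xhat X Phat) (nX [set: T]) (Y [set: T]) (nY [set: T]) id k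
    <= (core_const * eps)%:E)%E.
Proof.
move=> count; have mT : measurable [set: T] by [].
have S20 : 0 <= S2 by have := S2P 0; rewrite big_ord0.
have core0 : 0 < core_const.
  have t1 : 0 <= kap `^ (- th) by exact: powR_ge0.
  have t2 : 0 <= r2 * cr * Qcst * kap' `^ (- th) * S2.
    apply: mulr_ge0 => //; apply: mulr_ge0; last exact: powR_ge0.
    apply: mulr_ge0; last exact: le_trans Qcst1.
    by apply: mulr_ge0 => //; exact: ltW.
  by rewrite /core_const; have := r2_ge0; lra.
have XhatY f : Xhat X Phat f -> Y [set: T] f.
  move=> [g Xg <-]; apply: (lp_inB hY) => //; first exact: XY.
  exact/PY/Phat_in.
apply: (@entropy_le_atoms R _ _ _ _ _ _ _ _ _ ('I_(size W) * Loc)%type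
  (fun j => a * Lam (nth root W j.1)) _
  (fun f j => code f (nth root W j.1) j.2)) count _ _ => //.
- exact: mulr_gt0.
- by exists (fun=> 0); apply: (lp_in0 hY).
- by move=> j; apply: aLam; apply: mem_nth.
- rewrite -(pair_bigA _ (fun (i : 'I_(size W)) (l : Loc) =>
     2 `^ (- (a * Lam (nth root W i))))) /=.
  under eq_bigr do rewrite sumr_const.
  rewrite sumrMnl -[leLHS]mulr_natl -(big_mkord xpredT (fun i => 2 `^ (- (a * Lam (nth root W i))))).
  rewrite -(big_nth root xpredT (fun x => 2 `^ (- (a * Lam x)))) /=.
  by apply: le_trans kraft; rewrite !card_sum !card_prod !card_ord card_unit.
- by move=> f Xf f1; apply: total_cost; exact: Xhat_Ball.
- move=> f f' Xf f1 Xf' f1' E; apply: close; [exact: Xhat_Ball|exact: Xhat_Ball|].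
  move=> x xW l; have ix : (index x W < size W)%N by rewrite index_mem.
  by have := E (Ordinal ix, l); rewrite /= nth_index.
Qed.

End core.

(** * Levels of the tree *)

Section levels.
Context {R : realType}.

Lemma counting_ge (I : choiceType) (A : set I) (s : seq I) : uniq s ->
  (forall x, x \in s -> A x) -> ((size s)%:R%:E <= counting A :> \bar R)%E.
Proof.
move=> us sA; rewrite /counting; case: ifPn => [/asboolP fin|_]; last by rewrite leey.
rewrite lee_fin ler_nat; apply: uniq_leq_size => // x /sA Ax.
by rewrite -[_ \in _]/(x \in fset_set A) in_fset_set // mem_set.
Qed.

Lemma esum_counting_ge (V : countType) (I : choiceType) (J : set I)
    (A : I -> set V) (s : seq V) : uniq s ->
  (forall x, x \in s -> exists2 i, J i & A i x) ->
  ((size s)%:R%:E <= \esum_(i in J) counting (A i) :> \bar R)%E.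
Proof.
move=> us sA; case: s us sA => [|v0 s0] us sA.
  by apply: esum_ge0 => i _; apply: (@counting_ge _ (A i) [::]).
set s := v0 :: s0 in us sA *.
have [i0 _ _] := sA v0 (mem_head _ _).
have /choice[g hg] : forall x, exists i, x \in s -> J i /\ A i x.
  move=> x; have [xs|xs] := boolP (x \in s); last by exists i0.
  by have [i Ji Ai] := sA x xs; exists i.
pose r := undup (map g s).
apply: esum_ge; exists [set` r].
  split; first exact: finite_seq.
  move=> i /=; rewrite mem_undup => /mapP[x xs ->]; by have [] := hg x xs.
rewrite -fsbig_seq ?undup_uniq //.
apply: (@le_trans _ _ (\sum_(i <- r) (size [seq x <- s | g x == i])%:R%:E)%E); last first.
  rewrite !big_seq; apply: lee_sum => i ir; apply: counting_ge.
    exact: filter_uniq.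
  by move=> x; rewrite mem_filter => /andP[/eqP <- xs]; have [] := hg x xs.
rewrite sumEFin lee_fin -natr_sum ler_nat.
have -> : size s = (\sum_(x <- s) \sum_(i <- r) (g x == i))%N.
  rewrite -sum1_size; apply: eq_big_seq => x xs.
  have gr : g x \in r by rewrite mem_undup map_f.
  rewrite (bigD1_seq (g x)) ?undup_uniq //= eqxx big1 ?addn0 // => i.
  by rewrite eq_sym => /negbTE ->.
rewrite exchange_big; apply: leq_sum => i _.
rewrite size_filter -sum1_count [X in (_ <= X)%N]big_mkcond.
by apply: leq_sum => x _; case: eqP.
Qed.

Lemma finite_of_bound (V : countType) (A : set V) (c : R) :
  (forall s, uniq s -> (forall x, x \in s -> A x) -> (size s)%:R <= c) ->
  exists s : seq V, [/\ uniq s, (forall x, x \in s <-> A x) & (size s)%:R <= c].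
Proof.
move=> H; have fin : finite_set A.
  apply: contrapT => /(infinite_set_fset (Num.truncn c).+1)[B BA Bc].
  have := H B (fset_uniq B) (fun x xB => BA x xB).
  rewrite leNgt => /negP; apply.
  apply: lt_le_trans (truncnS_gt c) _; by rewrite ler_nat.
have memA x : (x \in (fset_set A : seq V)) <-> A x.
  by rewrite -[_ \in _]/(x \in fset_set A) in_fset_set //; split=> [/set_mem|/mem_set].
exists (fset_set A : seq V); split=> //; first exact: fset_uniq.
by apply: H; [exact: fset_uniq|move=> x /memA].
Qed.

(** The level of a vertex is the first index of the part [At t i] that contains
    it.  The bound on [wt] follows from that on [w] since [lambda <= mu_]. *)
Lemma levels_ex (V : countType) (e : rel V) (root : V) (w wt : V -> R)
    (lambda mu_ gamma : R) (psi u : R -> R) (c3 : R) (t0 : nat) (I : choiceType)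
    (J : nat -> set I) (At : nat -> I -> set V) (i0 : I) :
  1 <= c3 -> lambda <= mu_ ->
  (forall y, 0 < y -> 0 < psi y) -> (forall y, 0 < y -> 0 < u y) ->
  assumption3 e root w wt lambda mu_ gamma psi u c3 t0 J At ->
  J t0 = [set i0] -> At t0 i0 root ->
  exists (lev : V -> nat) (s : nat -> seq V),
  [/\ lev root = t0,
      forall x, w x <= c3 * (2 `^ (- lambda * (lev x)%:R) * u (2 ^+ lev x)),
      forall x, wt x <= c3 * (2 `^ (- lambda * (lev x)%:R) * u (2 ^+ lev x)),
      forall t, uniq (s t) /\ forall x, x \in s t <-> lev x = t &
      forall t, (size (s t))%:R <=
        c3 * (2 `^ (gamma * 2 ^+ t) * psi (2 ^+ (2 ^ t)%N))].
Proof.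
move=> c31 lm psi0 u0 [[_ dis cov] ww count _ _] Jt0 Aroot.
have p2 k : 0 < 2 ^+ k :> R by rewrite exprn_gt0.
have /choice[lev hlev] : forall x, exists t, (t0 <= t)%N /\ exists2 i, J t i & At t i x.
  by move=> x; have [t [i [tt Ji Ai]]] := cov x; exists t; split=> //; exists i.
have lev_eq x t i : (t0 <= t)%N -> J t i -> At t i x -> lev x = t.
  move=> tt Ji Ai; have [tl [j Jj Aj]] := hlev x; apply: contrapT => ne.
  have : (At t i `&` At (lev x) j) x by [].
  by rewrite dis // => -[E _]; apply: ne.
have bound t : exists s : seq V, [/\ uniq s, (forall x, x \in s <-> lev x = t) &
   (size s)%:R <= c3 * (2 `^ (gamma * 2 ^+ t) * psi (2 ^+ (2 ^ t)%N))].
  apply: (@finite_of_bound _ [set x | lev x = t]) => s us sl.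
  have nu0 : 0 <= c3 * (2 `^ (gamma * 2 ^+ t) * psi (2 ^+ (2 ^ t)%N)).
    apply: mulr_ge0; first exact: le_trans c31.
    by apply: mulr_ge0; [exact: powR_ge0|apply/ltW/psi0].
  case: (leqP t0 t) => tt; last first.
    case: s us sl => // x s _ /(_ x (mem_head _ _)) /= lx.
    by have [] := hlev x; rewrite lx leqNgt tt.
  rewrite -lee_fin; apply: le_trans (count t tt).
  apply: esum_counting_ge => // x xs; have [_] := hlev x.
  by rewrite (sl x xs).
have /choice[s hs] := bound.
exists lev, s; split.
- by apply: (lev_eq root t0 i0) => //; rewrite Jt0.
- move=> x; have [tl [i Ji Ai]] := hlev x.
  by have [/andP[_ h] _] := ww _ _ _ tl Ji Ai; rewrite mulrA.
- move=> x; have [tl [i Ji Ai]] := hlev x.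
  have [_ /andP[_ h]] := ww _ _ _ tl Ji Ai.
  apply: le_trans h _; rewrite mulrA; apply: ler_wpM2r; first exact/ltW/u0.
  apply: ler_wpM2l; first exact: le_trans c31.
  apply: ler_powR; first by rewrite ler1n.
  by apply: ler_wpM2r => //; rewrite lerN2.
- by move=> t; have [] := hs t.
- by move=> t; have [] := hs t.
Qed.

End levels.

(** * Numerical conditions on the parameters of the code *)

Section scale.
Context {R : realType}.
Variables (p q : R) (r0 : nat) (delta c1 c2 : R).
Hypotheses (p1 : 1 < p) (pq : p < q) (delta0 : 0 < delta) (c11 : 1 <= c1)
  (c21 : 1 <= c2).

Let th := p^-1 - q^-1.
Let r2 : R := #|{: 'I_r0 * bool}|%:R.
Let G : R := 1 + (1 + r2) * (c2 + c1).

Definition geom_bound (x : R) : R := (1 - 2 `^ (- x))^-1.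

Lemma geom_sum_le (x : R) k : 0 < x ->
  \sum_(m < k) 2 `^ (- (x * m%:R)) <= geom_bound x.
Proof.
move=> x0; set y := 2 `^ (- x).
have y0 : 0 < y by exact: powR_gt0.
have y1 : y < 1.
  rewrite /y powRN invf_lt1 ?powR_gt0 //.
  rewrite -[ltLHS](powRr0 2) /powR pnatr_eq0 /= ltr_expR mul0r mulr_gt0 //.
  by rewrite ln_gt0 // ltr1n.
have E m : 2 `^ (- (x * m%:R)) = y ^+ m.
  by rewrite /y -powR_mulrn ?powR_ge0 // -powRrM mulNr.
under eq_bigr do rewrite E.
have H : (1 - y) * \sum_(m < k) y ^+ m = 1 - y ^+ k.
  elim: k => [|k IH]; first by rewrite big_ord0 mulr0 expr0 subrr.
  by rewrite big_ord_recr /= mulrDr IH exprS; ring.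
rewrite /geom_bound -/y -[leRHS]mul1r ler_pdivlMr ?subr_gt0 // mulrC H.
by rewrite gerBl exprn_ge0 // ltW.
Qed.

Let al := delta / (2 * th).
Let Sal := geom_bound al.
Let S2 := geom_bound (delta / 2).

(** With these values the heavy vertices outside [U] and the increments cost at
    most [n / 8] each. *)
Definition kap_of (a : R) : R := (8 * (a * G))^-1.
Definition kap'_of (a : R) : R :=
  (8 * (a * (1 + r2) * (2 `^ p * (2 * c2)) * (1 + Sal)))^-1.

Definition scale_const (a : R) : R :=
  core_const p q r0 c2 (kap_of a) (kap'_of a) S2.

(** Up to level [t1] all vertices are heavy, and beyond level [te] none is; [N1]
    is the parameter of the coarsest partitions up to level [t1], beyond which it
    is [1], and [M] the number of scales.  [Kw] bounds the number of pieces of a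
    vertex, and [Lb] the coordinates on the coarsest pieces in units of
    [eps / n]. *)
Record scale_conditions (wl nu : nat -> R) (Wm : R) (n t1 te M N1 Kw Lb : nat)
    (a eps : R) : Prop := ScaleConditions {
  sc_n : (0 < n)%N;
  sc_N1 : (0 < N1)%N;
  sc_a : 1 <= a;
  sc_eps : 0 < eps;
  sc_t : (t1 <= te)%N;
  sc_mid : forall t, (t1 < t)%N -> (t <= te)%N ->
    wl t * (2 ^+ t / n%:R) `^ th <= eps;
  sc_tail : forall t, (te < t)%N -> wl t <= eps;
  sc_low : Wm * N1%:R `^ (- delta) * (2 ^+ t1.+1 / n%:R) `^ th <= eps;
  sc_M : 2 `^ (- (delta * M%:R)) * Wm <= eps;
  sc_Kw : c2 * (2 ^ M * N1)%N%:R <= Kw%:R;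
  sc_Lb : 3 ^+ r0 * (Wm + Wm) / (eps / n%:R) < Lb%:R;
  sc_kraft : (1 + Kw * #|{: 'I_r0 * bool}| * Lb
    + Num.truncn c1 * #|{: 'I_r0 * bool}| * Lb
    + M * Kw * Kw * #|{: 'I_r0 * bool}|)%N%:R *
    (\sum_(t < te.+1) nu t * 2 `^ (- (a * 2 ^+ maxn t t1.+1))) <= 1;
  sc_budget : (\sum_(t < t1.+1) nu t) *
    (a * 2 ^+ t1.+1 * (1 + (1 + r2) * (c2 * N1%:R + c1))) <= n%:R / 8;
  sc_count : expR 2 * 2 `^ (3 * (n%:R / 8)) <= (2 ^ n.-1)%N%:R :> R }.

Section setting.
Context {d : measure_display} {T : measurableType d}.
Variable mes : {measure set T -> \bar R}.
Variables (V : countType) (w wt : V -> R).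
Hypotheses (hw : forall x, 0 < w x) (hwt : forall x, 0 < wt x).
Variables (e : rel V) (root : V).
Hypothesis tr : is_tree e.
Hypothesis hch : forall x, (counting (children e root x) <= c1%:E)%E.
Variables (Theta : set (set T)) (F : V -> set T).
Hypothesis hTheta : ae_partition mes Theta [set: T].
Hypothesis hF : set_bij [set: V] Theta F.
Variables (X : set T -> set (T -> R)) (nX : set T -> (T -> R) -> R)
  (Y : set T -> set (T -> R)) (nY : set T -> (T -> R) -> R) (P : set (T -> R)).
Hypothesis hfs : function_spaces mes p q X nX Y nY.
Hypothesis hP : null_subspace mes r0 X nX P.
Hypothesis ha1 : assumption1 mes e root F X nX Y nY P w.
Hypothesis ha2 : assumption2 mes F X nX Y nY P wt delta c2.
Variable Phat : (T -> R) -> T -> R.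
Hypothesis hPhat : tree_projection mes e root F X nX Y nY P w root Phat.

Variables (wl nu : nat -> R) (lev : V -> nat) (s : nat -> seq V) (Wm : R).
Hypothesis w_wl : forall x, w x <= wl (lev x).
Hypothesis wt_wl : forall x, wt x <= wl (lev x).
Hypothesis sP : forall t, uniq (s t) /\ forall x, x \in s t <-> lev x = t.
Hypothesis s_nu : forall t, (size (s t))%:R <= nu t.
Hypotheses (w_Wm : forall x, w x <= Wm) (wt_Wm : forall x, wt x <= Wm).

Let up_to t := [seq x | k <- iota 0 t.+1, x <- s k].

Let mem_up_to t x : (x \in up_to t) = (lev x <= t)%N.
Proof.
apply/allpairsPdep/idP => [[k [y [kt ys ->]]]|xt].
  by move: kt; rewrite mem_iota add0n ltnS; have /(_ y)[/(_ ys) -> _] := (sP k).2.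
exists (lev x), x; split=> //; first by rewrite mem_iota.
by apply/(sP (lev x)).2.
Qed.

Let uniq_up_to t : uniq (up_to t).
Proof.
apply: allpairs_uniq_dep; first exact: iota_uniq.
  by move=> k _; case: (sP k).
move=> [k x] [k' x'] /allpairsPdep[l [y [_ ys [-> ->]]]].
move=> /allpairsPdep[l' [y' [_ ys' [-> ->]]]] /= yy'; subst y'.
have <- := proj1 ((sP l).2 y) ys; have <- := proj1 ((sP l').2 y) ys'.
by [].
Qed.

Let sum_up_to t (f : V -> R) (g : nat -> R) : (forall k, 0 <= g k) ->
  (forall x, f x <= g (lev x)) ->
  \sum_(x <- up_to t) f x <= \sum_(k < t.+1) nu k * g k.
Proof.
move=> g0 fg; rewrite big_allpairs_dep.
rewrite -(big_mkord xpredT (fun k => nu k * g k)) /index_iota subn0.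
apply: ler_sum => k _; apply: (@le_trans _ _ (\sum_(x <- s k) g k)).
  rewrite !big_seq; apply: ler_sum => x xs; apply: le_trans (fg x) _.
  by rewrite (proj1 ((sP k).2 x) xs).
rewrite big_const_seq count_predT iter_addr_0 -[leLHS]mulr_natl.
by apply: ler_wpM2r.
Qed.

(** A vertex of level [t] has the price [2 ^+ maxn t t1.+1]: constant on the levels
    where all vertices are heavy, and large enough beyond to number all vertices
    of the level. *)
Lemma scale_entropy (n t1 te M N1 Kw Lb : nat) (a eps : R) :
  (lev root <= t1)%N ->
  scale_conditions wl nu Wm n t1 te M N1 Kw Lb a eps ->
  (entropy_number (Xhat X Phat) (nX [set: T]) (Y [set: T]) (nY [set: T]) id n
    <= (scale_const a * eps)%:E)%E.
Proof.
move=> root_t1 sc.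
have p0 : 0 < p by exact: lt_trans p1.
have q0 : 0 < q by exact: lt_trans pq.
have hc1 := c11; have hc2 := c21.
have th0 : 0 < th by rewrite /th subr_gt0 ltf_pV2 ?posrE.
have n0 : 0 < n%:R :> R by rewrite ltr0n (sc_n sc).
have a1 := sc_a sc; have a0 : 0 < a by lra.
have eps0 := sc_eps sc.
have hX := function_spaces_X p0 hfs; have hY := function_spaces_Y q0 hfs.
have XY := X_sub_Y hfs; have Yind := Y_indic hfs.
have [subP PX dimP Pnull] := hP.
have mT : measurable [set: T] by [].
have PY : P `<=` Y [set: T] by move=> f /PX/XY.
have P_sub f g : P f -> P g -> P (f \- g).
  move=> Pf Pg; have := ae_subspaceP subP (- 1) Pg Pf.
  by congr P; apply/funext => t /=; ring.
have P00 : P (fun=> 0) := ae_subspace0 subP.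
have [_ mTh dTh cTh] := hTheta; have [Fin Finj Fsurj] := hF.
have mF x : measurable (F x) by apply: mTh; apply: Fin.
have F_disj x y : x <> y -> mes (F x `&` F y) = 0%E.
  move=> xy; apply: dTh; [exact: Fin|exact: Fin|move=> E; apply: xy].
  by apply: Finj => //; rewrite inE.
have F_cover : mes (~` \bigcup_x F x) = 0%E.
  rewrite -cTh; congr (mes _); apply/seteqP; split=> t /=.
    move=> nt; left; split=> // -[E TE Et]; apply: nt.
    by have [x _ Fx] := Fsurj E TE; exists x => //; rewrite Fx.
  by case=> [[_ nt] [x _ Fx]|[_ []//]]; apply: nt; exists (F x) => //; apply: Fin.
have [Phi PhiP] := coordinates_ex hY PY dimP.
have /choice[Px hPx] := ha1.
pose op0 x f := if `[< X [set: T] f >] then Px x f else fun=> 0.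
have op0_in x f : P (op0 x f).
  rewrite /op0; case: asboolP => // Xf; have [lin _] := hPx x.
  by apply: (lin_cont_op_in lin); apply: XY.
have op0_bound x f S : X [set: T] f -> subtree_rooted_at e root x S ->
    nY (tree_domain F S) (f \- op0 x f) <= w x * nX (tree_domain F S) f.
  by move=> Xf hS; rewrite /op0 asboolT //; have [_ h] := hPx x; apply: h.
pose N x := if (lev x <= t1)%N then N1 else 1%N.
have N0 x : (0 < N x)%N by rewrite /N; case: ifP => // _; exact: sc_N1 sc.
have wt0 x : 0 <= wt x := ltW (hwt x).
have /choice[KDO hKDO] : forall x, exists z : (nat -> nat) * (nat -> nat -> set T) *
     (nat -> nat -> (T -> R) -> T -> R),
   indexed_partitions mes X nX nY P (F x) (N x) (wt x) delta c2 z.1.1 z.1.2 z.2.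
  move=> x; have [K [D [op h]]] := indexed_partitions_ex hX hY XY PX P00 c21 wt0 ha2 x (N0 x).
  by exists (K, D, op).
have /choice[ch hch'] := fun x => children_seq tr (hch x).
pose U x : Prop := (lev x <= t1)%N.
pose Lam x : R := 2 ^+ maxn (lev x) t1.+1.
have G0 : 0 < G.
  have r20 : 0 <= r2 by exact: ler0n.
  by rewrite /G ltr_pwDl // mulr_ge0 //; lra.
have Sal0 : 0 <= Sal.
  have al0 : 0 < al by rewrite /al divr_gt0 // mulr_gt0.
  by have := geom_sum_le 0 al0; rewrite big_ord0.
have D0 : 0 < a * (1 + r2) * (2 `^ p * (2 * c2)) * (1 + Sal).
  have r20 : 0 <= r2 by exact: ler0n.
  have t2 : 0 < 2 `^ p :> R by exact: powR_gt0.
  by rewrite !mulr_gt0 //; lra.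
have kap0 : 0 < kap_of a by rewrite invr_gt0 !mulr_gt0.
have kap'0 : 0 < kap'_of a by rewrite invr_gt0 mulr_gt0.
have kapE : a * G * (kap_of a * n%:R) = n%:R / 8.
  by rewrite /kap_of; field; rewrite !gt_eqF.
have kap'E : a * r2 * (2 `^ p * (2 * c2)) * (kap'_of a * n%:R) * Sal <= n%:R / 8.
  have -> : n%:R / 8 = a * (1 + r2) * (2 `^ p * (2 * c2)) * (kap'_of a * n%:R) * (1 + Sal).
    rewrite /kap'_of; field.
    have r20 : 0 <= r2 by exact: ler0n.
    have t2 : 0 < 2 `^ p :> R by exact: powR_gt0.
    by rewrite !gt_eqF //; lra.
  have r20 : 0 <= r2 by exact: ler0n.
  have t2 : 0 < 2 `^ p :> R by exact: powR_gt0.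
  have c20 : 0 <= c2 by lra.
  apply: ler_pM => //; rewrite ?lerDr //.
    by rewrite !mulr_ge0 // ltW.
  do 2 (apply: ler_wpM2r; first by rewrite !mulr_ge0 // ltW).
  by apply: ler_wpM2l; [exact: ltW|rewrite lerDr].
have Lam_low x : (lev x <= t1)%N -> Lam x = 2 ^+ t1.+1.
  by move=> h; rewrite /Lam (maxn_idPr _) // (leq_trans h).
have Lam_mid x : (t1 < lev x)%N -> Lam x = 2 ^+ lev x.
  by move=> h; rewrite /Lam (maxn_idPl _).
apply: (@core_entropy d T R mes p q p1 pq V e root F tr mF F_disj F_cover X nX
  Y nY hX hY XY Yind P r0 PX P_sub Phi PhiP w wt op0 (fun x => ltW (hw x)) hwt
  op0_in op0_bound delta c1 c2 N delta0 c21 N0 (fun x => (KDO x).1.1)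
  (fun x => (KDO x).1.2) (fun x => (KDO x).2) hKDO ch _ _ (up_to te) U Lam n%:R a
  (kap_of a) (kap'_of a) eps (uniq_up_to te) _ root_t1 _ n0 kap0 kap'0 eps0 _ _ M Kw
  (Num.truncn c1) Lb Wm _ (n%:R / 8) Sal _ _ S2 _ _ _ _ w_Wm wt_Wm (sc_M sc)
  (sc_Lb sc)).
- by move=> x; have [_ h _] := hch' x.
- by move=> x y yr yx; have [_ _ h] := hch' x; apply: h.
- by move=> x Ux; rewrite mem_up_to; apply: leq_trans Ux (sc_t sc).
- by move=> x; exact: exprn_gt0.
- by move=> x _ /negP nUx; rewrite /N (negbTE nUx).
- move=> x _; apply: mulr_ege1 => //; apply: exprn_ege1; rewrite ler1n //.
- move=> x m _ mM; rewrite -(ler_nat R).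
  apply: le_trans (ip_card (hKDO x) m) _; apply: le_trans (sc_Kw sc).
  apply: ler_wpM2l; first exact: le_trans c21.
  rewrite ler_nat leq_mul // ?leq_exp2l //.
  by rewrite /N; case: ifP => // _; exact: sc_N1 sc.
- pose loc : R := a * 2 ^+ t1.+1 * (1 + (1 + r2) * (c2 * N1%:R + c1)).
  have loc0 : 0 <= loc.
    have N10 : 0 <= N1%:R :> R by exact: ler0n.
    have r20 : 0 <= r2 by exact: ler0n.
    have c2N : 0 <= c2 * N1%:R by apply: mulr_ge0 => //; lra.
    have t2 : 0 <= 2 ^+ t1.+1 :> R by apply: exprn_ge0.
    rewrite /loc; apply: mulr_ge0; first by apply: mulr_ge0 => //; exact: ltW.
    by apply: addr_ge0 => //; apply: mulr_ge0; lra.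
  have -> : \sum_(x <- up_to te | `[< U x >])
      a * Lam x * (1 + (1 + #|{: 'I_r0 * bool}|%:R) * (c2 * (N x)%:R + c1)) =
     \sum_(x <- up_to te | (lev x <= t1)%N) loc.
    apply: eq_big => [x|x Ux]; first exact/asboolP/idP.
    have {}Ux : (lev x <= t1)%N by exact/asboolP.
    by rewrite Lam_low // /N Ux.
  apply: le_trans (sc_budget sc); rewrite -/loc mulr_suml.
  apply: (@le_trans _ _ (\sum_(k < te.+1) nu k * (if (k <= t1)%N then loc else 0))).
    rewrite big_mkcond; apply: (sum_up_to te (g := fun k => if (k <= t1)%N then loc else 0)).
      by move=> k; case: ifP.
    by move=> x.
  rewrite (big_ord_widen te.+1 (fun k => nu k * loc) (sc_t sc : (t1.+1 <= te.+1)%N)).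
  rewrite [leRHS]big_mkcond; apply: ler_sum => k _ /=; rewrite ltnS.
  by case: ifP; rewrite ?mulr0.
- by move=> k; apply: geom_sum_le; rewrite divr_gt0 // mulr_gt0.
- by rewrite ler1n (sc_n sc).
- move=> x; rewrite mem_up_to => xte /negP; rewrite /U -ltnNge => t1x.
  rewrite Lam_mid //; apply: le_trans (sc_mid sc t1x xte).
  by apply: ler_wpM2r; [exact: powR_ge0|exact: w_wl].
- move=> x; rewrite mem_up_to -ltnNge => tex.
  exact: le_trans (w_wl x) (sc_tail sc tex).
- move=> x; rewrite mem_up_to => xte; rewrite /N; case: leqP => t1x.
    rewrite Lam_low //; apply: le_trans (sc_low sc).
    apply: ler_wpM2r; first exact: powR_ge0.
    by apply: ler_wpM2r; [exact: powR_ge0|exact: wt_Wm].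
  rewrite Lam_mid // powR1 mulr1; apply: le_trans (sc_mid sc t1x xte).
  by apply: ler_wpM2r; [exact: powR_ge0|exact: wt_wl].
- move=> x; rewrite truncn_ge_nat; last exact: le_trans c11.
  by have [_ h _] := hch' x.
- by rewrite kapE; have := ltW n0; lra.
- by move=> k; apply: geom_sum_le; rewrite divr_gt0.
- apply: le_trans (sc_kraft sc); apply: ler_wpM2l; first exact: ler0n.
  apply: (sum_up_to te (g := fun t => 2 `^ (- (a * 2 ^+ maxn t t1.+1)))).
    by move=> k; exact: powR_ge0.
  by move=> x.
- move=> f Xf; have [lin _] := hPhat; apply: (lin_cont_op_in lin); exact: XY.
- exact: Pnull.
- move=> f Xf; have [lin bd] := hPhat.
  have all_root : branch e root set0 root = [set: V].
    by apply/seteqP; split=> // x _; split=> //; apply: tree_le_root.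
  have := bd f [set: V] Xf; rewrite -{1}all_root => /(_ (branch_rooted root tr _ _)).
  have mU : measurable (tree_domain F [set: V]) by exact: measurable_domain.
  have sym0 : mes ([set: T] `+` tree_domain F [set: V]) = 0%E.
    rewrite -F_cover; congr (mes _); apply/seteqP; split=> t /=; last by left.
    by case=> -[].
  have Pf : P (Phat f) by apply: (lin_cont_op_in lin); exact: XY.
  rewrite (lp_set_ae hX mT mU sym0 Xf) (lp_set_ae hY mT mU sym0) //.
  by apply: (lp_inB hY) => //; [exact: XY|exact: PY].
- apply: le_trans (sc_count sc); apply: ler_wpM2l; first exact: expR_ge0.
  apply: ler_powR; first by rewrite ler1n.
  rewrite kapE; have := kap'E; rewrite -/r2; lra.
Qed.

End setting.
End scale.

(** * Asymptotic comparisons *)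

Section asymptotics.
Context {R : realType}.

Lemma ln2_gt0 : 0 < ln 2 :> R. Proof. by rewrite ln_gt0 // ltr1n. Qed.

Lemma powR_log2 (x : R) : 0 < x -> 2 `^ log2 x = x.
Proof.
move=> x0; rewrite /powR pnatr_eq0 /= /log2 divfK ?lnK //.
by rewrite gt_eqF // ln2_gt0.
Qed.

Lemma log2_powR (x : R) : log2 (2 `^ x) = x.
Proof. by rewrite /log2 ln_powR mulfK // gt_eqF // ln2_gt0. Qed.

Lemma ler_log2 (x y : R) : 0 < x -> x <= y -> log2 x <= log2 y.
Proof.
move=> x0 xy; rewrite /log2 ler_pM2r ?invr_gt0 ?ln2_gt0 // ler_ln ?posrE //.
exact: lt_le_trans xy.
Qed.

Lemma log2_lt (x : R) : 0 < x -> log2 x < x / ln 2.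
Proof.
by move=> x0; rewrite /log2 ltr_pM2r ?invr_gt0 ?ln2_gt0 // ln_sublinear.
Qed.

Lemma near_natr_ge (C : R) : \forall n \near \oo, C <= n%:R.
Proof.
by near=> n; near: n; exact: nbhs_infty_ger.
Unshelve. all: by end_near. Qed.

Lemma near_powR_ge (C s : R) : 0 < s -> \forall n \near \oo, C <= n%:R `^ s.
Proof.
move=> s0; near=> n.
have H : (Num.max C 1) `^ s^-1 <= n%:R by near: n; exact: near_natr_ge.
have C1 : 0 <= Num.max C 1 by rewrite le_max ler01 orbT.
apply: (@le_trans _ _ (Num.max C 1)); first by rewrite le_max lexx.
have -> : Num.max C 1 = (Num.max C 1 `^ s^-1) `^ s.
  by rewrite -powRrM mulVf ?gt_eqF // powRr1.
by apply: (ge0_ler_powR (ltW s0)) H; rewrite nnegrE ?powR_ge0.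
Unshelve. all: by end_near. Qed.

Lemma near_log2_ge (C : R) : \forall n \near \oo, C <= log2 n%:R.
Proof.
near=> n.
rewrite -[leLHS]log2_powR; apply: ler_log2; first exact: powR_gt0.
by near: n; exact: near_natr_ge.
Unshelve. all: by end_near. Qed.

(** [log2 y] is less than a multiple of [y], here with [y = n `^ (s / 2)]. *)
Lemma near_log2_le (s : R) : 0 < s -> \forall n \near \oo, log2 n%:R + 1 <= n%:R `^ s.
Proof.
move=> s0; near=> n.
have n0 : 0 < n%:R :> R.
  by apply: lt_le_trans ltr01 _; near: n; exact: near_natr_ge.
have ns0 : 0 < n%:R `^ (s / 2) :> R by exact: powR_gt0.
have -> : log2 n%:R = log2 (n%:R `^ (s / 2)) * (2 / s) :> R.
  by rewrite /log2 ln_powR; field; rewrite !gt_eqF // ln2_gt0.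
have l2 := log2_lt ns0.
have c0 : 0 < 2 / s by rewrite divr_gt0.
set y := n%:R `^ (s / 2) in ns0 l2 *.
have -> : n%:R `^ s = y * y :> R.
  by rewrite /y -powRD -?splitr // (gt_eqF n0) implybT.
have yC : 2 / s / ln 2 + 1 <= y by rewrite /y; near: n; apply: near_powR_ge; rewrite divr_gt0.
have y1 : 1 <= y by rewrite /y; near: n; apply: near_powR_ge; rewrite divr_gt0.
apply: (@le_trans _ _ (y / ln 2 * (2 / s) + y)).
  by apply: lerD => //; rewrite ler_pM2r // ltW.
have -> : y / ln 2 * (2 / s) + y = y * (2 / s / ln 2 + 1) by ring.
by rewrite ler_pM2l.
Unshelve. all: by end_near. Qed.

(** The factor [psi (2 ^+ (2 ^ t))] grows slower than any power of
    [2 ^+ (2 ^ t)], so that it is absorbed by an increase of [gamma] by one. *)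
Lemma level_count_le (gamma c3 : R) (psi : R -> R) : 0 <= c3 -> slowly_varying psi ->
  exists2 C1, 1 <= C1 & forall t,
   c3 * (2 `^ (gamma * 2 ^+ t) * psi (2 ^+ (2 ^ t)%N)) <= C1 * 2 `^ ((gamma + 1) * 2 ^+ t).
Proof.
move=> c30 hpsi; have psi0 := slowly_varying_gt0 hpsi.
have [X0 X1 pot] := slowly_varying_potter hpsi ltr01.
have y1 t : 1 <= 2 ^+ (2 ^ t)%N :> R by rewrite exprn_ege1 // ler1n.
have y0 t : 0 < 2 ^+ (2 ^ t)%N :> R by apply: lt_le_trans (y1 t).
pose B := psi X0 + \sum_(t < (Num.truncn X0).+1) psi (2 ^+ (2 ^ t)%N).
have pX : 0 < psi X0 by apply: psi0; exact: lt_le_trans X1.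
have sum0 : 0 <= \sum_(t < (Num.truncn X0).+1) psi (2 ^+ (2 ^ t)%N).
  by apply: sumr_ge0 => t _; apply/ltW/psi0.
have B0 : 0 < B by rewrite ltr_wpDr.
have psiB t : psi (2 ^+ (2 ^ t)%N) <= B * 2 ^+ (2 ^ t)%N.
  have [yX|yX] := leP X0 (2 ^+ (2 ^ t)%N).
    have [h _] := pot _ _ (lexx _) yX; apply: le_trans h _.
    apply: ler_pM => //; [exact: ltW|exact: powR_ge0|by rewrite lerDl|].
    have X00 : 0 < X0 by apply: lt_le_trans X1.
    rewrite powRr1 ?divr_ge0 ?(ltW (y0 _)) ?(ltW X00) //.
    by rewrite ler_pdivrMr // ler_peMr // ltW.
  apply: (@le_trans _ _ B); last by rewrite ler_peMr // ltW.
  have tX : (t < (Num.truncn X0).+1)%N.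
    rewrite ltnS truncn_ge_nat; last exact: le_trans X1.
    apply: le_trans (ltW yX); rewrite -natrX ler_nat.
    by apply: (@leq_trans (2 ^ t)); apply: ltnW; apply: ltn_expl.
  rewrite /B (bigD1 (Ordinal tX)) //= addrCA lerDl addr_ge0 //; first exact: ltW.
  by apply: sumr_ge0 => k _; apply/ltW/psi0.
exists (c3 * B + 1); first by rewrite lerDr mulr_ge0 // ltW.
move=> t; have -> : (gamma + 1) * 2 ^+ t = gamma * 2 ^+ t + 2 ^+ t by ring.
rewrite powRD ?pnatr_eq0 ?implybT //.
have -> : 2 `^ (2 ^+ t) = 2 ^+ (2 ^ t)%N :> R by rewrite -natrX powR_mulrn.
set z := 2 `^ (gamma * _); set y := 2 ^+ (2 ^ t)%N.
have z0 : 0 < z by exact: powR_gt0.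
rewrite mulrCA [leRHS]mulrCA ler_pM2l //.
have h := psiB t; apply: (@le_trans _ _ (c3 * (B * y))); first exact: ler_wpM2l.
by rewrite mulrA ler_wpM2r ?lerDl // ltW // y0.
Qed.

End asymptotics.

(** * Choice of the parameters *)

Section choice.
Context {R : realType}.
Variables (p q : R) (r0 : nat) (delta c1 c2 : R).
Hypotheses (p1 : 1 < p) (pq : p < q) (delta0 : 0 < delta) (c11 : 1 <= c1)
  (c21 : 1 <= c2).

Let th := p^-1 - q^-1.
Let r2 : R := #|{: 'I_r0 * bool}|%:R.

(** The number of scales is about [scale_rate * log2 n], the number of atoms at a
    vertex is at most [n `^ code_exponent], and [level_cost g] is the factor [a] in the
    prices of the atoms. *)
Definition scale_rate : R := (th + delta) / delta.
Definition code_exponent : R := 2 * scale_rate + 4 + th + delta.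
Definition level_cost (g : R) : R := code_exponent * (4 * g) + g + 1.

Let th0 : 0 < th.
Proof. by rewrite subr_gt0 ltf_pV2 ?posrE //; have := p1; have := pq; lra. Qed.

Lemma level_cost_ge1 (g : R) : 1 <= g -> 1 <= level_cost g.
Proof.
move=> g1; have d0 := delta0; have h0 := th0.
have ab0 : 0 < scale_rate by rewrite divr_gt0 // addr_gt0.
rewrite /level_cost /code_exponent.
have : 0 <= (2 * scale_rate + 4 + th + delta) * (4 * g) by apply: mulr_ge0; lra.
lra.
Qed.

End choice.

Lemma dyadic_between {R : realType} (y : R) : 1 <= y -> exists t : nat,
  [/\ 2 ^+ t <= y, y <= 2 ^+ t.+1 & forall k : nat, 2 ^+ k <= y -> (k <= t)%N].
Proof.
move=> y1; have y0 : 0 <= y by apply: le_trans y1.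
have y0' : (0 < Num.truncn y)%N by rewrite truncn_ge_nat.
have /andP[h1 h2] := trunc_log_bounds (isT : (1 < 2)%N) y0'.
exists (trunc_log 2 (Num.truncn y)); split.
- by rewrite -natrX -truncn_ge_nat.
- by apply: le_trans (ltW (truncnS_gt _)) _; rewrite -natrX ler_nat.
- by move=> k ky; apply: trunc_log_max => //; rewrite truncn_ge_nat // natrX.
Qed.

Lemma natr_above {R : realType} (y : R) : 0 <= y -> exists k : nat, y < k.+1%:R /\ k.+1%:R <= y + 1.
Proof.
move=> y0; exists (Num.truncn y); rewrite truncnS_gt; split=> //.
by rewrite -natr1 lerD2r truncn_le.
Qed.

(** Here [2 ^ t1] is of order [log2 n], so that the levels up to [t1] have at most
    [n `^ (1 / 4)] vertices up to logarithms, while [2 ^ te] is of order [n].  On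
    the levels in between the error is [E n] by assumption; beyond them it is
    that of level [te] by monotony of the weights.  All other errors are smaller
    by a power of [n], and [E n] loses at most the power [delta / 8]. *)
Lemma scale_choice {R : realType} (p q : R) (r0 : nat) (delta c1 c2 : R)
    (g c3 C1 Wm : R) (wl nu E : nat -> R) (t0 : nat) :
  let th := p^-1 - q^-1 in
  1 < p -> p < q -> 0 < delta -> 1 <= c1 -> 1 <= c2 ->
  1 <= g -> 1 <= c3 -> 0 <= C1 -> 0 <= Wm -> (forall t, 0 < wl t) ->
  (forall t t', (t <= t')%N -> wl t' <= c3 * wl t) ->
  (forall t, nu t <= C1 * 2 `^ (g * 2 ^+ t)) ->
  (\forall n \near \oo, n%:R `^ (- th - delta / 8) <= E n) ->
  (\forall n \near \oo, forall t, log2 n%:R / (4 * g) <= 2 ^+ t ->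
     2 ^+ t <= n%:R :> R -> wl t * (2 ^+ t / n%:R) `^ th <= E n) ->
  \forall n \near \oo, exists t1 te M N1 Kw Lb, (t0 <= t1)%N /\
    scale_conditions p q r0 delta c1 c2 wl nu Wm n t1 te M N1 Kw Lb
      (level_cost p q delta g) (c3 * 2 `^ th * E n).
Proof.
move=> th p1 pq d0 hc1 hc2 g1 c31 C10 Wm0 wl0 wl_mono nuC E_ge E_wl.
have h0 : 0 < th by rewrite subr_gt0 ltf_pV2 ?posrE //; move: p1 pq; clear; lra.
have g0 : 0 < g by apply: lt_le_trans g1.
set a := level_cost p q delta g; have a1 : 1 <= a by exact: level_cost_ge1.
have Ab0 : 0 < scale_rate p q delta by rewrite divr_gt0 // addr_gt0.
set Ab := scale_rate p q delta in Ab0.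
pose r2 : R := #|{: 'I_r0 * bool}|%:R.
have r20 : 0 <= r2 by exact: ler0n.
pose D : R := 1 + (1 + r2) * (2 * c2 + c1).
near=> n.
have x1 : 1 <= n%:R :> R by near: n; exact: near_natr_ge.
have L_big : 4 * g * 2 ^+ t0 <= log2 n%:R by near: n; exact: near_log2_ge.
have E_low : n%:R `^ (- th - delta / 8) <= E n by near: n.
have E_mid : forall t, log2 n%:R / (4 * g) <= 2 ^+ t ->
     2 ^+ t <= n%:R :> R -> wl t * (2 ^+ t / n%:R) `^ th <= E n by near: n.
have Wm_small : Wm <= n%:R `^ (delta / 16).
  by near: n; apply: near_powR_ge; rewrite divr_gt0.
have L_small : log2 n%:R + 1 <= n%:R `^ (delta / 16 / th).
  by near: n; apply: near_log2_le; rewrite !divr_gt0.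
have L_eighth : log2 n%:R + 1 <= n%:R `^ (8^-1) :> R.
  by near: n; apply: near_log2_le; rewrite invr_gt0.
have L_g : log2 n%:R + 1 <= n%:R `^ ((8 * g)^-1).
  by near: n; apply: near_log2_le; rewrite invr_gt0 mulr_gt0.
have C1_g : C1 <= n%:R `^ ((8 * g)^-1).
  by near: n; apply: near_powR_ge; rewrite invr_gt0 mulr_gt0.
have x_quarter : 8 * (C1 * a * D) <= n%:R `^ (4^-1).
  by near: n; apply: near_powR_ge; rewrite invr_gt0.
have x_Kw : 1 + 4 * c2 <= n%:R `^ (3 / 4).
  by near: n; apply: near_powR_ge; rewrite divr_gt0.
have x_Lb : 1 + 3 ^+ r0 * (Wm + Wm) <= n%:R `^ (7 * delta / 8).
  by near: n; apply: near_powR_ge; rewrite divr_gt0 // mulr_gt0.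
have x_M : Ab + 1 <= n%:R `^ 2^-1.
  by near: n; apply: near_powR_ge; rewrite invr_gt0.
have L_half : log2 n%:R + 1 <= n%:R `^ (2^-1) :> R.
  by near: n; apply: near_log2_le; rewrite invr_gt0.
have x_count : 1 + r2 * (2 + c1) <= n%:R by near: n; exact: near_natr_ge.
have x_expR : 2 * (2 / ln 2 + 1) <= n%:R :> R by near: n; exact: near_natr_ge.
have log_ge k : 2 ^+ k <= n%:R :> R -> k%:R <= log2 n%:R :> R.
  move=> kn; rewrite -[leLHS]log2_powR; apply: ler_log2; rewrite ?powR_gt0 //.
  by rewrite powR_mulrn.
have [x Ex] : exists x : R, x = n%:R by exists n%:R.
have [L EL] : exists L, L = log2 x by exists (log2 x).
rewrite -Ex -EL in x1 L_big E_low E_mid Wm_small L_small L_eighth L_g C1_g x_quarter x_Kw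
  x_Lb x_M L_half x_count x_expR log_ge.
have x0 : 0 < x by apply: lt_le_trans ltr01 _.
have n0 : (0 < n)%N by rewrite -(ltr_nat R) -Ex.
have np0 s : 0 < x `^ s by exact: powR_gt0.
have npD s t : x `^ (s + t) = x `^ s * x `^ t by rewrite powRD // (gt_eqF x0) implybT.
have np_le s t : s <= t -> x `^ s <= x `^ t by move=> st; apply: ler_powR.
have np_ge1 s : 0 <= s -> 1 <= x `^ s by move=> s0; rewrite -[leLHS](powRr0 x); apply: np_le.
have np1 : x `^ 1 = x by rewrite powRr1 // ltW.
have np_lex s : s <= 1 -> x `^ s <= x by move=> s1; rewrite -[leRHS]np1; apply: np_le.
have xL : 2 `^ L = x by rewrite EL; exact: powR_log2.
have xLs s : 2 `^ (L * s) = x `^ s by rewrite powRrM xL.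
have L_4g : 4 * g <= L.
  by apply: le_trans L_big; rewrite ler_peMr ?exprn_ege1 ?ler1n // mulr_ge0 // ltW.
have L4 : 4 <= L by move: L_4g g1; clear; lra.
have L0 : 0 < L by apply: lt_le_trans L4.
have E0 : 0 < E n by apply: lt_le_trans E_low.
have twoth : 1 <= 2 `^ th :> R by rewrite -[leLHS](powRr0 2); apply: ler_powR; [rewrite ler1n|exact: ltW].
have E_le : E n <= c3 * 2 `^ th * E n.
  by rewrite ler_peMl ?(ltW E0) // mulr_ege1.
have p2 k : 0 < 2 ^+ k :> R by rewrite exprn_gt0.
have y1 : 1 <= L / (4 * g) by rewrite ler_pdivlMr ?mul1r // mulr_gt0.
have [t1 [t1y yt1 t1_max]] := dyadic_between y1.
have t0t1 : (t0 <= t1)%N by apply: t1_max; rewrite ler_pdivlMr ?mulr_gt0 // mulrC.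
have t1L : g * 2 ^+ t1 <= L / 4.
  by move: t1y; rewrite ler_pdivlMr ?mulr_gt0 //; clear; lra.
have t1SL : 2 ^+ t1.+1 <= L.
  have : 2 ^+ t1 <= g * 2 ^+ t1 by rewrite ler_peMl // ltW.
  by move: t1L L0; rewrite exprS; clear; lra.
have [te [tex xte te_max]] := dyadic_between x1.
have Lx : L + 1 <= x.
  by apply: le_trans L_half (np_lex _ _); rewrite invf_le1 // ler1n.
have t1te : (t1 <= te)%N.
  by apply: te_max; move: (p2 t1) t1SL Lx; rewrite exprS; clear; lra.
have teL : te%:R <= L by exact: log_ge.
have [M' [M_gt M_le]] : exists k : nat, Ab * L < k.+1%:R /\ k.+1%:R <= Ab * L + 1.
  by apply: natr_above; rewrite mulr_ge0 // ltW.
have [N' [N_gt N_le]] := natr_above (ltW (np0 4^-1)).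
have N_le2 : N'.+1%:R <= 2 * x `^ 4^-1.
  have h : x `^ 0 <= x `^ 4^-1 by apply: np_le; rewrite invr_ge0.
  by move: h N_le; rewrite powRr0; clear; lra.
have [K' [K_gt K_le]] : exists k : nat, c2 * (2 ^ M'.+1 * N'.+1)%N%:R < k.+1%:R /\
    k.+1%:R <= c2 * (2 ^ M'.+1 * N'.+1)%N%:R + 1.
  by apply: natr_above; rewrite mulr_ge0 //; exact: le_trans hc2.
set eps := c3 * 2 `^ th * E n in E_le *.
have eps0 : 0 < eps by apply: lt_le_trans E_le.
have [L' [L'_gt L'_le]] : exists k : nat, 3 ^+ r0 * (Wm + Wm) / (eps / x) < k.+1%:R /\
    k.+1%:R <= 3 ^+ r0 * (Wm + Wm) / (eps / x) + 1.
  apply: natr_above; apply: divr_ge0; last exact/ltW/divr_gt0.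
  by apply: mulr_ge0; [exact: exprn_ge0|exact: addr_ge0].
have te_low : L / (4 * g) <= 2 ^+ te.
  apply: (@le_trans _ _ (x / 2)); last by rewrite ler_pdivrMr // mulrC -exprS.
  apply: ler_pM; rewrite ?invr_ge0 ?(ltW L0) ?mulr_ge0 ?(ltW g0) //.
    by move: Lx; clear; lra.
  by rewrite lef_pV2 ?posrE ?mulr_gt0 //; move: g1; clear; lra.
have mid t : (t1 < t)%N -> (t <= te)%N -> wl t * (2 ^+ t / x) `^ th <= E n.
  move=> t1t tte; apply: E_mid.
    by apply: le_trans yt1 _; apply: ler_weXn2l; rewrite ?ler1n.
  by apply: le_trans tex; apply: ler_weXn2l; rewrite ?ler1n.
have tail t : (te < t)%N -> wl t <= eps.
  move=> tet; apply: le_trans (wl_mono te t (ltnW tet)) _.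
  rewrite /eps -mulrA ler_wpM2l //; first exact: le_trans c31.
  have h := E_mid te te_low tex.
  set z := (2 ^+ te / x) `^ th in h.
  have z1 : 1 <= 2 `^ th * z.
    rewrite /z -powRM //; last by rewrite divr_ge0 ?exprn_ge0 // ltW.
    apply: (@le_trans _ _ (1 `^ th)); first by rewrite powR1.
    apply: ge0_ler_powR; rewrite ?nnegrE //; first exact: ltW.
      by rewrite !mulr_ge0 ?exprn_ge0 ?invr_ge0 // ltW.
    by rewrite mulrA -exprS ler_pdivlMr // mul1r.
  apply: (@le_trans _ _ (2 `^ th * (wl te * z))).
    rewrite mulrCA; rewrite ler_peMr //; exact: ltW.
  by apply: ler_wpM2l => //; exact: powR_ge0.
have low : Wm * N'.+1%:R `^ (- delta) * (2 ^+ t1.+1 / x) `^ th <= eps.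
  apply: le_trans E_le; apply: le_trans E_low.
  have -> : - th - delta / 8 = delta / 16 + - (4^-1 * delta) + (delta / 16 - th) by field.
  rewrite !npD; apply: ler_pM; rewrite ?powR_ge0 //.
    by apply: mulr_ge0 => //; exact: powR_ge0.
    apply: ler_pM; rewrite ?powR_ge0 //.
    rewrite !powRN lef_pV2 ?posrE ?powR_gt0 // powRrM.
    by apply: ge0_ler_powR; rewrite ?nnegrE ?powR_ge0 //; exact: ltW.
  apply: (@le_trans _ _ ((L / x) `^ th)).
    apply: ge0_ler_powR; rewrite ?nnegrE ?divr_ge0 ?exprn_ge0 //; try exact: ltW.
    by rewrite ler_pM2r ?invr_gt0.
  rewrite powRM ?invr_ge0; try exact: ltW.
  rewrite -powR_inv1 ?(ltW x0) // -powRrM mulN1r ler_pM2r //.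
  have -> : delta / 16 = delta / 16 / th * th by field; rewrite gt_eqF.
  rewrite powRrM; apply: ge0_ler_powR; rewrite ?nnegrE ?powR_ge0 //; try exact: ltW.
  by move: L_small; clear; lra.
have small : 2 `^ (- (delta * M'.+1%:R)) * Wm <= eps.
  apply: le_trans E_le; apply: le_trans E_low.
  apply: (@le_trans _ _ (x `^ (- (th + delta)) * x `^ (delta / 16))).
    apply: ler_pM; rewrite ?powR_ge0 // -xLs; apply: ler_powR; first by rewrite ler1n.
    have -> : L * - (th + delta) = - (delta * (Ab * L)).
      by rewrite /Ab /scale_rate -/th; field; rewrite gt_eqF.
    by rewrite lerN2 ler_pM2l // ltW.
  by rewrite -npD; apply: np_le; move: (d0); clear; lra.
have K_small : K'.+1%:R <= x `^ (Ab + 1).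
  have K4 : c2 * (2 ^ M'.+1 * N'.+1)%N%:R <= 4 * c2 * x `^ (Ab + 4^-1).
    rewrite natrM natrX -powR_mulrn // npD.
    have h : 2 `^ M'.+1%:R <= 2 * x `^ Ab.
      apply: (@le_trans _ _ (2 `^ (L * Ab + 1))).
        by apply: ler_powR; rewrite ?ler1n // mulrC.
      by rewrite powRD ?pnatr_eq0 ?implybT // xLs powRr1 // mulrC.
    have -> : 4 * c2 * (x `^ Ab * x `^ 4^-1) = c2 * (2 * x `^ Ab * (2 * x `^ 4^-1)) by ring.
    apply: ler_wpM2l; first exact: le_trans hc2.
    by apply: ler_pM => //; exact: powR_ge0.
  have h1 : 1 <= x `^ (Ab + 4^-1).
    by apply: np_ge1; rewrite addr_ge0 ?invr_ge0 // ltW.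
  have -> : Ab + 1 = 3 / 4 + (Ab + 4^-1) by field.
  rewrite npD; apply: (@le_trans _ _ ((1 + 4 * c2) * x `^ (Ab + 4^-1))).
    by move: K_le K4 h1; clear; lra.
  by rewrite ler_pM2r.
have L'_small : L'.+1%:R <= x `^ (1 + th + delta).
  set A := 3 ^+ r0 * (Wm + Wm) in x_Lb L'_le *.
  have A0 : 0 <= A by apply: mulr_ge0; [exact: exprn_ge0|exact: addr_ge0].
  have h : A / (eps / x) <= A * x `^ (1 + th + delta / 8).
    apply: ler_wpM2l => //; rewrite invf_div ler_pdivrMr //.
    apply: (@le_trans _ _ (x `^ (1 + th + delta / 8) * x `^ (- th - delta / 8))).
      rewrite -npD; have -> : 1 + th + delta / 8 + (- th - delta / 8) = 1 by ring.
      by rewrite np1.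
    by rewrite ler_pM2l //; apply: le_trans E_low E_le.
  have h1 : 1 <= x `^ (1 + th + delta / 8).
    apply: np_ge1; move: (d0) (h0); clear; lra.
  have -> : 1 + th + delta = 7 * delta / 8 + (1 + th + delta / 8) by field.
  rewrite npD; apply: (@le_trans _ _ ((1 + A) * x `^ (1 + th + delta / 8))).
    by move: L'_le h h1; clear; lra.
  by rewrite ler_pM2r.
have M_small : M'.+1%:R <= x.
  have -> : x = x `^ 2^-1 * x `^ 2^-1.
    by rewrite -npD -{1}np1; congr (_ `^ _); field.
  have hL : Ab * L + 1 <= (Ab + 1) * (L + 1) by move: Ab0 L0; clear; lra.
  apply: le_trans (le_trans M_le hL) _; apply: ler_pM => //.
    by move: Ab0; clear; lra.
  by move: L0; clear; lra.
have count_small : (1 + K'.+1 * #|{: 'I_r0 * bool}| * L'.+1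
    + Num.truncn c1 * #|{: 'I_r0 * bool}| * L'.+1
    + M'.+1 * K'.+1 * K'.+1 * #|{: 'I_r0 * bool}|)%N%:R
    <= x `^ code_exponent p q delta.
  have count_natr (k l m c s : nat) : (1 + k * s * l + c * s * l + m * k * k * s)%N%:R =
      1 + k%:R * s%:R * l%:R + c%:R * s%:R * l%:R + m%:R * k%:R * k%:R * s%:R :> R.
    by rewrite !natrD !natrM.
  rewrite count_natr -/r2.
  have -> : code_exponent p q delta = 1 + (2 * Ab + 3 + th + delta).
    by rewrite /code_exponent -/Ab -/th; ring.
  set d := 2 * Ab + 3 + th + delta; rewrite npD np1.
  have KL : K'.+1%:R * L'.+1%:R <= x `^ d.
    apply: (@le_trans _ _ (x `^ (Ab + 1) * x `^ (1 + th + delta))); first exact: ler_pM.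
    by rewrite -npD; apply: np_le; rewrite /d; move: Ab0; clear; lra.
  have LL : L'.+1%:R <= x `^ d.
    apply: le_trans L'_small _; apply: np_le; rewrite /d; move: Ab0; clear; lra.
  have MKK : M'.+1%:R * K'.+1%:R * K'.+1%:R <= x `^ d.
    apply: (@le_trans _ _ (x `^ 1 * x `^ (Ab + 1) * x `^ (Ab + 1))).
      by rewrite np1; apply: ler_pM => //; rewrite ?mulr_ge0 //; apply: ler_pM.
    rewrite -!npD; apply: np_le; rewrite /d; move: (d0) (h0); clear; lra.
  have one : 1 <= x `^ d.
    apply: np_ge1; rewrite /d; move: Ab0 (d0) (h0); clear; lra.
  have tc : (Num.truncn c1)%:R <= c1 by rewrite truncn_le; exact: le_trans hc1.
  apply: (@le_trans _ _ ((1 + r2 * (2 + c1)) * x `^ d)); last by rewrite ler_pM2r.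
  have k1 : K'.+1%:R * r2 * L'.+1%:R <= r2 * x `^ d.
    by rewrite -mulrA mulrCA ler_wpM2l.
  have k2 : (Num.truncn c1)%:R * r2 * L'.+1%:R <= r2 * c1 * x `^ d.
    apply: ler_pM => //; first exact: mulr_ge0.
    by rewrite mulrC ler_wpM2l.
  have k3 : M'.+1%:R * K'.+1%:R * K'.+1%:R * r2 <= r2 * x `^ d.
    by rewrite mulrC ler_wpM2l.
  by move: k1 k2 k3 one; clear; lra.
have sum_kraft : \sum_(t < te.+1) nu t * 2 `^ (- (a * 2 ^+ maxn t t1.+1)) <=
    x `^ (- code_exponent p q delta).
  set d := code_exponent p q delta.
  have d00 : 0 <= d by rewrite /d /code_exponent -/Ab -/th; move: Ab0 (d0) (h0); clear; lra.
  have term t : nu t * 2 `^ (- (a * 2 ^+ maxn t t1.+1)) <=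
      C1 * (x `^ (- d) * x `^ (- (4 * g)^-1)).
    set La : R := 2 ^+ maxn t t1.+1.
    have La0 : 0 <= La by exact: exprn_ge0.
    have tLa : 2 ^+ t <= La by apply: ler_weXn2l; rewrite ?ler1n ?leq_maxl.
    have LLa : L / (4 * g) <= La.
      by apply: le_trans yt1 _; apply: ler_weXn2l; rewrite ?ler1n ?leq_maxr.
    apply: (@le_trans _ _ (C1 * 2 `^ (g * 2 ^+ t) * 2 `^ (- (a * La)))).
      by apply: ler_wpM2r => //; exact: powR_ge0.
    rewrite -mulrA ler_wpM2l // -npD -powRD ?pnatr_eq0 ?implybT // -xLs.
    apply: ler_powR; first by rewrite ler1n.
    have h1 : g * 2 ^+ t <= g * La by rewrite ler_pM2l.
    have h2 : d * L <= d * (4 * g * La).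
      by apply: ler_wpM2l => //; rewrite -ler_pdivrMl ?mulr_gt0 // mulrC.
    have -> : L * (- d - (4 * g)^-1) = - (d * L) - L / (4 * g) by ring.
    rewrite /a /level_cost -/d; move: h1 h2 LLa; clear; lra.
  apply: (@le_trans _ _ (\sum_(t < te.+1) C1 * (x `^ (- d) * x `^ (- (4 * g)^-1)))).
    by apply: ler_sum => t _; exact: term.
  rewrite sumr_const card_ord -[leLHS]mulr_natl.
  have -> : te.+1%:R * (C1 * (x `^ (- d) * x `^ (- (4 * g)^-1))) =
      x `^ (- d) * (te.+1%:R * C1 * x `^ (- (4 * g)^-1)) by ring.
  rewrite ler_piMr ?powR_ge0 // powRN ler_pdivrMr // mul1r.
  have -> : (4 * g)^-1 = (8 * g)^-1 + (8 * g)^-1 by field; rewrite gt_eqF.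
  rewrite npD; apply: ler_pM => //.
  by apply: le_trans L_g; rewrite -natr1 lerD2r.
have sum_budget : (\sum_(t < t1.+1) nu t) *
    (a * 2 ^+ t1.+1 * (1 + (1 + r2) * (c2 * N'.+1%:R + c1))) <= x / 8.
  have a0 : 0 <= a by exact: le_trans a1.
  have nu_le : \sum_(t < t1.+1) nu t <= (L + 1) * (C1 * x `^ 4^-1).
    apply: (@le_trans _ _ (\sum_(t < t1.+1) C1 * x `^ 4^-1)).
      apply: ler_sum => t _; apply: le_trans (nuC t) _; apply: ler_wpM2l => //.
      rewrite -xLs; apply: ler_powR; first by rewrite ler1n.
      apply: le_trans t1L; rewrite ler_pM2l //; apply: ler_weXn2l; rewrite ?ler1n //.
      by rewrite -ltnS.
    rewrite sumr_const card_ord -[leLHS]mulr_natl; apply: ler_wpM2r.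
      by apply: mulr_ge0 => //; exact: powR_ge0.
    by rewrite -natr1 lerD2r; apply: le_trans teL; rewrite ler_nat.
  have D_le : 1 + (1 + r2) * (c2 * N'.+1%:R + c1) <= D * x `^ 4^-1.
    have y1' : 1 <= x `^ 4^-1 by apply: np_ge1; rewrite invr_ge0.
    have h1 : c2 * N'.+1%:R <= c2 * (2 * x `^ 4^-1).
      by apply: ler_wpM2l => //; exact: le_trans hc2.
    have h2 : c1 <= c1 * x `^ 4^-1 by rewrite ler_peMr //; exact: le_trans hc1.
    have h3 : (1 + r2) * (c2 * N'.+1%:R + c1) <=
        (1 + r2) * ((2 * c2 + c1) * x `^ 4^-1).
      apply: ler_wpM2l; first by move: r20; clear; lra.
      by move: h1 h2; clear; lra.
    by rewrite /D; move: h3 y1'; clear; lra.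
  have D0 : 0 <= D.
    rewrite /D addr_ge0 // mulr_ge0 //; first by move: r20; clear; lra.
    by move: (hc1) (hc2); clear; lra.
  apply: (@le_trans _ _ ((L + 1) * (C1 * x `^ 4^-1) * (a * (L + 1) * (D * x `^ 4^-1)))).
    have loc0 : 0 <= 1 + (1 + r2) * (c2 * N'.+1%:R + c1).
      apply: addr_ge0 => //; apply: mulr_ge0; first by move: r20; clear; lra.
      by apply: addr_ge0; [apply: mulr_ge0 => //; exact: le_trans hc2|exact: le_trans hc1].
    have loc1 : 0 <= a * 2 ^+ t1.+1 by apply: mulr_ge0 => //; exact: ltW.
    apply: le_trans (ler_wpM2r _ nu_le) _; first exact: mulr_ge0.
    apply: ler_wpM2l.
      apply: mulr_ge0; last by apply: mulr_ge0 => //; exact: powR_ge0.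
      by move: L0; clear; lra.
    apply: ler_pM => //; apply: ler_wpM2l => //; apply: le_trans t1SL _.
    by rewrite lerDl.
  have -> : x / 8 = x `^ 8^-1 * x `^ 8^-1 * (x `^ 4^-1 * x `^ 4^-1) * (x `^ 4^-1 / 8).
    rewrite mulrA -!npD.
    have -> : 8^-1 + 8^-1 + (4^-1 + 4^-1) + 4^-1 = 1 :> R by field.
    by rewrite np1.
  have -> : (L + 1) * (C1 * x `^ 4^-1) * (a * (L + 1) * (D * x `^ 4^-1)) =
     (L + 1) * (L + 1) * (x `^ 4^-1 * x `^ 4^-1) * (C1 * a * D) by ring.
  have L10 : 0 <= L + 1 by move: L0; clear; lra.
  apply: ler_pM; rewrite ?mulr_ge0 ?powR_ge0 //; last first.
    by move: x_quarter; clear; lra.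
  by apply: ler_wpM2r; rewrite ?mulr_ge0 ?powR_ge0 //; apply: ler_pM.
have count : expR 2 * 2 `^ (3 * (x / 8)) <= (2 ^ n.-1)%N%:R.
  have -> : expR 2 = 2 `^ (2 / ln 2) :> R.
    by rewrite /powR pnatr_eq0 /= divfK // gt_eqF // ln2_gt0.
  rewrite natrX -powR_mulrn // -powRD ?pnatr_eq0 ?implybT //; apply: ler_powR.
    by rewrite ler1n.
  have -> : n.-1%:R = x - 1 by rewrite Ex -[in RHS](prednK n0) -natr1 addrK.
  by move: x_expR x0; clear; lra.
exists t1, te, M'.+1, N'.+1, K'.+1, L'.+1; split=> //.
apply: ScaleConditions; rewrite -?Ex //.
- by move=> t t1t tte; apply: le_trans (mid t t1t tte) E_le.
- exact: ltW.
- apply: (@le_trans _ _ (x `^ code_exponent p q delta * x `^ (- code_exponent p q delta))).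
    apply: le_trans (ler_wpM2l _ sum_kraft) _; first exact: ler0n.
    by apply: ler_wpM2r => //; exact: powR_ge0.
  by rewrite -npD subrr powRr0.
Unshelve. all: by end_near. Qed.

(** * The two rates *)

Section targets.
Context {R : realType}.
Variables (u : R -> R) (lambda th g c3 sigma : R).
Hypotheses (hu : slowly_varying u) (g1 : 1 <= g) (c31 : 1 <= c3) (sigma0 : 0 < sigma).

Let wl t : R := c3 * (2 `^ (- lambda * t%:R) * u (2 ^+ t)).

Let g40 : 0 < 4 * g. Proof. by have := g1; lra. Qed.
Let c30 : 0 < c3. Proof. exact: lt_le_trans c31. Qed.
Let u0 y : 0 < y -> 0 < u y. Proof. exact: (slowly_varying_gt0 hu). Qed.

Lemma level_weight (y x : R) t : y = 2 ^+ t -> 0 < x ->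
  wl t * (y / x) `^ th = c3 * (y `^ (th - lambda) * u y) * x `^ (- th).
Proof.
move=> yE x0; have y0 : 0 < y by rewrite yE exprn_gt0.
rewrite /wl -yE (_ : 2 `^ (- lambda * t%:R) = y `^ (- lambda)); last first.
  by rewrite mulrC powRrM powR_mulrn // yE.
rewrite powR_div // -powRN.
by rewrite powRD ?(gt_eqF y0) ?implybT //; ring.
Qed.

(** [y `^ (th - lambda) * u y] almost decreases, and so is largest at the bottom of
    the range, for [y] of order [log2 n]. *)
Lemma target_fast : th < lambda -> exists2 K, 0 < K &
  let E (n : nat) := K * (n%:R `^ (- th) * log2 n%:R `^ (th - lambda) * u (log2 n%:R)) in
  (\forall n \near \oo, n%:R `^ (- th - sigma) <= E n) /\
  (\forall n \near \oo, forall t, log2 n%:R / (4 * g) <= 2 ^+ t ->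
     2 ^+ t <= n%:R :> R -> wl t * (2 ^+ t / n%:R) `^ th <= E n).
Proof.
move=> thl; pose b := lambda - th; have b0 : 0 < b by rewrite subr_gt0.
have [X0 X1 pot] := slowly_varying_potter hu b0.
have X00 : 0 < X0 by apply: lt_le_trans X1.
exists (c3 * (4 * g) `^ b * (4 * g) `^ b); first by rewrite !mulr_gt0 ?powR_gt0.
move=> E; split.
  near=> n.
  have x1 : 1 <= n%:R :> R by near: n; exact: near_natr_ge.
  have x0 : 0 < n%:R :> R by apply: lt_le_trans x1.
  have LX : X0 <= log2 n%:R by near: n; exact: near_log2_ge.
  have L0 : 0 < log2 n%:R :> R by apply: lt_le_trans LX.
  set K := _ * _ in E *; have K0 : 0 < K by rewrite /K !mulr_gt0 ?powR_gt0.
  have big : (K * (u X0 * X0 `^ b))^-1 <= n%:R `^ (sigma / 2).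
    by near: n; apply: near_powR_ge; rewrite divr_gt0.
  have Lsmall : log2 n%:R <= n%:R `^ (sigma / (4 * b)).
    near: n; near=> m; apply: (@le_trans _ _ (log2 m%:R + 1)); first by rewrite lerDl.
    by near: m; apply: near_log2_le; rewrite divr_gt0 // mulr_gt0.
  set x : R := n%:R in x1 x0 LX L0 big Lsmall *.
  set L := log2 x in LX L0 Lsmall *.
  have uX := u0 X00.
  have [_ h] := pot _ _ (lexx X0) LX.
  have P0 : 0 < L `^ b by exact: powR_gt0.
  have Q0 : 0 < X0 `^ b by exact: powR_gt0.
  have uP : u X0 * X0 `^ b <= u L * L `^ b.
    by move: h; rewrite powR_div // mulrA ler_pdivlMr.
  have PP : L `^ b * L `^ b <= x `^ (sigma / 2).
    have h1 : L `^ b <= x `^ (sigma / 4).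
      have -> : sigma / 4 = sigma / (4 * b) * b by field; rewrite gt_eqF.
      by rewrite powRrM; apply: ge0_ler_powR; rewrite ?nnegrE ?powR_ge0 // ltW.
    have -> : sigma / 2 = sigma / 4 + sigma / 4 by field.
    rewrite (@powRD _ x) ?(gt_eqF x0) ?implybT //; apply: ler_pM => //; exact: ltW.
  have KQ : x `^ (- (sigma / 2)) <= K * (u X0 * X0 `^ b).
    have KQ0 : 0 < K * (u X0 * X0 `^ b) by apply: mulr_gt0 => //; exact: mulr_gt0.
    by rewrite powRN -[leRHS]invrK lef_pV2 ?posrE ?invr_gt0 ?powR_gt0.
  rewrite /E -/x -/L (@powRD _ x) ?(gt_eqF x0) ?implybT //.
  rewrite (_ : K * _ = x `^ (- th) * (K * (L `^ (th - lambda) * u L))); last by ring.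
  rewrite ler_pM2l ?powR_gt0 //.
  have -> : th - lambda = - b by rewrite /b opprB.
  rewrite (powRN L) -(ler_pM2r P0) -(ler_pM2r P0).
  have -> : K * ((L `^ b)^-1 * u L) * L `^ b * L `^ b = K * (u L * L `^ b).
    by field; rewrite gt_eqF.
  apply: le_trans (le_trans KQ _); last by rewrite ler_pM2l.
  rewrite -mulrA; apply: le_trans (ler_wpM2l (powR_ge0 _ _) PP) _.
  by rewrite -(@powRD _ x) ?(gt_eqF x0) ?implybT //; apply: ler_powR => //; have := sigma0; lra.
near=> n => t ty tn.
have x1 : 1 <= n%:R :> R by near: n; exact: near_natr_ge.
have x0 : 0 < n%:R :> R by apply: lt_le_trans x1.
have LX : X0 * (4 * g) <= log2 n%:R by near: n; exact: near_log2_ge.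
set x : R := n%:R in x1 x0 LX tn ty *.
set L := log2 x in LX ty *.
have L0 : 0 < L by apply: lt_le_trans LX; exact: mulr_gt0.
set z := L / (4 * g) in ty *.
have Xz : X0 <= z by rewrite /z ler_pdivlMr.
have z0 : 0 < z by rewrite divr_gt0.
have zL : z <= L.
  by rewrite /z ler_pdivrMr // ler_peMr ?(ltW L0) //; have := g1; lra.
pose y : R := 2 ^+ t; have y0 : 0 < y by exact: exprn_gt0.
rewrite (@level_weight y) // -/y /E.
have [h1 _] := pot _ _ Xz ty; have [_ h2] := pot _ _ Xz zL.
have -> : th - lambda = - b by rewrite /b opprB.
have Lz : L / z = 4 * g by rewrite /z invf_div mulrCA divff ?mulr1 // gt_eqF.
rewrite Lz in h2.
have h3 : y `^ (- b) * u y <= z `^ (- b) * u z.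
  move: h1; rewrite -/y powR_div // => h1.
  rewrite !powRN mulrC ler_pdivrMr ?powR_gt0 //; apply: le_trans h1 _.
  by rewrite le_eqVlt; apply/orP; left; apply/eqP; ring.
have h4 : z `^ (- b) = L `^ (- b) * (4 * g) `^ b.
  by rewrite !powRN /z powR_div // invf_div mulrC.
have h5 : z `^ (- b) * u z <= L `^ (- b) * (4 * g) `^ b * (u L * (4 * g) `^ b).
  by rewrite h4 ler_wpM2l // mulr_ge0 ?powR_ge0.
apply: (@le_trans _ _ (c3 * (L `^ (- b) * (4 * g) `^ b * (u L * (4 * g) `^ b)) * x `^ (- th))).
  by rewrite ler_pM2r ?powR_gt0 // ler_pM2l //; apply: le_trans h5.
by rewrite le_eqVlt; apply/orP; left; apply/eqP; ring.
Unshelve. all: by end_near. Qed.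

(** [y `^ (th - lambda) * u y] almost increases, and so is largest for [y = n]. *)
Lemma target_slow : lambda < th ->
  let E (n : nat) := c3 * (n%:R `^ (- lambda) * u n%:R) in
  (\forall n \near \oo, n%:R `^ (- th - sigma) <= E n) /\
  (\forall n \near \oo, forall t, log2 n%:R / (4 * g) <= 2 ^+ t ->
     2 ^+ t <= n%:R :> R -> wl t * (2 ^+ t / n%:R) `^ th <= E n).
Proof.
move=> thl; pose b := th - lambda; have b0 : 0 < b by rewrite subr_gt0.
have [X0 X1 pot] := slowly_varying_potter hu b0.
have X00 : 0 < X0 by apply: lt_le_trans X1.
move=> E; split.
  near=> n.
  have x1 : 1 <= n%:R :> R by near: n; exact: near_natr_ge.
  have xX : X0 <= n%:R :> R by near: n; exact: near_natr_ge.
  have big : (c3 * (u X0 * X0 `^ b))^-1 <= n%:R `^ sigma.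
    by near: n; apply: near_powR_ge.
  set x : R := n%:R in x1 xX big *.
  have x0 : 0 < x by apply: lt_le_trans x1.
  have uX := u0 X00.
  have [_ h] := pot _ _ (lexx X0) xX.
  have uP : u X0 * X0 `^ b <= u x * x `^ b.
    by move: h; rewrite powR_div // mulrA ler_pdivlMr ?powR_gt0.
  have KQ : x `^ (- sigma) <= c3 * (u X0 * X0 `^ b).
    have KQ0 : 0 < c3 * (u X0 * X0 `^ b).
      by apply: mulr_gt0 => //; apply: mulr_gt0 => //; exact: powR_gt0.
    by rewrite powRN -[leRHS]invrK lef_pV2 ?posrE ?invr_gt0 ?powR_gt0.
  rewrite /E -/x (@powRD _ x) ?(gt_eqF x0) ?implybT //.
  rewrite (_ : c3 * _ = x `^ (- th) * (c3 * (u x * x `^ b))); last first.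
    have -> : - lambda = - th + b by rewrite /b; ring.
    by rewrite (@powRD _ x) ?(gt_eqF x0) ?implybT //; ring.
  by rewrite ler_pM2l ?powR_gt0 //; apply: le_trans KQ _; rewrite ler_pM2l.
near=> n => t ty tn.
have x1 : 1 <= n%:R :> R by near: n; exact: near_natr_ge.
have x0 : 0 < n%:R :> R by apply: lt_le_trans x1.
have LX : X0 * (4 * g) <= log2 n%:R by near: n; exact: near_log2_ge.
set x : R := n%:R in x1 x0 LX tn ty *.
pose y : R := 2 ^+ t; have y0 : 0 < y by exact: exprn_gt0.
have Xy : X0 <= y by apply: le_trans ty; rewrite ler_pdivlMr.
rewrite (@level_weight y) // -/y /E.
have [_ h] := pot _ _ Xy tn.
have -> : th - lambda = b by [].
have h3 : y `^ b * u y <= x `^ b * u x.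
  by move: h; rewrite -/y powR_div // mulrA ler_pdivlMr ?powR_gt0 // => h; rewrite mulrC [leRHS]mulrC.
have -> : - lambda = b - th by rewrite /b; ring.
rewrite (@powRD _ x) ?(gt_eqF x0) ?implybT //.
apply: (@le_trans _ _ (c3 * (x `^ b * u x) * x `^ (- th))).
  by rewrite ler_pM2r ?powR_gt0 // ler_pM2l.
by rewrite le_eqVlt; apply/orP; left; apply/eqP; ring.
Unshelve. all: by end_near. Qed.

End targets.

(** * The entropy bound *)

Theorem theorem5 (R : realType)
  (p q : R) (hp : 1 < p) (hpq : p < q) (r0 : nat)
  (V : countType) (w wt : V -> R)
  (hw : forall x, 0 < w x) (hwt : forall x, 0 < wt x)
  (delta lambda mu_ gamma : R)
  (hdelta0 : 0 < delta) (hdelta : Num.max (q^-1 - p^-1) 0 < delta)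
  (hlambda : 0 <= lambda) (hmu : lambda <= mu_) (hgamma : 0 < gamma)
  (psi u : R -> R) (hpsi : slowly_varying psi) (hu : slowly_varying u)
  (c1 c2 c3 : R) (hc1 : 1 <= c1) (hc2 : 1 <= c2) (hc3 : 1 <= c3) :
  exists2 C : R, 0 < C &
  forall (e : rel V) (root : V),
    is_tree e ->
    (forall x, (counting (children e root x) <= c1%:E)%E) ->
  forall (d : measure_display) (T : measurableType d)
    (mes : {measure set T -> \bar R}) (Theta : set (set T)) (F : V -> set T),
    ae_partition mes Theta [set: T] ->
    set_bij [set: V] Theta F ->
  forall (X : set T -> set (T -> R)) (nX : set T -> (T -> R) -> R)
    (Y : set T -> set (T -> R)) (nY : set T -> (T -> R) -> R)
    (P : set (T -> R)),
    function_spaces mes p q X nX Y nY ->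
    null_subspace mes r0 X nX P ->
    assumption1 mes e root F X nX Y nY P w ->
    assumption2 mes F X nX Y nY P wt delta c2 ->
  forall (t0 : nat) (I : choiceType) (J : nat -> set I)
    (At : nat -> I -> set V) (i0 : I),
    (0 < t0)%N ->
    assumption3 e root w wt lambda mu_ gamma psi u c3 t0 J At ->
    J t0 = [set i0] ->
    min_vertex e root (At t0 i0) root ->
  forall Phat : (T -> R) -> T -> R,
    tree_projection mes e root F X nX Y nY P w root Phat ->
  \forall n \near \oo,
    (p^-1 - q^-1 < lambda ->
      (entropy_number (Xhat X Phat) (nX [set: T]) (Y [set: T]) (nY [set: T])
         id n <=
       (C * (n%:R `^ (q^-1 - p^-1)
             * log2 n%:R `^ (- lambda - q^-1 + p^-1) * u (log2 n%:R)))%:E)%E)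
    /\
    (lambda < p^-1 - q^-1 ->
      (entropy_number (Xhat X Phat) (nX [set: T]) (Y [set: T]) (nY [set: T])
         id n <=
       (C * (n%:R `^ (- lambda) * u n%:R))%:E)%E).
Proof.
pose th := p^-1 - q^-1; pose g := gamma + 1.
have g1 : 1 <= g by rewrite /g; lra.
have [p0 q0] : 0 < p /\ 0 < q by lra.
have u0 := slowly_varying_gt0 hu; have psi0 := slowly_varying_gt0 hpsi.
pose wl t := c3 * (2 `^ (- lambda * t%:R) * u (2 ^+ t)).
pose A := scale_const p q r0 delta c1 c2 (level_cost p q delta g) * (c3 * 2 `^ th).
pose good (E : nat -> R) :=
  (\forall n \near \oo, n%:R `^ (- th - delta / 8) <= E n) /\
  (\forall n \near \oo, forall t, log2 n%:R / (4 * g) <= 2 ^+ t ->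
     2 ^+ t <= n%:R :> R -> wl t * (2 ^+ t / n%:R) `^ th <= E n).
have sigma0 : 0 < delta / 8 by rewrite divr_gt0.
pose fast (n : nat) := n%:R `^ (q^-1 - p^-1) *
  log2 n%:R `^ (- lambda - q^-1 + p^-1) * u (log2 n%:R).
pose slow (n : nat) := n%:R `^ (- lambda) * u n%:R.
have [E goodE [C C0 EC]] : exists2 E, (th != lambda -> good E) & exists2 C, 0 < C &
    \forall n \near \oo, (th < lambda -> A * E n <= C * fast n) /\
      (lambda < th -> A * E n <= C * slow n).
  have [thl|lth|eqth] := ltgtP th lambda.
  - have [K K0 goodE] := target_fast hu g1 hc3 sigma0 thl.
    eexists; first by move=> _; exact: goodE.
    exists (`|A| * K + 1); first by rewrite ltr_wpDl // mulr_ge0 // ltW.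
    near=> n; split=> // _.
    have L0 : 0 < log2 n%:R :> R.
      by apply: lt_le_trans ltr01 _; near: n; exact: near_log2_ge.
    have -> : n%:R `^ (- th) * log2 n%:R `^ (th - lambda) * u (log2 n%:R) = fast n.
      by rewrite /fast /th; congr (_ `^ _ * _ `^ _ * _); ring.
    have f0 : 0 <= fast n by rewrite !mulr_ge0 ?powR_ge0 // ltW // u0.
    rewrite mulrA; apply: ler_wpM2r => //.
    apply: (@le_trans _ _ (`|A| * K)); last by rewrite lerDl.
    by rewrite ler_pM2r // ler_norm.
  - have goodE := target_slow hu g1 hc3 sigma0 lth.
    eexists; first by move=> _; exact: goodE.
    exists (`|A| * c3 + 1); first by rewrite ltr_wpDl // mulr_ge0 // (le_trans _ hc3).
    near=> n; split=> // _.
    have n0 : 0 < n%:R :> R.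
      by apply: lt_le_trans ltr01 _; near: n; exact: near_natr_ge.
    have f0 : 0 <= slow n by rewrite mulr_ge0 ?powR_ge0 // ltW // u0.
    rewrite -/(slow n) mulrA; apply: ler_wpM2r => //.
    apply: (@le_trans _ _ (`|A| * c3)); last by rewrite lerDl.
    by rewrite ler_wpM2r ?ler_norm // (le_trans _ hc3).
  (* neither rate is claimed for [th = lambda] *)
  - exists (fun=> 0); first by [].
    by exists 1 => //; near=> n.
exists C => // e root htree hchild d T mes Theta F hTheta hF X nX Y nY P hfs hP ha1 ha2.
move=> t0 I J At i0 t00 ha3 hJ [Aroot _] Phat hPhat.
have [C1 C11 nuC] := level_count_le gamma (le_trans ler01 hc3) hpsi.
have [lev [s [lev_root w_lev wt_lev sP s_nu]]] :=
  levels_ex hc3 hmu psi0 u0 ha3 hJ Aroot.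
have c30 : 0 <= c3 by exact: le_trans hc3.
have wl0 t : 0 < wl t.
  by apply: mulr_gt0; [exact: lt_le_trans hc3|rewrite mulr_gt0 ?powR_gt0 // u0 ?exprn_gt0].
have wl_mono t t' : (t <= t')%N -> wl t' <= c3 * wl t.
  by move=> tt'; have [_ _ _ mono _] := ha3; rewrite /wl ler_wpM2l // mono.
have w_max x : w x <= c3 * wl 0%N by apply: le_trans (w_lev x) (wl_mono _ _ _).
have wt_max x : wt x <= c3 * wl 0%N by apply: le_trans (wt_lev x) (wl_mono _ _ _).
have [eqth|neth] := eqVneq th lambda.
  by near=> n; rewrite -/th eqth ltxx.
have [E_low E_wl] := goodE neth.
have choice := scale_choice r0 t0 hp hpq hdelta0 hc1 hc2 g1 hc3 (le_trans ler01 C11)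
  (mulr_ge0 c30 (ltW (wl0 0%N))) wl0 wl_mono nuC E_low E_wl.
near=> n.
have [t1 [te [M [N1 [Kw [Lb [t01 sc]]]]]]] : exists t1 te M N1 Kw Lb, (t0 <= t1)%N /\
    scale_conditions p q r0 delta c1 c2 wl
      (fun t => c3 * (2 `^ (gamma * 2 ^+ t) * psi (2 ^+ (2 ^ t)%N))) (c3 * wl 0%N)
      n t1 te M N1 Kw Lb (level_cost p q delta g) (c3 * 2 `^ th * E n).
  by near: n.
have [fastC slowC] : (th < lambda -> A * E n <= C * fast n) /\
    (lambda < th -> A * E n <= C * slow n) by near: n.
have root_t1 : (lev root <= t1)%N by rewrite lev_root.
have := scale_entropy hp hpq hdelta0 hc1 hc2 hw hwt htree hchild hTheta hF hfs hP
  ha1 ha2 hPhat (w_lev : forall x, w x <= wl (lev x)) wt_lev sP s_nu w_max wt_max root_t1 sc.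
rewrite mulrA -/A => ent.
split=> [thl|lth]; apply: le_trans ent _; rewrite lee_fin.
- exact: fastC.
- exact: slowC.
Unshelve. all: by end_near. Qed.
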